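(* Let $k$ be an algebraically closed field of characteristic $p>3$, let $L$ be a simple restricted Lie algebra of Cartan type over $k$ (that is, $L=W(n)$ with $n\ge 1$, $L=S(n)$ with $n\geq 2$, $L=H(2m)$ with $m\geq 2$, or $L=K(2m+1)$ with $m\ge 1$), and let $G=\mathrm{Aut}(L)$ be the automorphism group of $L$, acting on $L^*$ by the coadjoint representation. Then $$k[L^*]^G=k,$$ i.e. the only $G$-invariant polynomial functions on $L^*$ are the constants.
   Context: Let $A(n)=k[X_1,\dots,X_n]/(X_1^p,\dots,X_n^p)$ with $x_i$ the image of $X_i$. $W(n)$ is the Lie algebra of $k$-derivations of $A(n)$ under the commutator; it is a free $A(n)$-module with basis $\partial_1,\dots,\partial_n$, where $\partial_i$ is partial differentiation with respect to $x_i$. $W(n)$ acts on every exterior power of the module $\Omega_{A(n)/k}$ of Kähler differentials by Lie derivative: $\partial(df)=d(\partial(f))$, $\partial(f\omega)=\partial(f)\omega+f\partial(\omega)$, and derivation rule on wedge products. For a Lie algebra $M$ write $M^{(1)}=[M,M]$ and $M^{(2)}=[M^{(1)},M^{(1)}]$. The simple restricted Lie algebras of Cartan type are: (W) $W(n)$, $n\geq1$. (S) For $n\ge 2$ let $\widehat S(n)=\{\partial\in W(n): \partial(dx_1\wedge\dots\wedge dx_n)=0\}$, equivalently $\sum_i\partial_i(\partial(x_i))=0$. The special algebra is $S(n)=\widehat S(n)^{(1)}$ if $n\ge3$ and $S(2)=\widehat S(2)^{(2)}$. (H) For $m\ge 2$ let $\widehat H(2m)=\{\partial\in W(2m): \partial(\sum_{i=1}^m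 dx_i\wedge dx_{2m+1-i})=0\}$. The Hamiltonian algebra is $H(2m)=\widehat H(2m)^{(1)}$. (K) For $m\ge1$ put $\omega_K=\sum_{i=1}^m(x_i\,dx_{2m+1-i}-x_{2m+1-i}\,dx_i)+dx_{2m+1}$ and $\widehat K(2m+1)=\{\partial\in W(2m+1):\partial(\omega_K)\in A(2m+1)\,\omega_K\}$. The contact algebra is $K(2m+1)=\widehat K(2m+1)^{(1)}$. Coadjoint representation: $(g.\chi)(x)=\chi(g^{-1}(x))$ for $g\in G$, $\chi\in L^*$, $x\in L$. $k[L^*]$ is the algebra of polynomial functions on the vector space $L^*$, and $k[L^*]^G$ is its subalgebra of functions $f$ with $f(g.\chi)=f(\chi)$ for all $g\in G$, $\chi\in L^*$. *)

(* Defs.v *)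
From HB Require Import structures.
From mathcomp Require Import all_boot all_order all_algebra ring_quotient.
From mathcomp Require Import ring.
From mathcomp Require Import mpoly.

Set Implicit Arguments.
Unset Strict Implicit.
Unset Printing Implicit Defensive.

Import GRing.Theory.
Local Open Scope ring_scope.
Local Open Scope quotient_scope.

Section TruncatedIdeal.

Variables (k : fieldType) (p : nat) (chp : p \in [pchar k]) (n : nat).
Implicit Types (f g : {mpoly k[n]}) (m : 'X_{1..n}).

(* Membership in the ideal (X_1^p, .., X_n^p), in decidable form: see
   trunc_idealP. The unused proof of p \in [pchar k] guarantees that the
   ideal is proper. *)
Definition trunc_ideal (_ : p \in [pchar k]) : {pred {mpoly k[n]}} :=
  fun f => all (fun m => [exists i, (p <= m i)%N]) (msupp f).

Local Notation I := (trunc_ideal chp).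

Lemma trunc_ideal_coeff f :
  reflect (forall m, (forall i, (m i < p)%N) -> f@_m = 0) (f \in I).
Proof.
apply: (iffP allP) => [If m ltm | If m].
  apply: memN_msupp_eq0; apply/negP => /If /existsP[i].
  by rewrite leqNgt ltm.
apply: contraTT; rewrite negb_exists => /forallP ltm.
by rewrite -mcoeff_eq0 If // => i; rewrite ltnNge.
Qed.

Lemma trunc_idealP f :
  reflect (exists g : 'I_n -> {mpoly k[n]}, f = \sum_i g i * 'X_i ^+ p)
          (f \in I).
Proof.
apply: (iffP idP) => [/allP If | [g ->]]; last first.
  apply/trunc_ideal_coeff => m ltm; rewrite raddf_sum /= big1 // => i _.
  rewrite mpolyXn mcoeffM big1 // => -[m1 m2] /= /eqP Dm.
  rewrite mcoeffX; case: eqP => [Dm2|]; last by rewrite mulr0.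
  have := ltm i; have ->: m i = (m1 i + m2 i)%N by rewrite [in LHS]Dm mnmDE.
  by rewrite -Dm2 mulmnE mnm1E eqxx mul1n ltnNge leq_addl.
have: forall s : seq 'X_{1..n}, {subset s <= msupp f} ->
  exists g : 'I_n -> {mpoly k[n]},
    \sum_(m <- s) f@_m *: 'X_[m] = \sum_i g i * 'X_i ^+ p.
  elim=> [_|m s IHs sub_s].
    by exists (fun=> 0); rewrite big_nil big1 // => i _; rewrite mul0r.
  have [|g Dg] := IHs; first by move=> m' sm'; rewrite sub_s // inE sm' orbT.
  have /If/existsP[i le_p] : m \in msupp f by rewrite sub_s // mem_head.
  exists (fun j => g j + (if j == i then f@_m *: 'X_[m - U_(i) *+ p] else 0)).
  rewrite big_cons Dg (eq_bigr _ (fun j _ => mulrDl _ _ _)) big_split /= addrC.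
  congr (_ + _); rewrite (bigD1 i) //= eqxx big1 ?addr0.
    rewrite mpolyXn -scalerAl -mpolyXD submK //.
    apply/mnm_lepP => j; rewrite mulmnE mnm1E.
    by case: eqP => [<-|]; rewrite ?mul1n ?mul0n.
  by move=> j /negPf->; rewrite mul0r.
by move=> /(_ (msupp f))[//|g Dg]; exists g; rewrite -Dg -mpolyE.
Qed.

Lemma trunc_ideal_closed : idealr_closed I.
Proof.
split=> [| |a u v /trunc_idealP[g ->] /trunc_idealP[h ->]].
- by apply/trunc_ideal_coeff => m _; rewrite mcoeff0.
- apply/negP => /trunc_ideal_coeff/(_ 0%MM) I1; have /eqP := oner_neq0 k.
  by rewrite -I1 ?mcoeff1 ?eqxx // => i; rewrite mnmE prime_gt0 ?(pcharf_prime chp).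
apply/trunc_idealP; exists (fun i => a * g i + h i).
rewrite mulr_sumr -big_split; apply: eq_bigr => i _ /=.
by rewrite mulrDl mulrA.
Qed.

HB.instance Definition _ :=
  isIdealr.Build {mpoly k[n]} (trunc_ideal chp) trunc_ideal_closed.

End TruncatedIdeal.

Section TruncatedAlgebra.

Variables (k : fieldType) (p : nat) (chp : p \in [pchar k]) (n : nat).

(* k[X_1, .., X_n] / (X_1^p, .., X_n^p); tvar i below is the class of X_i. *)
Definition trunc : Type := {ideal_quot @trunc_ideal k p n chp}.

HB.instance Definition _ := GRing.ComNzRing.on trunc.


Definition trunc_scale (c : k) (a : trunc) : trunc := \pi_trunc c%:MP * a.

Fact trunc_scaleA c d a :
  trunc_scale c (trunc_scale d a) = trunc_scale (c * d) a.
Proof. by rewrite /trunc_scale mulrA mpolyCM rmorphM. Qed.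

Fact trunc_scale1 : left_id 1 trunc_scale.
Proof. by move=> a; rewrite /trunc_scale rmorph1 mul1r. Qed.

Fact trunc_scaleDr : right_distributive trunc_scale +%R.
Proof. by move=> c a b; rewrite /trunc_scale mulrDr. Qed.

Fact trunc_scaleDl a : {morph trunc_scale^~ a : c d / c + d}.
Proof. by move=> c d; rewrite /trunc_scale mpolyCD rmorphD mulrDl. Qed.

HB.instance Definition _ := GRing.Zmodule_isLmodule.Build k trunc
  trunc_scaleA trunc_scale1 trunc_scaleDr trunc_scaleDl.

Fact trunc_scaleAl (c : k) (a b : trunc) : c *: (a * b) = c *: a * b.
Proof. exact: mulrA. Qed.

HB.instance Definition _ := GRing.Lmodule_isLalgebra.Build k trunc trunc_scaleAl.

Fact trunc_scaleAr (c : k) (a b : trunc) : c *: (a * b) = a * (c *: b).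
Proof. exact: mulrCA. Qed.

HB.instance Definition _ := GRing.Lalgebra_isAlgebra.Build k trunc trunc_scaleAr.

Definition tclass (f : {mpoly k[n]}) : trunc := \pi_trunc f.

Fact tclass_is_zmod_morphism : zmod_morphism tclass.
Proof. exact: raddfB. Qed.
Fact tclass_is_monoid_morphism : monoid_morphism tclass.
Proof. by split; [exact: rmorph1 | exact: rmorphM]. Qed.
Fact tclass_is_scalable : scalable tclass.
Proof. by move=> c f; rewrite -mul_mpolyC /tclass rmorphM. Qed.

HB.instance Definition _ := GRing.isZmodMorphism.Build _ _ tclass
  tclass_is_zmod_morphism.
HB.instance Definition _ := GRing.isMonoidMorphism.Build _ _ tclass
  tclass_is_monoid_morphism.
HB.instance Definition _ := GRing.isScalable.Build _ _ _ _ tclass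
  tclass_is_scalable.

Lemma tclass_eq f g : (tclass f == tclass g) = (f - g \in trunc_ideal chp).
Proof. by rewrite Quotient.idealrBE. Qed.

Lemma tclass_surj (a : trunc) : exists f, a = tclass f.
Proof. by exists (repr a); rewrite /tclass reprK. Qed.

Definition tvar (i : 'I_n) : trunc := tclass 'X_i.

Local Notation expo := {ffun 'I_n -> 'I_p}.
Let emon (e : expo) : 'X_{1..n} := [multinom (e i : nat) | i < n].
Let coords (a : trunc) : 'rV[k]_#|expo| :=
  \row_j (repr a)@_(emon (enum_val j)).

Let coordsE f j : coords (tclass f) 0 j = f@_(emon (enum_val j)).
Proof.
rewrite mxE; apply/eqP; rewrite -subr_eq0 -mcoeffB; apply/eqP.
have /trunc_ideal_coeff : repr (tclass f) - f \in trunc_ideal chp.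
  by rewrite -tclass_eq /tclass reprK.
by apply=> i; rewrite mnmE ltn_ord.
Qed.

Fact trunc_vect_axiom : Vector.axiom #|expo| trunc.
Proof.
exists coords.
  move=> c a b; have [[f ->] [g ->]] := (tclass_surj a, tclass_surj b).
  rewrite -linearP; apply/rowP => j; rewrite coordsE mcoeffD mcoeffZ.
  by rewrite -!coordsE !mxE.
exists (fun r : 'rV_#|expo| => tclass (\sum_j r 0 j *: 'X_[emon (enum_val j)])) => [a | r].
  have [f ->] := tclass_surj a; apply/eqP; rewrite tclass_eq.
  apply/trunc_ideal_coeff => m ltm; apply/eqP; rewrite mcoeffB subr_eq0.
  pose e : expo := [ffun i => Ordinal (ltm i)].
  have De : emon e = m by apply/mnmP => i; rewrite mnmE ffunE.
  rewrite raddf_sum (bigD1 (enum_rank e)) //= enum_rankK mcoeffZ coordsE.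
  rewrite enum_rankK De mcoeffX eqxx mulr1 big1 ?addr0 // => j.
  apply: contraNeq; rewrite mcoeffZ mcoeffX.
  case: (emon _ =P m) => [Dm _|]; last by rewrite mulr0 eqxx.
  apply/eqP/enum_val_inj; rewrite enum_rankK; apply/ffunP => i; apply: val_inj.
  by have /mnmP/(_ i) := etrans Dm (esym De); rewrite !mnmE.
apply/rowP => j; rewrite coordsE raddf_sum (bigD1 j) //= mcoeffZ mcoeffX eqxx.
rewrite mulr1 big1 ?addr0 // => l; apply: contraNeq; rewrite mcoeffZ mcoeffX.
case: (emon _ =P emon _) => [Dm _|]; last by rewrite mulr0 eqxx.
apply/eqP/enum_val_inj/ffunP => i; apply: val_inj.
by have /mnmP/(_ i) := Dm; rewrite !mnmE.
Qed.

HB.instance Definition _ := Lmodule_hasFinDim.Build k trunc trunc_vect_axiom.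

Lemma tclass_mderiv i f g :
  tclass f = tclass g -> tclass f^`M(i) = tclass g^`M(i).
Proof.
move=> /eqP; rewrite tclass_eq => /trunc_idealP[h Dfg].
apply/eqP; rewrite tclass_eq -mderivB Dfg; apply/trunc_idealP.
exists (fun j => (h j)^`M(i)); rewrite raddf_sum; apply: eq_bigr => j _ /=.
rewrite mderivM mpolyXn mderivX mulmnE.
by rewrite natrM (pcharf0 chp) mulr0 scale0r mulr0 addr0.
Qed.

(* Independent of the representative, by pderiv_funE. *)
Definition pderiv_fun (i : 'I_n) (a : trunc) : trunc := tclass (repr a)^`M(i).

Lemma pderiv_funE i f : pderiv_fun i (tclass f) = tclass f^`M(i).
Proof. by apply: tclass_mderiv; rewrite /tclass reprK. Qed.

Fact pderiv_is_linear i : linear (pderiv_fun i).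
Proof.
move=> c a b; have [[f ->] [g ->]] := (tclass_surj a, tclass_surj b).
by rewrite -linearP !pderiv_funE mderivD mderivZ linearP.
Qed.
HB.instance Definition _ i := GRing.isLinear.Build _ _ _ _ (pderiv_fun i)
  (pderiv_is_linear i).

Definition pderiv i : 'End(trunc) := linfun (pderiv_fun i).

End TruncatedAlgebra.

Section DifferentialForms.

Variables (k : fieldType) (p : nat) (chp : p \in [pchar k]) (n : nat).

Local Notation A := (trunc chp n).
Local Notation x := (@tvar k p chp n).
Local Notation "''d_' i" := (@pderiv k p chp n i) (at level 8, i at level 2).

Implicit Types (i j : 'I_n) (S T U : {set 'I_n}) (a b c : A).

Lemma pderivE i f : 'd_i (tclass chp f) = tclass chp f^`M(i).
Proof. by rewrite lfunE /= pderiv_funE. Qed.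

Lemma tclassC (c : k) : tclass chp c%:MP = c%:A :> A.
Proof. exact/esym/mulr1. Qed.

Lemma pderivM i a b : 'd_i (a * b) = 'd_i a * b + a * 'd_i b.
Proof.
have [[f ->] [g ->]] := (tclass_surj a, tclass_surj b).
by rewrite -rmorphM !pderivE mderivM rmorphD !rmorphM.
Qed.

Lemma pderiv_var i j : 'd_i (x j) = (i == j)%:R.
Proof.
rewrite pderivE mderivX mnm1E eq_sym.
have [<-|_] := eqVneq i j; last by rewrite scale0r rmorph0.
have -> : (U_(i) - U_(i))%MM = 0%MM :> 'X_{1..n} by apply/mnmP=> l; rewrite mnmBE subnn mnm0E.
by rewrite scale1r mpolyX0 rmorph1.
Qed.

Lemma pderivC i j a : 'd_i ('d_j a) = 'd_j ('d_i a).
Proof. by have [f ->] := tclass_surj a; rewrite !pderivE mderiv_comm. Qed.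

Lemma trunc_gen (P : A -> Prop) :
    (forall c : k, P c%:A) -> (forall i, P (x i)) ->
    (forall a b, P a -> P b -> P (a + b)) ->
    (forall a b, P a -> P b -> P (a * b)) -> forall a, P a.
Proof.
move=> PC PX PD PM a; have [f ->] := tclass_surj a; rewrite [f]mpolyE raddf_sum.
have P1: P 1 by rewrite -[1]scale1r.
apply: (big_ind P) => [||m _] //=; first by rewrite -(scale0r 1).
rewrite linearZ /= -[tclass _ _]mul1r scalerAl; apply: (PM) => //.
rewrite mpolyXE_id rmorph_prod; apply: (big_ind P); [exact: P1 | exact: PM | move=> i _ /=].
rewrite rmorphXn /=; elim: (m i) => [|l IHl]; first exact: P1.
by rewrite exprS; apply: (PM) => //; apply: PX.
Qed.

(* The universal property of the differentials: a k-derivation of A into an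
   A-module factors through d a = \sum_i 'd_i a dx_i, which justifies taking
   for Omega^1 the free A-module on the dx_i. *)
Lemma derivation_expand (M : lmodType A) (delta : A -> M) :
    {morph delta : a b / a + b} -> (forall c : k, delta c%:A = 0) ->
    (forall a b, delta (a * b) = a *: delta b + b *: delta a) ->
  forall a, delta a = \sum_i 'd_i a *: delta (x i).
Proof.
move=> dD dC dM; elim/trunc_gen => [c|i|a b IHa IHb|a b IHa IHb].
- rewrite dC big1 // => i _.
  by rewrite -tclassC pderivE mderivC rmorph0 scale0r.
- by rewrite (bigD1 i) //= pderiv_var eqxx scale1r big1 ?addr0 // => j /negPf ji; rewrite pderiv_var ji scale0r.
- by rewrite dD IHa IHb -big_split; apply: eq_bigr => i _; rewrite linearD scalerDl.
rewrite dM IHa IHb !scaler_sumr -big_split; apply: eq_bigr => i _ /=.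
by rewrite pderivM scalerDl !scalerA addrC [b * _]mulrC.
Qed.

Lemma derivation_vars (D : A -> A) :
    {morph D : a b / a + b} -> (forall c : k, D c%:A = 0) ->
    (forall a b, D (a * b) = D a * b + a * D b) ->
  forall a, D a = \sum_i D (x i) * 'd_i a.
Proof.
move=> DD DC DM a; rewrite (@derivation_expand A^o D) //.
  by apply: eq_bigr => i _; rewrite mulrC.
by move=> {a} a b; rewrite DM addrC [D a * b]mulrC.
Qed.

(* The full exterior algebra of the module of differentials: w S is the
   coefficient in w of dx_i1 /\ .. /\ dx_ir, for S = {i1 < .. < ir}. *)
Definition forms : Type := {ffun {set 'I_n} -> A}.
HB.instance Definition _ := Vector.on forms.

Implicit Types (w v u : forms).

Definition inversions S T : nat := \sum_(i in S) \sum_(j in T) (j < i)%N.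

Definition wedge w v : forms :=
  [ffun U : {set 'I_n} => \sum_(S : {set 'I_n} | S \subset U)
     (-1) ^+ inversions S (U :\: S) * (w S * v (U :\: S))].

Definition fscale a w : forms := [ffun S : {set 'I_n} => a * w S].

Definition form1 : forms := [ffun S : {set 'I_n} => (S == set0)%:R].
Definition dx i : forms := [ffun S : {set 'I_n} => (S == [set i])%:R].
Definition dform a : forms := \sum_i fscale ('d_i a) (dx i).

Definition dmon (s : seq 'I_n) : forms := \big[wedge/form1]_(i <- s) dx i.

(* The Lie derivative along D, computed on the basis of monomials by the
   derivation rule, with dx_i sent to d (D x_i). When D is a derivation it
   satisfies the defining rules on all forms: lie_der_dform, lie_derZ and
   lie_der_wedge below. *)
Fixpoint lie_dmon (D : 'End(A)) (s : seq 'I_n) : forms :=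
  if s is i :: s' then
    wedge (dform (D (x i))) (dmon s') + wedge (dx i) (lie_dmon D s')
  else 0.

Definition lie_der (D : 'End(A)) w : forms :=
  \sum_S (fscale (D (w S)) (dmon (enum S))
          + fscale (w S) (lie_dmon D (enum S))).

(* Interior product with 'd_i. *)
Definition contr i w : forms :=
  [ffun S : {set 'I_n} =>
     if i \in S then 0 else (-1) ^+ inversions [set i] S * w (i |: S)].

Lemma inversionsUl S S' T : [disjoint S & S'] ->
  inversions (S :|: S') T = (inversions S T + inversions S' T)%N.
Proof. by move=> dS; rewrite /inversions (eq_bigl [predU S & S']) ?bigU // => i; rewrite !inE. Qed.

Lemma inversionsUr S T T' : [disjoint T & T'] ->
  inversions S (T :|: T') = (inversions S T + inversions S T')%N.
Proof.
move=> dT; rewrite -big_split; apply: eq_bigr => i _.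
by rewrite /= (eq_bigl [predU T & T']) ?bigU // => j; rewrite !inE.
Qed.

Lemma inversions11 i j : inversions [set i] [set j] = (j < i)%N.
Proof. by rewrite /inversions !big_set1. Qed.

Lemma wedgeA w v u : wedge w (wedge v u) = wedge (wedge w v) u.
Proof.
apply/ffunP => U; rewrite !ffunE.
under [RHS]eq_bigr do rewrite ffunE mulr_suml mulr_sumr.
rewrite (exchange_big_dep (fun T : {set 'I_n} => T \subset U)) /=; last first.
  by move=> S T sSU sTS; exact: subset_trans sTS sSU.
apply: eq_bigr => T sTU; rewrite ffunE !mulr_sumr.
rewrite [RHS](reindex_onto (fun R => T :|: R) (fun S => S :\: T)) /=; last first.
  by move=> S /andP[_ sTS]; rewrite -[RHS](setID S T) (setIidPr sTS).
apply: eq_big => [R | R sRU].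
  rewrite subUset sTU subsetUl andbT /= setDUl setDv set0U subsetD.
  by congr (_ && _); rewrite (sameP eqP setDidPl).
have dTR: [disjoint T & R] by move: sRU; rewrite subsetD disjoint_sym => /andP[].
have DR: (T :|: R) :\: T = R.
  by rewrite setDUl setDv set0U; apply/setDidPl; rewrite disjoint_sym.
have DV: U :\: T = R :|: ((U :\: T) :\: R).
  by rewrite -[in LHS](setID (U :\: T) R) (setIidPr sRU).
have dRV: [disjoint R & (U :\: T) :\: R].
  by rewrite -setI_eq0; apply/eqP/setP => i; rewrite !inE; case: (i \in R); rewrite ?andbF.
rewrite DR setDDl in DV dRV *.
rewrite DV (inversionsUr _ dRV) (inversionsUl _ dTR) !exprD.
set e1 := (-1) ^+ _; set e2 := (-1) ^+ _; set e3 := (-1) ^+ _.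
by ring.
Qed.

Lemma fscaleDr a w v : fscale a (w + v) = fscale a w + fscale a v.
Proof. by apply/ffunP => S; rewrite !ffunE mulrDr. Qed.

Lemma fscaleDl a b w : fscale (a + b) w = fscale a w + fscale b w.
Proof. by apply/ffunP => S; rewrite !ffunE mulrDl. Qed.

Lemma fscaleA a b w : fscale a (fscale b w) = fscale (a * b) w.
Proof. by apply/ffunP => S; rewrite !ffunE mulrA. Qed.

Lemma fscale1 w : fscale 1 w = w.
Proof. by apply/ffunP => S; rewrite ffunE mul1r. Qed.

Fact fscale_is_linear a : linear (fscale a).
Proof. by move=> c w v; apply/ffunP => S; rewrite !ffunE mulrDr scalerAr. Qed.
HB.instance Definition _ a := GRing.isLinear.Build k forms forms _ (fscale a)
  (@fscale_is_linear a).

Lemma wedgeDl w v u : wedge (w + v) u = wedge w u + wedge v u.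
Proof.
apply/ffunP => U; rewrite !ffunE -big_split; apply: eq_bigr => S _.
by rewrite ffunE mulrDl mulrDr.
Qed.

Lemma wedgeDr w v u : wedge w (v + u) = wedge w v + wedge w u.
Proof.
apply/ffunP => U; rewrite !ffunE -big_split; apply: eq_bigr => S _.
by rewrite ffunE mulrDr mulrDr.
Qed.

Lemma wedge_fscalel a w v : wedge (fscale a w) v = fscale a (wedge w v).
Proof.
apply/ffunP => U; rewrite !ffunE mulr_sumr; apply: eq_bigr => S _.
by rewrite ffunE; ring.
Qed.

Lemma wedge_fscaler a w v : wedge w (fscale a v) = fscale a (wedge w v).
Proof.
apply/ffunP => U; rewrite !ffunE mulr_sumr; apply: eq_bigr => S _.
by rewrite ffunE; ring.
Qed.

Lemma fscale0l w : fscale 0 w = 0.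
Proof. by apply/ffunP => S; rewrite !ffunE mul0r. Qed.

Lemma wedge0l w : wedge 0 w = 0.
Proof. by rewrite -{1}(fscale0l 0) wedge_fscalel fscale0l. Qed.

Lemma wedge0r w : wedge w 0 = 0.
Proof. by rewrite -{1}(fscale0l 0) wedge_fscaler fscale0l. Qed.

Lemma fscaleN a w : fscale a (- w) = - fscale a w.
Proof. by rewrite linearN. Qed.

Lemma wedgeNl w v : wedge (- w) v = - wedge w v.
Proof. by apply/eqP; rewrite -addr_eq0 -wedgeDl addNr wedge0l. Qed.

Lemma wedgeNr w v : wedge w (- v) = - wedge w v.
Proof. by apply/eqP; rewrite -addr_eq0 -wedgeDr addNr wedge0r. Qed.

Lemma wedge_suml (I : Type) (r : seq I) (F : I -> forms) w :
  wedge (\sum_(i <- r) F i) w = \sum_(i <- r) wedge (F i) w.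
Proof. by apply: (big_morph (wedge^~ w)) => [v u|]; rewrite (wedgeDl, wedge0l). Qed.

Lemma wedge_sumr (I : Type) (r : seq I) (F : I -> forms) w :
  wedge w (\sum_(i <- r) F i) = \sum_(i <- r) wedge w (F i).
Proof. by apply: (big_morph (wedge w)) => [v u|]; rewrite (wedgeDr, wedge0r). Qed.

Lemma inversions0 S : inversions set0 S = 0%N.
Proof. by rewrite /inversions big_set0. Qed.

Lemma wedge1l w : wedge form1 w = w.
Proof.
apply/ffunP => U; rewrite ffunE (bigD1 set0) ?sub0set //= ffunE eqxx setD0.
rewrite inversions0 !mul1r big1 ?addr0 // => S /andP[_ /negPf S0].
by rewrite ffunE S0 mul0r mulr0.
Qed.

Lemma wedge_dxE i w U : wedge (dx i) w U =
  if i \in U then (-1) ^+ inversions [set i] (U :\ i) * w (U :\ i) else 0.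
Proof.
rewrite ffunE; case: ifP => iU.
  rewrite (bigD1 [set i]) ?sub1set //= ffunE eqxx mul1r big1 ?addr0 // => S.
  by case/andP=> _ /negPf Si; rewrite ffunE Si mul0r mulr0.
rewrite big1 // => S sSU; rewrite ffunE; case: eqP => [DS|]; last first.
  by rewrite mul0r mulr0.
by rewrite DS sub1set iU in sSU.
Qed.

Lemma dmon_cons i s : dmon (i :: s) = wedge (dx i) (dmon s).
Proof. by rewrite /dmon big_cons. Qed.

Lemma dmon_sorted (s : seq 'I_n) : sorted ltn (map val s) ->
  dmon s = [ffun S => (S == [set i in s])%:R].
Proof.
elim: s => [_ | i s IHs] /=.
  rewrite /dmon big_nil; apply/ffunP => S; rewrite !ffunE.
  by congr (_ == _)%:R; apply/setP => i; rewrite !inE.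
rewrite path_sortedE; last exact: ltn_trans.
move=> /andP[/allP gt_i /IHs Ds].
have inv0: inversions [set i] [set j in s] = 0%N.
  rewrite /inversions big_set1 big1 // => j; rewrite inE => sj.
  have lt_ij: (i < j)%N by apply: gt_i; apply: map_f.
  by rewrite ltnNge ltnW.
have nis: i \notin [set j in s].
  by rewrite inE; apply/negP => /(map_f val)/gt_i /=; rewrite ltnn.
apply/ffunP => U; rewrite dmon_cons wedge_dxE Ds !ffunE.
have -> : [set j in i :: s] = i |: [set j in s] by apply/setP => j; rewrite !inE.
case: ifP => iU.
  have -> : (U == i |: [set j in s]) = (U :\ i == [set j in s]).
    apply/eqP/eqP => [->|<-]; last by rewrite setD1K.
    by rewrite setU1K.
  by case: eqP => [->|_]; rewrite ?mulr0 // inv0 mulr1.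
by case: eqP => // DU; rewrite DU setU11 in iU.
Qed.

Lemma dmon_enum S : dmon (enum S) = [ffun T => (T == S)%:R].
Proof.
rewrite dmon_sorted; last first.
  rewrite /enum_mem -enumT sorted_map.
  apply: sorted_filter; first by move=> i j l; apply: ltn_trans.
  by rewrite -sorted_map val_enum_ord iota_ltn_sorted.
by apply/ffunP => T; rewrite !ffunE; congr (_ == _)%:R; apply/setP => i; rewrite inE mem_enum.
Qed.

Lemma forms_dmon w : w = \sum_S fscale (w S) (dmon (enum S)).
Proof.
apply/ffunP => T; rewrite sum_ffunE (bigD1 T) //= dmon_enum !ffunE eqxx mulr1.
rewrite big1 ?addr0 // => S; rewrite eq_sym => /negPf TS.
by rewrite dmon_enum !ffunE TS mulr0.
Qed.

Lemma forms_ind (P : forms -> Prop) :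
    P form1 -> (forall w v, P w -> P v -> P (w + v)) ->
    (forall a w, P w -> P (fscale a w)) ->
    (forall i w, P w -> P (wedge (dx i) w)) ->
  forall w, P w.
Proof.
move=> P1 PD PZ Pdx w; rewrite (forms_dmon w).
apply: (big_ind P) => [||S _]; [|exact: PD|].
  by rewrite -(fscale0l form1); apply: PZ.
apply: PZ; elim: (enum S) => [|i s IHs]; first by rewrite /dmon big_nil.
by rewrite dmon_cons; apply: Pdx.
Qed.

Lemma dx_anticomm i j : wedge (dx i) (dx j) = - wedge (dx j) (dx i).
Proof.
apply/ffunP => U; rewrite [RHS]ffunE !wedge_dxE !ffunE.
have eqU (i' j' : 'I_n) : i' \in U -> (U :\ i' == [set j']) = (i' != j') && (U == [set i'; j']).
  move=> iU; apply/eqP/andP => [DU|[nij /eqP->]].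
    have: j' \in U :\ i' by rewrite DU set11.
    by rewrite !inE eq_sym => /andP[-> _]; rewrite -DU setD1K.
  by rewrite setU1K // inE.
case: ifP => iU; case: ifP => jU; rewrite ?oppr0 //.
- rewrite !eqU // [j == i]eq_sym [[set j; i]]setUC.
  have [|] := eqVneq i j; first by rewrite !mulr0 oppr0.
  move=> nij /=; case: eqP => [->|]; last by rewrite !mulr0 oppr0.
  rewrite setU1K ?inE // [[set i; j]]setUC setU1K ?inE 1?eq_sym //.
  rewrite !inversions11 !mulr1.
  by case: (ltngtP i j) nij => [||/val_inj->]; rewrite ?eqxx //= expr0 expr1 ?opprK.
- rewrite eqU //; case: (U =P _) => [DU|_]; last by rewrite andbF mulr0.
  by rewrite DU !inE eqxx orbT in jU.
rewrite eqU //; case: (U =P _) => [DU|_]; last by rewrite andbF mulr0 oppr0.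
by rewrite DU !inE eqxx orbT in iU.
Qed.

Fact contr_is_linear i : linear (contr i).
Proof.
move=> c w v; apply/ffunP => S; rewrite !ffunE.
by case: ifP => _; rewrite ?scaler0 ?addr0 // mulrDr scalerAr.
Qed.
HB.instance Definition _ i := GRing.isLinear.Build k forms forms _ (contr i)
  (@contr_is_linear i).

Lemma contr_fscale i a w : contr i (fscale a w) = fscale a (contr i w).
Proof.
by apply/ffunP => S; rewrite !ffunE; case: ifP => _; rewrite ?mulr0 // mulrCA.
Qed.

Lemma contr_form1 i : contr i form1 = 0.
Proof.
apply/ffunP => S; rewrite !ffunE; case: ifP => // _.
case: eqP => [S0|_]; last by rewrite mulr0.
by have := setU11 i S; rewrite S0 inE.
Qed.

Lemma contr_dx i j w :
  contr i (wedge (dx j) w) = fscale (i == j)%:R w - wedge (dx j) (contr i w).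
Proof.
apply/ffunP => S; rewrite [LHS]ffunE wedge_dxE [RHS]ffunE [X in _ + X]ffunE.
rewrite wedge_dxE ffunE; have [<-{j}|nij] := eqVneq i j.
  rewrite mul1r setU11 ffunE setD11; case: ifP => iS.
    by rewrite setD1K // mulrA -expr2 sqrr_sign mul1r subrr.
  by rewrite setU1K ?iS // mulrA -expr2 sqrr_sign mul1r subr0.
rewrite mul0r sub0r !inE eq_sym (negPf nij) /= ffunE !inE nij /=.
have [iS|niS] := boolP (i \in S).
  by case: ifP; rewrite ?mulr0 oppr0.
have [jS|njS] := boolP (j \in S); last by rewrite mulr0 oppr0.
have ->: (i |: S) :\ j = i |: (S :\ j).
  by apply/setP => l; rewrite !inE; case: (l =P j) => // ->; rewrite eq_sym (negPf nij).
have dj: [disjoint [set j] & S :\ j] by rewrite disjoints1 setD11.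
have di: [disjoint [set i] & S :\ j] by rewrite disjoints1 !inE (negPf niS) andbF.
rewrite -{1}(setD1K jS) (inversionsUr _ dj) (inversionsUr _ di) !inversions11.
rewrite !exprD; case: (ltngtP i j) nij => [||/val_inj->]; rewrite ?eqxx //= => _ _; ring.
Qed.

Lemma dform_dx_anticomm a j w :
  wedge (dform a) (wedge (dx j) w) = - wedge (dx j) (wedge (dform a) w).
Proof.
rewrite !wedgeA -wedgeNl; congr (wedge _ w).
rewrite wedge_suml wedge_sumr -sumrN; apply: eq_bigr => i _.
by rewrite wedge_fscalel wedge_fscaler dx_anticomm fscaleN.
Qed.

Implicit Type D : 'End(A).

Definition is_deriv D := forall a b, D (a * b) = D a * b + a * D b.

Lemma deriv1 (D : 'End(A)) : is_deriv D -> D 1 = 0.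
Proof.
move=> DM; have /eqP := DM 1 1.
by rewrite !mulr1 mul1r -subr_eq0 opprD addrA subrr sub0r oppr_eq0 => /eqP.
Qed.

Lemma deriv_expand (D : 'End(A)) a :
  is_deriv D -> D a = \sum_i D (x i) * 'd_i a.
Proof.
move=> DM; apply: derivation_vars => // [b c | c]; first exact: linearD.
by rewrite linearZ /= deriv1 // scaler0.
Qed.

Lemma lie_dmonE (D : 'End(A)) s :
  lie_dmon D s = \sum_i wedge (dform (D (x i))) (contr i (dmon s)).
Proof.
elim: s => [|j s IHs] /=.
  by rewrite /dmon big_nil big1 // => i _; rewrite contr_form1 wedge0r.
rewrite IHs dmon_cons wedge_sumr.
have -> : wedge (dform (D (x j))) (dmon s) =
  \sum_i wedge (dform (D (x i))) (fscale (i == j)%:R (dmon s)).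
  rewrite (bigD1 j) //= eqxx fscale1 big1 ?addr0 // => i /negPf->.
  by rewrite fscale0l wedge0r.
rewrite -big_split; apply: eq_bigr => i _ /=.
by rewrite contr_dx wedgeDr wedgeNr dform_dx_anticomm opprK.
Qed.

Definition coef_der (D : 'End(A)) w : forms := [ffun S => D (w S)].

Lemma lie_derE (D : 'End(A)) w :
  lie_der D w =
    coef_der D w + \sum_i wedge (dform (D (x i))) (contr i w).
Proof.
rewrite /lie_der big_split /=; congr (_ + _).
  rewrite [RHS]forms_dmon; apply: eq_bigr => S _; by rewrite ffunE.
under eq_bigr do rewrite lie_dmonE linear_sum.
rewrite exchange_big; apply: eq_bigr => i _ /=.
rewrite [in RHS](forms_dmon w) linear_sum wedge_sumr; apply: eq_bigr => S _.
by rewrite /= contr_fscale wedge_fscaler.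
Qed.

Fact dform_is_linear : linear dform.
Proof.
move=> c a b; rewrite /dform linear_sum -big_split; apply: eq_bigr => i _ /=.
by rewrite linearP fscaleDl; congr (_ + _); apply/ffunP => S; rewrite !ffunE scalerAl.
Qed.
HB.instance Definition _ := GRing.isLinear.Build k A forms _ dform
  dform_is_linear.

Lemma scale_fscale (c : k) w : c *: w = fscale c%:A w.
Proof. by apply/ffunP => S; rewrite !ffunE -scalerAl mul1r. Qed.

Fact lie_der_is_linear D : linear (lie_der D).
Proof.
move=> c w v; rewrite !lie_derE scalerDr addrACA; congr (_ + _).
  by apply/ffunP => S; rewrite !ffunE linearP.
rewrite scaler_sumr -big_split; apply: eq_bigr => i _ /=.
by rewrite linearP /= wedgeDr !scale_fscale wedge_fscaler.
Qed.
HB.instance Definition _ D := GRing.isLinear.Build k forms forms _ (lie_der D)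
  (@lie_der_is_linear D).

Lemma lie_derZ D a w : is_deriv D ->
  lie_der D (fscale a w) = fscale (D a) w + fscale a (lie_der D w).
Proof.
move=> DM; rewrite !lie_derE fscaleDr addrA; congr (_ + _).
  by apply/ffunP => S; rewrite !ffunE DM.
by rewrite linear_sum; apply: eq_bigr => i _; rewrite contr_fscale wedge_fscaler.
Qed.

Lemma lie_der_form1 D : is_deriv D -> lie_der D form1 = 0.
Proof.
move=> DM; rewrite lie_derE big1 => [|i _]; last by rewrite contr_form1 wedge0r.
rewrite addr0; apply/ffunP => S; rewrite !ffunE.
by case: eqP => _; rewrite ?linear0 // deriv1.
Qed.

Lemma lie_der_dxM D j w : is_deriv D ->
  lie_der D (wedge (dx j) w) =
    wedge (dform (D (x j))) w + wedge (dx j) (lie_der D w).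
Proof.
move=> DM; rewrite !lie_derE wedgeDr addrCA; congr (_ + _).
  apply/ffunP => S; rewrite [LHS]ffunE !wedge_dxE; case: ifP => _.
    by rewrite ffunE -signr_odd !mulr_sign; case: odd; rewrite ?linearN.
  by rewrite linear0.
have -> : wedge (dform (D (x j))) w =
  \sum_i wedge (dform (D (x i))) (fscale (i == j)%:R w).
  rewrite (bigD1 j) //= eqxx fscale1 big1 ?addr0 // => i /negPf->.
  by rewrite fscale0l wedge0r.
rewrite wedge_sumr -big_split; apply: eq_bigr => i _ /=.
by rewrite contr_dx wedgeDr wedgeNr dform_dx_anticomm opprK.
Qed.

Lemma wedge1r w : wedge w form1 = w.
Proof.
elim/forms_ind: w => [|w v IHw IHv|a w IHw|i w IHw]; first exact: wedge1l.
- by rewrite wedgeDl IHw IHv.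
- by rewrite wedge_fscalel IHw.
by rewrite -wedgeA IHw.
Qed.

Lemma lie_der_dx D j : is_deriv D -> lie_der D (dx j) = dform (D (x j)).
Proof.
move=> DM; rewrite -[dx j]wedge1r lie_der_dxM // lie_der_form1 // wedge0r addr0.
by rewrite wedge1r.
Qed.

Lemma lie_der_dform D a : is_deriv D -> lie_der D (dform a) = dform (D a).
Proof.
move=> DM; rewrite {1}/dform linear_sum.
under eq_bigr do rewrite /= lie_derZ // lie_der_dx //.
rewrite (deriv_expand a DM) linear_sum big_split /= addrC.
under [RHS]eq_bigr => i _.
  have -> : dform (D (x i) * 'd_i a) =
     fscale ('d_i a) (dform (D (x i))) + fscale (D (x i)) (dform ('d_i a)).
    rewrite /dform !linear_sum -big_split; apply: eq_bigr => j _ /=.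
    rewrite !fscaleA -fscaleDl pderivM; congr (fscale _ _); ring.
  over.
rewrite big_split /=; congr (_ + _).
under [RHS]eq_bigr do rewrite linear_sum.
rewrite exchange_big; apply: eq_bigr => j _ /=.
under [RHS]eq_bigr do rewrite fscaleA.
rewrite (deriv_expand _ DM).
rewrite -(big_morph (fscale^~ (dx j)) (fun b c => fscaleDl b c (dx j)) (fscale0l _)).
by congr (fscale _ _); apply: eq_bigr => i _; rewrite pderivC.
Qed.

Lemma lie_der_wedge D w v : is_deriv D ->
  lie_der D (wedge w v) = wedge (lie_der D w) v + wedge w (lie_der D v).
Proof.
move=> DM; elim/forms_ind: w => [|w u IHw IHu|a w IHw|i w IHw].
- by rewrite lie_der_form1 // wedge0l !wedge1l add0r.
- by rewrite wedgeDl !linearD /= IHw IHu !wedgeDl addrACA.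
- by rewrite !wedge_fscalel !lie_derZ // wedgeDl !wedge_fscalel IHw fscaleDr addrA.
by rewrite -!wedgeA !lie_der_dxM // IHw !(wedgeDl, wedgeDr, wedgeA) addrA.
Qed.

Lemma lie_derDl D E w : lie_der (D + E) w = lie_der D w + lie_der E w.
Proof.
rewrite !lie_derE addrACA -big_split; congr (_ + _).
  by apply/ffunP => S; rewrite !ffunE add_lfunE.
by apply: eq_bigr => i _; rewrite add_lfunE linearD wedgeDl.
Qed.

Lemma lie_derZl (c : k) D w : lie_der (c *: D) w = c *: lie_der D w.
Proof.
rewrite !lie_derE scalerDr scaler_sumr; congr (_ + _).
  by apply/ffunP => S; rewrite !ffunE scale_lfunE.
by apply: eq_bigr => i _; rewrite scale_lfunE linearZ /= !scale_fscale wedge_fscalel.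
Qed.

Definition lie_der_of w D : forms := lie_der D w.

Fact lie_der_of_is_linear w : linear (lie_der_of w).
Proof. by move=> c D E; rewrite /lie_der_of lie_derDl lie_derZl. Qed.
HB.instance Definition _ w := GRing.isLinear.Build k 'End(A) forms _
  (lie_der_of w) (@lie_der_of_is_linear w).

Definition fmulr w a : forms := fscale a w.

Fact fmulr_is_linear w : linear (fmulr w).
Proof.
move=> c a b; rewrite /fmulr fscaleDl; congr (_ + _).
by apply/ffunP => S; rewrite !ffunE scalerAl.
Qed.
HB.instance Definition _ w := GRing.isLinear.Build k A forms _
  (fmulr w) (@fmulr_is_linear w).

Definition leibniz_defect a b D : A := D (a * b) - (D a * b + a * D b).

Fact leibniz_defect_is_linear a b : linear (leibniz_defect a b).
Proof.
move=> c D E; rewrite /leibniz_defect !add_lfunE !scale_lfunE.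
by rewrite mulrDl mulrDr -scalerAl -scalerAr addrACA -scalerDr opprD addrACA scalerBr.
Qed.
HB.instance Definition _ a b := GRing.isLinear.Build k 'End(A) A _
  (leibniz_defect a b) (@leibniz_defect_is_linear a b).

(* The derivations of A (see mem_witt); Leibniz's rule on a basis. *)
Definition witt : {vspace 'End(A)} :=
  (\bigcap_(i < \dim {:A}) \bigcap_(j < \dim {:A})
     lker (linfun (leibniz_defect (vbasis {:A})`_i (vbasis {:A})`_j)))%VS.

Lemma mem_witt D : reflect (is_deriv D) (D \in witt).
Proof.
have memE a b : (D \in lker (linfun (leibniz_defect a b))) =
                (D (a * b) == D a * b + a * D b).
  by rewrite memv_ker lfunE /= subr_eq0.
apply: (iffP idP) => [WD | DM]; last first.
  rewrite memvE; apply/subv_bigcapP => i _; apply/subv_bigcapP => j _.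
  by rewrite -memvE memE DM.
have DB (i j : nat) : D ((vbasis {:A})`_i * (vbasis {:A})`_j) =
   D (vbasis {:A})`_i * (vbasis {:A})`_j + (vbasis {:A})`_i * D (vbasis {:A})`_j.
  have [lti|gei] := ltnP i (\dim {:A}); last first.
    by rewrite [_`_i]nth_default ?size_tuple // linear0 !mul0r linear0 addr0.
  have [ltj|gej] := ltnP j (\dim {:A}); last first.
    by rewrite [_`_j]nth_default ?size_tuple // linear0 !mulr0 linear0 addr0.
  apply/eqP; rewrite -memE; move: WD; rewrite memvE.
  move/subv_bigcapP/(_ (Ordinal lti) isT)/subv_bigcapP/(_ (Ordinal ltj) isT).
  by rewrite -memvE.
move=> a b; rewrite (coord_vbasis (memvf a)) (coord_vbasis (memvf b)).
rewrite !(mulr_suml, linear_sum) -big_split; apply: eq_bigr => i _ /=.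
rewrite !(mulr_sumr, linear_sum) -big_split; apply: eq_bigr => j _ /=.
have:= DB i j; move: (vbasis _)`_i (vbasis _)`_j => u v Duv.
rewrite -[in LHS]scalerAl -[in LHS]scalerAr !linearZ /= linearZ /= Duv.
rewrite -!(scalerAl, scalerAr) !scalerDr.
by congr (_ + _); rewrite !scalerA mulrC.
Qed.

Definition volume : forms := dmon (enum 'I_n).

(* Hence D kills the volume form iff its divergence vanishes. *)
Lemma lie_der_volume D : is_deriv D ->
  lie_der D volume = fscale (\sum_i 'd_i (D (x i))) volume.
Proof.
move=> DM.
have vE: volume = [ffun S => (S == setT)%:R].
  rewrite -dmon_enum /volume; congr dmon.
  by apply: eq_enum => i; rewrite !inE.
rewrite lie_derE [X in X + _](_ : _ = 0) ?add0r; last first.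
  apply/ffunP => S; rewrite vE !ffunE.
  by case: eqP => _; rewrite ?linear0 // deriv1.
have dxv j : wedge (dx j) volume = 0.
  apply/ffunP => U; rewrite wedge_dxE vE !ffunE; case: ifP => // jU.
  case: eqP => [DU|_]; last by rewrite mulr0.
  by have := in_setT j; rewrite -DU setD11.
have dxc i j : wedge (dx j) (contr i volume) = fscale (i == j)%:R volume.
  have := contr_dx i j volume; rewrite dxv linear0 => /esym/eqP.
  by rewrite subr_eq0 => /eqP.
rewrite (big_morph (fscale^~ volume) (id1 := 0) (op1 := +%R)) => [|b c|]; last 2 first.
- exact: fscaleDl.
- exact: fscale0l.
apply: eq_bigr => i _; rewrite /dform wedge_suml (bigD1 i) //= big1 => [|j /negPf ji].
  by rewrite addr0 wedge_fscalel dxc eqxx fscale1.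
by rewrite wedge_fscalel dxc eq_sym ji fscale0l linear0.
Qed.

Definition annihilator w : {vspace 'End(A)} :=
  (witt :&: lker (linfun (lie_der_of w)))%VS.

Lemma mem_annihilator w D :
  reflect (is_deriv D /\ lie_der D w = 0) (D \in annihilator w).
Proof.
rewrite memv_cap memv_ker lfunE /=.
by apply: (iffP andP) => -[/mem_witt DM /eqP Dv].
Qed.

Definition line_stabiliser w : {vspace 'End(A)} :=
  (witt :&: linfun (lie_der_of w) @^-1: limg (linfun (fmulr w)))%VS.

Lemma mem_line_stabiliser w D :
  reflect (is_deriv D /\ exists a, lie_der D w = fscale a w)
          (D \in line_stabiliser w).
Proof.
rewrite memv_cap -memv_preim lfunE /=.
apply: (iffP andP) => -[/mem_witt DM].
  by case/memv_imgP=> a _; rewrite lfunE; split=> //; exists a.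
case=> a Da; split=> //; apply/memv_imgP; exists a; first exact: memvf.
by rewrite lfunE.
Qed.

End DifferentialForms.

Section LieAlgebras.

Variables (K : fieldType) (vT : vectType K).
Implicit Types (D E : 'End(vT)) (L M N : {vspace 'End(vT)}).

Definition lie_bracket D E : 'End(vT) := ((D \o E) - (E \o D))%VF.

Lemma lie_bracketE D E v : lie_bracket D E v = D (E v) - E (D v).
Proof. by rewrite /lie_bracket add_lfunE opp_lfunE !comp_lfunE. Qed.

Definition lie_closed L := {in L &, forall D E, lie_bracket D E \in L}.

Definition derived M : {vspace 'End(vT)} :=
  <<[seq lie_bracket D E | D <- vbasis M, E <- vbasis M]>>%VS.

Lemma lie_bracketDl D D' E :
  lie_bracket (D + D') E = lie_bracket D E + lie_bracket D' E.
Proof.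
apply/lfunP => v; rewrite add_lfunE !lie_bracketE !add_lfunE linearD opprD.
by rewrite addrACA.
Qed.

Lemma lie_bracketZl c D E : lie_bracket (c *: D) E = c *: lie_bracket D E.
Proof.
by apply/lfunP => v; rewrite scale_lfunE !lie_bracketE !scale_lfunE linearZ scalerBr.
Qed.

Lemma lie_bracketC D E : lie_bracket D E = - lie_bracket E D.
Proof. by rewrite opprB. Qed.

Lemma lie_bracket0l E : lie_bracket 0 E = 0.
Proof. by rewrite -[in LHS](scale0r 0) lie_bracketZl scale0r. Qed.

Lemma mem_derived M : {in M &, forall D E, lie_bracket D E \in derived M}.
Proof.
have memZ D E : (forall i, lie_bracket (vbasis M)`_i E \in derived M) ->
    D \in M -> lie_bracket D E \in derived M.
  move=> bE MD; rewrite (coord_vbasis MD).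
  elim/big_ind: _ => [|u v Du Dv|i _].
  - by rewrite lie_bracket0l mem0v.
  - by rewrite lie_bracketDl memvD.
  by rewrite lie_bracketZl memvZ.
move=> D E MD ME; apply: (memZ) => // i.
rewrite lie_bracketC memvN; apply: (memZ) => // j.
have [lti|gei] := ltnP i (\dim M); last first.
  by rewrite [_`_i]nth_default ?size_tuple // lie_bracketC lie_bracket0l oppr0 mem0v.
have [ltj|gej] := ltnP j (\dim M); last first.
  by rewrite [_`_j]nth_default ?size_tuple // lie_bracket0l mem0v.
by apply/memv_span/allpairsP; exists ((vbasis M)`_j, (vbasis M)`_i);
  rewrite /= !mem_nth ?size_tuple.
Qed.

Lemma derived_sub M N :
  reflect {in M &, forall D E, lie_bracket D E \in N} (derived M <= N)%VS.
Proof.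
apply: (iffP idP) => [sMN D E MD ME | MN].
  by apply: (subvP sMN); apply: mem_derived.
apply/span_subvP => _ /allpairsP[[D E] /= [bD bE ->]].
by apply: MN; apply: vbasis_mem.
Qed.

Lemma derived_closed M : lie_closed M -> lie_closed (derived M).
Proof.
move=> cM D E MD ME; have sM: (derived M <= M)%VS by apply/derived_sub.
by apply: mem_derived; apply: (subvP sM).
Qed.

Section Coadjoint.

Variable L : {vspace 'End(vT)}.

(* Only meaningful when lie_closed L, by sub_bracketK. *)
Definition sub_bracket (u v : subvs_of L) : subvs_of L :=
  vsproj L (lie_bracket (vsval u) (vsval v)).

Lemma sub_bracketK u v : lie_closed L ->
  vsval (sub_bracket u v) = lie_bracket (vsval u) (vsval v).
Proof. by move=> cL; rewrite vsprojK // cL ?subvsP. Qed.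

Definition lie_automorphism (g : 'End(subvs_of L)) : Prop :=
  bijective g /\ forall u v, g (sub_bracket u v) = sub_bracket (g u) (g v).

Definition dual : vectType K := 'Hom(subvs_of L, K^o).

Definition coadjoint (g : 'End(subvs_of L)) (chi : dual) : dual :=
  (chi \o g^-1)%VF.

Lemma coadjointE g (chi : dual) u : lie_automorphism g ->
  (coadjoint g chi : 'Hom(_, _)) (g u) = (chi : 'Hom(_, _)) u.
Proof.
by case=> [[h gK _] _]; rewrite comp_lfunE /= lker0_lfunK //; apply/lker0P/(can_inj gK).
Qed.

Definition coadjoint_invariant (f : dual -> K) : Prop :=
  forall g, lie_automorphism g -> forall chi, f (coadjoint g chi) = f chi.

End Coadjoint.

Definition polynomial_function (V : vectType K) (f : V -> K) : Prop :=
  exists P : {mpoly K[\dim {:V}]},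
    forall v, f v = P.@[fun i => coord (vbasis {:V}) i v].

End LieAlgebras.

Section CartanType.

Variables (k : fieldType) (p : nat) (chp : p \in [pchar k]).

Local Notation x := (@tvar k p chp _).
Local Notation dx := (@dx k p chp _).

Definition special_hat n := annihilator (@volume k p chp n).

Definition special n :=
  if n == 2%N then derived (derived (special_hat n))
  else derived (special_hat n).

(* With indices starting from 0, the partner of i < 2m is rev_ord i = 2m-1-i. *)
Definition omegaH m : forms chp (2 * m) :=
  \sum_(i < 2 * m | (i < m)%N) wedge (dx i) (dx (rev_ord i)).

Definition hamiltonian_hat m := annihilator (omegaH m).

Definition hamiltonian m := derived (hamiltonian_hat m).

Definition omegaK m : forms chp (2 * m).+1 :=
  let inl (i : 'I_(2 * m)) : 'I_(2 * m).+1 := widen_ord (leqnSn (2 * m)) i in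
  \sum_(i < 2 * m | (i < m)%N)
    (fscale (x (inl i)) (dx (inl (rev_ord i)))
     - fscale (x (inl (rev_ord i))) (dx (inl i)))
  + dx ord_max.

Definition contact_hat m := line_stabiliser (omegaK m).

Definition contact m := derived (contact_hat m).

Inductive cartan_type : forall n, {vspace 'End(trunc chp n)} -> Prop :=
| CartanW n of (1 <= n)%N : cartan_type (witt chp n)
| CartanS n of (2 <= n)%N : cartan_type (special n)
| CartanH m of (2 <= m)%N : cartan_type (hamiltonian m)
| CartanK m of (1 <= m)%N : cartan_type (contact m).

Lemma is_deriv_bracket n (D E : 'End(trunc chp n)) :
  is_deriv D -> is_deriv E -> is_deriv (lie_bracket D E).
Proof.
move=> DM EM a b; rewrite !lie_bracketE DM EM !linearD /= !DM !EM; ring.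
Qed.

Lemma lie_der_bracket n (D E : 'End(trunc chp n)) w :
    is_deriv D -> is_deriv E ->
  lie_der (lie_bracket D E) w =
    lie_der D (lie_der E w) - lie_der E (lie_der D w).
Proof.
move=> DM EM; have BM := is_deriv_bracket DM EM.
elim/forms_ind: w => [|w v IHw IHv|a w IHw|i w IHw].
- by rewrite !lie_der_form1 // !linear0 addr0.
- by rewrite !linearD /= IHw IHv addrACA.
- rewrite !lie_derZ // IHw lie_bracketE !linearD /= !lie_derZ //.
  by apply/ffunP => S; rewrite !ffunE; ring.
rewrite !lie_der_dxM // IHw !linearD /= !lie_der_wedge // !lie_der_dx // !lie_der_dform //.
rewrite lie_bracketE linearB /=.
rewrite wedgeDl wedgeNl wedgeDr wedgeNr.
move: (wedge _ _) (wedge _ _) (wedge _ _) (wedge _ _) (wedge _ _) (wedge _ _) => a b c d e f.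
apply/ffunP => S; rewrite !ffunE; ring.
Qed.

Lemma witt_closed n : lie_closed (witt chp n).
Proof.
by move=> D E /mem_witt DM /mem_witt EM; apply/mem_witt/is_deriv_bracket.
Qed.

Lemma annihilator_closed n (w : forms chp n) : lie_closed (annihilator w).
Proof.
move=> D E /mem_annihilator[DM Dw] /mem_annihilator[EM Ew]; apply/mem_annihilator.
split; first exact: is_deriv_bracket.
by rewrite lie_der_bracket // Dw Ew !linear0 addr0.
Qed.

Lemma line_stabiliser_closed n (w : forms chp n) :
  lie_closed (line_stabiliser w).
Proof.
move=> D E /mem_line_stabiliser[DM [d Dw]] /mem_line_stabiliser[EM [e Ew]].
apply/mem_line_stabiliser; split; first exact: is_deriv_bracket.
exists (D e - E d); rewrite lie_der_bracket // Dw Ew !lie_derZ // Dw Ew.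
by apply/ffunP => S; rewrite !ffunE; ring.
Qed.

Lemma cartan_type_closed n (L : {vspace 'End(trunc chp n)}) :
  cartan_type L -> lie_closed L.
Proof.
case: L / => {}n _ /=.
- exact: witt_closed.
- rewrite /special; case: ifP => _; do ?apply: derived_closed; exact: annihilator_closed.
- exact/derived_closed/annihilator_closed.
exact/derived_closed/line_stabiliser_closed.
Qed.

End CartanType.

(* Main.v *)
Require Import Defs.
From mathcomp Require Import all_boot all_order all_algebra ring_quotient.
From mathcomp Require Import mpoly.
From HB Require Import structures.
From mathcomp Require Import ring zify.
From Stdlib Require Import Classical.

(* Let f be an invariant polynomial function on L^*. The grading of A by
   deg x_i = 1 (with the last variable of degree 2 in the contact case) makes
   the dilations x_i -> s^(deg x_i) x_i act on L. A functional zeta supported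
   on the part of positive degree of L is contracted to 0 by this torus, so
   f(zeta) = f(0). If e in L satisfies e o e = 0, then conjugation by 1 + s e
   is an automorphism of L, since e D e = -[e, [e, D]] / 2 belongs to L.
   Suppose that L^* is spanned by the functionals of positive degree and by the
   functionals chi_0 o ad e, for one fixed chi_0 of positive degree and all such
   e. Then for every eta in L^* the torus and the groups 1 + s e provide a
   polynomial curve s |-> chi_0 + s eta + O(s^2) on which f is equal to f(0),
   and comparing lowest order terms at chi_0 gives f = f(0).

   By duality the spanning condition says that no nonzero y in L of degree
   <= 0 satisfies chi_0 [e, y] = 0 for all e. Every derivation e divisible by
   x_j^(p-2) satisfies e o e = 0, because p >= 5. With chi_0 the sum over j of
   the coefficients at d/dx_j of x_j^(p-2), x_j^(p-1) and x_j^(p-1) x_l, for l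
   in suitable partners of j, the fields with Hamiltonian x_j^(p-1) x_l^b,
   b <= 2, determine a triangular system of equations for the coefficients of
   y, in which the only divisions are by 2 and 3. *)

Set Implicit Arguments.
Unset Strict Implicit.
Unset Printing Implicit Defensive.

Import GRing.Theory.
Local Open Scope ring_scope.

(** The torus contracts nothing in degree at most 0, so those directions have to come from the
    unipotent groups. Only the first-order term of their action is controlled; this is enough
    because a polynomial that vanishes on one curve s v + O(s^2) for every v is zero.

    The shape of chi_0 makes the tests local. If e is divisible by x_j^(p-2), all components of
    [e, y] are divisible by x_j^(p-3), while the monomials of chi_0 attached to another index
    contain x_j at most once; as p - 3 >= 2, only the component at j is seen. There the factor
    x_j^(p-2) or x_j^(p-1) of e turns high coefficients into low coefficients of y.

    In W(n) the field x_j^(p-2) d/dx_j isolates the diagonal coefficients at once.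

    In the contact case the field d/dx_n of degree -2 escapes all these tests, so chi_0 gets one
    more coefficient, tested by the field with Hamiltonian x_n^(p-1), where x_n is the last
    variable. *)

(** * Polynomial identities over an algebraically closed field *)

Section PolynomialIdentities.

Variable k : closedFieldType.

Lemma poly_eq0_off0 (q : {poly k}) : (forall s, s != 0 -> q.[s] = 0) -> q = 0.
Proof.
move=> q0; apply/eqP; apply: contraT => nz_q.
(* A root of q X + 1 cannot be 0, where the value is 1; at any other point q vanishes by hypothesis
   and the value is 1 again. *)
have [|r] := closed_rootP (q * 'X + 1) _.
  rewrite -[1]/(1%:P : {poly k}) -cons_poly_def size_cons_poly nil_poly (negPf nz_q).
  by rewrite eqSS size_poly_eq0.
rewrite rootE !hornerE; have [->|/q0->] := eqVneq r 0.
  by rewrite mulr0 add0r oner_eq0.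
by rewrite mul0r add0r oner_eq0.
Qed.

Section Substitution.

Variable N : nat.
Implicit Types (Q : {mpoly k[N]}) (v : 'I_N -> k) (h : 'I_N -> {poly k}).

Lemma horner_mmap Q h s :
  (mmap polyC h Q).[s] = Q.@[fun i => (h i).[s]].
Proof.
rewrite mevalE /mmap horner_sum; apply: eq_bigr => m _.
rewrite hornerM hornerC /mmap1 horner_prod; congr (_ * _).
by apply: eq_bigr => i _; rewrite horner_exp.
Qed.

Lemma radix_inj (B n : nat) (m m' : nat -> nat) :
    (forall i, (m i < B)%N) -> (forall i, (m' i < B)%N) ->
    (\sum_(i < n) m i * B ^ i = \sum_(i < n) m' i * B ^ i)%N ->
  forall i, (i < n)%N -> m i = m' i.
Proof.
elim: n m m' => // n IHn m m' ltm ltm'; rewrite !big_ord_recl /= !expn0 !muln1.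
under eq_bigr do rewrite /bump add1n expnSr mulnA.
under [in RHS]eq_bigr do rewrite /bump add1n expnSr mulnA.
rewrite -!big_distrl /= => E.
have E0: m 0 = m' 0.
  by have /(congr1 (modn^~ B)) := E; rewrite ![(_ + _ * B)%N]addnC !modnMDl !modn_small.
move/eqP: E; rewrite E0 eqn_add2l eqn_pmul2r ?(leq_ltn_trans _ (ltm 0)) // => /eqP E.
by case=> [|i] lti; [exact: E0 | exact: (IHn (fun j => m j.+1) (fun j => m' j.+1))].
Qed.

Lemma meval_eq0 Q : (forall v, Q.@[v] = 0) -> Q = 0.
Proof.
(* Kronecker's substitution X_i := X^(B^i) separates the monomials of Q. *)
move=> Q0; pose B := (msize Q).+1.
pose h i : {poly k} := 'X^(B ^ (i : 'I_N)).
pose e (m : 'X_{1..N}) := (\sum_(i < N) m i * B ^ i)%N.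
have hE m : mmap1 h m = 'X^(e m).
  rewrite /mmap1 /e (big_morph _ (fun a b => exprD _ a b) (expr0 _)).
  by apply: eq_bigr => i _; rewrite -exprM mulnC.
have q0: mmap polyC h Q = 0.
  by apply: poly_eq0_off0 => s _; rewrite horner_mmap.
apply/mpolyP => m; rewrite mcoeff0; apply/eqP; apply: contraT => Qm.
have sm: m \in msupp Q by rewrite mcoeff_eq0 negbK in Qm.
have /(congr1 (fun q : {poly k} => q`_(e m))) := q0.
rewrite coef0 /mmap (bigD1_seq m) //= coefD coef_sum big1_seq.
  by rewrite hE coefCM coefXn eqxx mulr1 addr0 => Qm0; rewrite Qm0 eqxx in Qm.
move=> m' /andP[nm' sm']; rewrite hE coefCM coefXn.
case: eqP => [Em|]; last by rewrite mulr0.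
have ltB m1 (i : 'I_N) : m1 \in msupp Q -> (m1 i < B)%N.
  move=> sm1; rewrite ltnS; apply: leq_trans (ltnW (msize_mdeg_lt sm1)).
  by rewrite mdegE (bigD1 i) //= leq_addr.
case/eqP: nm'; apply/mnmP => i.
pose f (m1 : 'X_{1..N}) j := if insub j is Some i then m1 (i : 'I_N) else 0%N.
have fE m1 (j : 'I_N) : f m1 j = m1 j by rewrite /f valK.
have ltf m1 j : m1 \in msupp Q -> (f m1 j < B)%N.
  by rewrite /f; case: insub => // j' /ltB.
rewrite -!fE; apply: (@radix_inj B N) (ltn_ord i) => [j|j|]; rewrite ?ltf //.
by under eq_bigr do rewrite fE; under [RHS]eq_bigr do rewrite fE.
Qed.

(* The lowest homogeneous component of Q takes at v the value of the lowest
   coefficient of s |-> Q (s v + s^2 r(s)). *)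
Lemma meval_tangent_eq0 Q :
    (forall v, exists r : 'I_N -> {poly k},
       forall s, Q.@[fun i => s * v i + s ^+ 2 * (r i).[s]] = 0) ->
  Q = 0.
Proof.
move=> Q0; apply/eqP; apply: contraT => nzQ.
have exd: exists d, has (fun m => mdeg m == d) (msupp Q).
  case E: (msupp Q) => [|m s]; first by rewrite -msupp_eq0 E eqxx in nzQ.
  by exists (mdeg m); rewrite /= eqxx.
have [d /hasP[m0 sm0 /eqP dm0] mind] := ex_minnP exd.
have led m : m \in msupp Q -> (d <= mdeg m)%N.
  by move=> sm; apply: mind; apply/hasP; exists m.
pose Qd := \sum_(m <- msupp Q | mdeg m == d) Q@_m *: 'X_[m].
have Qd0: Qd = 0.
  apply: meval_eq0 => v; have [r Qr] := Q0 v.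
  pose h i : {poly k} := 'X * ((v i)%:P + 'X * r i).
  have hQ: mmap polyC h Q = 0.
    apply: poly_eq0_off0 => s _; rewrite horner_mmap -[RHS](Qr s).
    by apply: meval_eq => i; rewrite /h !hornerE expr2 mulrDr !mulrA.
  have /(congr1 (fun q : {poly k} => q`_d)) := hQ.
  rewrite coef0 => <-; rewrite /Qd /mmap raddf_sum coef_sum /= big_mkcond /=.
  apply: eq_big_seq => m /led le_d.
  have -> : mmap1 h m = mmap1 (fun i => (v i)%:P + 'X * r i) m * 'X^(mdeg m).
    rewrite mdegE /mmap1 (big_morph _ (fun a b => exprD _ a b) (expr0 _)).
    by rewrite -big_split /=; apply: eq_bigr => i _; rewrite exprMn mulrC.
  rewrite mulrA coefMXn; case: ltngtP le_d => // -> _.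
  rewrite subnn coefCM mevalZ mevalX; congr (_ * _).
  rewrite -horner_coef0 /mmap1 horner_prod; apply: eq_bigr => i _.
  by rewrite horner_exp !hornerE.
have /(congr1 (fun q => q@_m0)) := Qd0.
rewrite mcoeff0 /Qd -big_filter (bigD1_seq m0) /=; last 2 first.
- by rewrite mem_filter dm0 eqxx.
- exact: filter_uniq.
rewrite mcoeffD mcoeffZ mcoeffX eqxx mulr1 raddf_sum big1 /=; last first.
  by move=> m /negPf nm; rewrite mcoeffZ mcoeffX nm mulr0.
by rewrite addr0 => /eqP; rewrite mcoeff_eq0 sm0.
Qed.

End Substitution.

End PolynomialIdentities.

(** * Invariants of the coadjoint representation *)

Section PolynomialCurves.

Variable k : closedFieldType.
Implicit Types U V : vectType k.

(** Testing against all functionals, rather than coordinates in a basis, makes stability under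
    linear maps immediate. *)
Definition polycurve V (g : k -> V) : Prop :=
  forall phi : 'Hom(V, k^o), exists q : {poly k}, forall s, phi (g s) = q.[s].

Lemma polycurve_cst V (v : V) : polycurve (fun=> v).
Proof. by move=> phi; exists (phi v)%:P => s; rewrite hornerC. Qed.

Lemma polycurveD V (g h : k -> V) :
  polycurve g -> polycurve h -> polycurve (fun s => g s + h s).
Proof.
move=> cg ch phi; have [[q gq] [r hr]] := (cg phi, ch phi).
by exists (q + r) => s; rewrite linearD /= gq hr hornerD.
Qed.

Lemma polycurve_horner V (p : {poly k}) (g : k -> V) :
  polycurve g -> polycurve (fun s => p.[s] *: g s).
Proof.
by move=> cg phi; have [q gq] := cg phi; exists (p * q) => s; rewrite linearZ /= gq
  hornerM.
Qed.

Lemma eq_polycurve V (g h : k -> V) : g =1 h -> polycurve g -> polycurve h.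
Proof. by move=> gh cg phi; have [q gq] := cg phi; exists q => s; rewrite -gh. Qed.

Lemma polycurveX V (g : k -> V) : polycurve g -> polycurve (fun s => s *: g s).
Proof. by move/(polycurve_horner 'X); apply: eq_polycurve => s; rewrite hornerX. Qed.

Lemma polycurveZ V c (g : k -> V) : polycurve g -> polycurve (fun s => c *: g s).
Proof. by move/(polycurve_horner c%:P); apply: eq_polycurve => s; rewrite hornerC. Qed.

Lemma polycurve_lfun U V (phi : 'Hom(U, V)) (g : k -> U) :
  polycurve g -> polycurve (fun s => phi (g s)).
Proof.
by move=> cg psi; have [q gq] := cg (psi \o phi)%VF; exists q => s; rewrite -gq
  comp_lfunE.
Qed.

Lemma polycurve_coord V (g : k -> V) : polycurve g ->
  exists q : 'I_(\dim {:V}) -> {poly k},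
    forall s i, coord (vbasis {:V}) i (g s) = (q i).[s].
Proof.
move=> cg; have /fin_all_exists[q gq] : forall i, exists q : {poly k},
    forall s, coord (vbasis {:V}) i (g s) = q.[s].
  move=> i; have [q gq] := cg (linfun (coord (vbasis {:V}) i : V -> k^o)).
  by exists q => s; rewrite -gq lfunE.
by exists q => s i.
Qed.

Lemma polynomial_function_curve V (f : V -> k) (g : k -> V) :
    polynomial_function f -> polycurve g ->
  exists q : {poly k}, forall s, f (g s) = q.[s].
Proof.
move=> [P fP] /polycurve_coord[q gq]; exists (mmap polyC q P) => s.
by rewrite horner_mmap fP; apply: meval_eq => i.
Qed.

(** Translating by [v0] and subtracting [c] turns this into [meval_tangent_eq0], which concerns
    curves through the origin. *)
Lemma polynomial_function_tangent V (f : V -> k) (c : k) (v0 : V) :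
    polynomial_function f ->
    (forall v, exists2 r, polycurve r &
       forall s, f (v0 + s *: v + s ^+ 2 *: r s) = c) ->
  forall v, f v = c.
Proof.
move=> [P fP] fr; pose N := \dim {:V}; pose b := vbasis {:V}.
pose T := [tuple 'X_i + (coord b i v0)%:MP | i < N].
pose Q := (P \mPo T) - c%:MP : {mpoly k[N]}.
have QE v : Q.@[fun i => coord b i v] = f (v0 + v) - c.
  rewrite mevalB mevalC comp_mpoly_meval fP; congr (_ - _); apply: meval_eq => i.
  by rewrite tnth_mktuple mevalD mevalXU mevalC linearD addrC.
suff Q0: Q = 0.
  move=> v; apply/eqP; rewrite -subr_eq0; apply/eqP.
  by have := QE (v - v0); rewrite [v0 + _]addrCA subrr addr0 => <-; rewrite Q0 meval0.
apply: meval_tangent_eq0 => a.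
have [r cr rv] := fr (\sum_(i < N) a i *: b`_i).
have [q rq] := polycurve_coord cr; exists q => s.
have := QE (s *: (\sum_(i < N) a i *: b`_i) + s ^+ 2 *: r s).
rewrite addrA rv subrr => <-; apply: meval_eq => i; rewrite linearD !linearZ /= rq.
by rewrite coord_sum_free // (basis_free (vbasisP _)).
Qed.

Lemma polycurveX2 V (g : k -> V) : polycurve g -> polycurve (fun s => s ^+ 2 *: g s).
Proof.
by move/polycurveX/polycurveX; apply: eq_polycurve => s; rewrite scalerA.
Qed.

Lemma polycurveB V (g h : k -> V) :
  polycurve g -> polycurve h -> polycurve (fun s => g s - h s).
Proof.
move=> cg /(polycurveZ (-1)) ch; apply: eq_polycurve (polycurveD cg ch) => s.
by rewrite scaleN1r.
Qed.

Definition precomp U V (g : 'Hom(U, V)) (chi : 'Hom(V, k^o)) : 'Hom(U, k^o) :=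
  (chi \o g)%VF.

Fact precomp_is_linear U V (g : 'Hom(U, V)) : linear (precomp g).
Proof. by move=> c chi psi; rewrite /precomp comp_lfunDl -comp_lfunZl. Qed.
HB.instance Definition _ U V (g : 'Hom(U, V)) := GRing.isLinear.Build k
  'Hom(V, k^o) 'Hom(U, k^o) _ (precomp g) (precomp_is_linear g).

Lemma precompD U V (g : 'Hom(U, V)) chi psi :
  precomp g (chi + psi) = precomp g chi + precomp g psi.
Proof. exact: comp_lfunDl. Qed.

Lemma precompZ U V (g : 'Hom(U, V)) c chi :
  precomp g (c *: chi) = c *: precomp g chi.
Proof. exact/esym/comp_lfunZl. Qed.

(** The bookkeeping for one more unipotent move with parameter s c: the right side is the transform
    of the curve x + s e + s^2 r, where [D0], [De], [Dr] stand for the first-order effect on x, e, r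
    and [D2] for the second-order effect on the whole curve. The left side isolates the new tangent
    vector c D0 + e. *)
Lemma tangent_identity (W : lmodType k) (s c : k) (x e r D0 De Dr D2 : W) :
  x + s *: (c *: D0 + e) + s ^+ 2 *: (r + c *: De + s *: (c *: Dr) - c ^+ 2 *: D2) =
  x + s *: e + s ^+ 2 *: r + (s * c) *: (D0 + s *: De + s ^+ 2 *: Dr)
    - (s * c) ^+ 2 *: D2.
Proof.
rewrite !scalerDr !scalerN !scalerA exprMn !addrA; congr (_ - _).
have -> : s ^+ 2 * s * c = s * c * s ^+ 2 by ring.
have -> : s ^+ 2 * c = s * c * s by ring.
congr (_ + _ + _); rewrite -!addrA; congr (x + _).
by rewrite addrC -addrA; congr (_ + _); rewrite addrC.
Qed.

Lemma polycurve_precomp U V (g : 'Hom(U, V)) (h : k -> 'Hom(V, k^o)) :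
  polycurve h -> polycurve (fun s => precomp g (h s)).
Proof.
move/(polycurve_lfun (linfun (precomp g))).
by apply: eq_polycurve => s; rewrite lfunE.
Qed.

(** Finitely many members of [X] already have a trivial common kernel, since each suitable new one
    lowers its dimension. As [X] is an arbitrary predicate, excluded middle supplies that new
    member. *)
Lemma separating_span V (X : 'Hom(V, k^o) -> Prop) :
    (forall u, (forall chi, X chi -> chi u = 0) -> u = 0) ->
  forall eta : 'Hom(V, k^o), exists2 s : seq (k * 'Hom(V, k^o)),
    forall c, c \in s -> X c.2 & eta = \sum_(c <- s) c.1 *: c.2.
Proof.
move=> sepX eta; pose K (t : seq 'Hom(V, k^o)) := (\bigcap_(i < size t) lker t`_i)%VS.
have memK (t : seq 'Hom(V, k^o)) u : reflect (forall chi, chi \in t -> chi u = 0) (u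
  \in K t).
  rewrite memvE; apply: (iffP subv_bigcapP) => [Ku chi /(nthP 0)[i lti <-] | Ku i _].
    by apply/eqP; rewrite -memv_ker memvE (Ku (Ordinal lti)).
  by rewrite -memvE memv_ker Ku ?mem_nth.
have [t Xt Kt]: exists2 t, (forall chi, chi \in t -> X chi) & K t = 0%VS.
  suff H d : forall t, (forall chi, chi \in t -> X chi) -> (\dim (K t) <= d)%N ->
      exists2 t, (forall chi, chi \in t -> X chi) & K t = 0%VS.
    by apply: (H (\dim (K [::])) [::]).
  elim: d => [|d IHd] t Xt; first by rewrite leqn0 dimv_eq0 => /eqP; exists t.
  have [K0 _|nzK leK] := eqVneq (K t) 0%VS; first by exists t.
  have [chi [Xchi nz_chi]] : exists chi, X chi /\ chi (vpick (K t)) <> 0.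
    apply: NNPP => noX; case/eqP: nzK; apply/eqP; rewrite -vpick0; apply/eqP.
    by apply: sepX => chi Xchi; apply: NNPP => nz; apply: noX; exists chi.
  apply: (IHd (chi :: t)) => [psi|]; first by rewrite inE => /predU1P[->|/Xt].
  rewrite -ltnS; apply: leq_trans leK; rewrite ltn_neqAle dimvS; last first.
    by apply/subvP => u /memK Ku; apply/memK => psi tpsi; rewrite Ku // inE tpsi orbT.
  rewrite andbT; apply/eqP => eqd; apply: nz_chi.
  have /memK: vpick (K t) \in K (chi :: t).
    suff ->: K (chi :: t) = K t by exact: memv_pick.
    apply/eqP; rewrite eqEdim eqd leqnn andbT.
    by apply/subvP => u /memK Ku; apply/memK => psi tpsi; rewrite Ku // inE tpsi orbT.
  by apply; rewrite mem_head.
(* The chosen functionals embed V into row vectors; the coefficients of [eta] are its values on the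
   images of the unit vectors under a left inverse of this embedding. *)
pose hf (u : V) : 'rV[k]_(size t) := \row_i t`_i u.
have hlin : linear hf by move=> c u v; apply/rowP => i; rewrite !mxE linearP.
pose hL : {linear V -> 'rV[k]_(size t)} := HB.pack hf (GRing.isLinear.Build _ _ _ _
  hf hlin).
pose h := linfun hL.
have kh : lker h == 0%VS.
  rewrite -subv0 -Kt; apply/subvP => u; rewrite memv_ker lfunE => /eqP hu.
  apply/memK => _ /(nthP 0)[i lti <-]; have /rowP/(_ (Ordinal lti)) := hu.
  by rewrite !mxE.
exists [seq (eta (h^-1%VF (delta_mx 0 i)), t`_i) | i <- enum 'I_(size t)].
  by move=> _ /mapP[i _ ->]; apply/Xt/mem_nth.
apply/lfunP => u; rewrite sum_lfunE big_map big_enum /=.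
have Du : u = h^-1%VF (h u) by rewrite -comp_lfunE lker0_compVf // id_lfunE.
rewrite {1}Du [h u]row_sum_delta !linear_sum; apply: eq_bigr => i _ /=.
by rewrite scale_lfunE !linearZ /= lfunE /= mxE; apply: mulrC.
Qed.

End PolynomialCurves.

Section InvariantCriterion.

Variables (k : closedFieldType) (vT : vectType k) (L : {vspace 'End(vT)}).
Hypotheses (cL : lie_closed L) (char2 : 2%:R != 0 :> k).

Local Notation V := (subvs_of L).
Implicit Types (u v : 'End(vT)) (x y : V).

(** The projection only serves to make the map total: it does nothing as soon as the conjugate lies
    in [L]. *)
Definition conj_fun u v x : V := vsproj L (u \o vsval x \o v)%VF.

Fact conj_fun_is_linear u v : linear (conj_fun u v).
Proof.
move=> c x y; rewrite /conj_fun !linearP /=.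
by rewrite comp_lfunDr comp_lfunDl -comp_lfunZr -comp_lfunZl linearP.
Qed.
HB.instance Definition _ u v := GRing.isLinear.Build k V V _ (conj_fun u v)
  (conj_fun_is_linear u v).

Definition lie_conj u v : 'End(V) := linfun (conj_fun u v).

Lemma lie_conjK u v x : (u \o vsval x \o v)%VF \in L ->
  vsval (lie_conj u v x) = (u \o vsval x \o v)%VF.
Proof. by move=> Lx; rewrite lfunE /= vsprojK. Qed.

Lemma lie_conj_automorphism u v :
    (u \o v = \1)%VF -> (v \o u = \1)%VF ->
    {in L, forall D, (u \o D \o v)%VF \in L} ->
    {in L, forall D, (v \o D \o u)%VF \in L} ->
  lie_automorphism (lie_conj u v).
Proof.
move=> uv vu Luv Lvu; split=> [|x y].
  exists (lie_conj v u) => x; apply: val_inj;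
    rewrite /= !lie_conjK ?(Luv, Lvu) ?subvsP //.
    by rewrite !comp_lfunA vu comp_lfun1l -comp_lfunA vu comp_lfun1r.
  by rewrite !comp_lfunA uv comp_lfun1l -comp_lfunA uv comp_lfun1r.
apply: val_inj; rewrite /= sub_bracketK // !lie_conjK ?Luv ?subvsP //.
rewrite sub_bracketK // /lie_bracket comp_lfunDr comp_lfunDl comp_lfunNr comp_lfunNl.
have cc (D E : 'End(vT)) : (u \o D \o v \o (u \o E \o v) = u \o (D \o E) \o v)%VF.
  by rewrite !comp_lfunA -[(_ \o v \o u)%VF]comp_lfunA vu comp_lfun1r.
by rewrite !cc.
Qed.

(** The coadjoint action of g undoes precomposition with g, so invariance can be used without
    inverses. *)
Lemma coadjoint_invariantE (f : dual L -> k) (g : 'End(V)) (chi : dual L) :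
  coadjoint_invariant f -> lie_automorphism g -> f (chi \o g)%VF = f chi.
Proof.
move=> invf autg; rewrite -(invf g autg); congr f.
case: (autg) => -[h gK hK] _; apply/lfunP => x; rewrite -[x]hK.
by rewrite coadjointE // comp_lfunE.
Qed.

Fact lie_bracket_is_linear (e : 'End(vT)) : linear (lie_bracket e).
Proof.
move=> c D E; rewrite ![lie_bracket e _]lie_bracketC lie_bracketDl lie_bracketZl.
by rewrite scalerN opprD.
Qed.
HB.instance Definition _ e := GRing.isLinear.Build k 'End(vT) 'End(vT) _
  (lie_bracket e) (lie_bracket_is_linear e).

Definition sandwich (e D : 'End(vT)) : 'End(vT) := (e \o D \o e)%VF.

Fact sandwich_is_linear e : linear (sandwich e).
Proof.
move=> c D E; rewrite /sandwich comp_lfunDr comp_lfunDl.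
by rewrite -comp_lfunZr -comp_lfunZl.
Qed.
HB.instance Definition _ e := GRing.isLinear.Build k 'End(vT) 'End(vT) _
  (sandwich e) (sandwich_is_linear e).

Definition to_sub (phi : {linear 'End(vT) -> 'End(vT)}) : 'End(V) :=
  (linfun (vsproj L) \o linfun phi \o linfun vsval)%VF.

Lemma to_subE phi x : to_sub phi x = vsproj L (phi (vsval x)).
Proof. by rewrite !comp_lfunE /= !lfunE. Qed.

Lemma sandwich_mem e D : (e \o e = 0)%VF -> e \in L -> D \in L -> sandwich e D \in L.
Proof.
move=> ee Le LD; have L2: lie_bracket e (lie_bracket e D) \in L by rewrite !cL.
suff ->: sandwich e D = - (2%:R)^-1 *: lie_bracket e (lie_bracket e D) by rewrite memvZ.
have e0 a : e (e a) = 0 by rewrite -comp_lfunE ee lfunE.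
apply: (scalerI char2); rewrite scalerA mulrN divff // scaleN1r.
apply/lfunP => a; rewrite !(scale_lfunE, opp_lfunE) lie_bracketE !lie_bracketE.
rewrite /sandwich !comp_lfunE !linearB /= !e0 !(linear0, oppr0, sub0r, subr0, opprK).
by rewrite scaler_nat mulr2n.
Qed.

Section SquareZero.

Variables (e : 'End(vT)) (Le : e \in L) (ee : (e \o e = 0)%VF) (s : k).

Let u := (\1 + s *: e)%VF.
Let v := (\1 - s *: e)%VF.

Lemma unipotent_conj D : (u \o D \o v = D + s *: lie_bracket e D - s ^+ 2 *: sandwich
  e D)%VF.
Proof.
apply/lfunP => a; rewrite !(comp_lfunE, add_lfunE, opp_lfunE, scale_lfunE, id_lfunE).
rewrite !(linearB, linearZ, linearD) /= ?scalerA -?expr2 [e (- _)]linearN.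
by rewrite !addrA [D a + _ + _]addrAC.
Qed.

Lemma unipotent_conj_mem D : D \in L -> (u \o D \o v)%VF \in L.
Proof. by move=> LD; rewrite unipotent_conj memvB ?memvD ?memvZ ?cL ?sandwich_mem. Qed.

Lemma unipotent_conjE :
  lie_conj u v = \1%VF + s *: to_sub (lie_bracket e) - s ^+ 2 *: to_sub (sandwich e).
Proof.
apply/lfunP => x; apply: (can_inj vsvalK); rewrite lie_conjK ?unipotent_conj_mem
  ?subvsP // unipotent_conj.
rewrite !(add_lfunE, opp_lfunE, scale_lfunE) id_lfunE !to_subE linearB linearD /=
  !linearZ /=.
rewrite !vsprojK -?scalerDr //; first exact: sandwich_mem (subvsP x).
exact: cL (subvsP x).
Qed.

Lemma unipotent_inv : (u \o v = \1)%VF.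
Proof.
have e0 a : e (e a) = 0 by rewrite -comp_lfunE ee lfunE.
apply/lfunP => a; rewrite !(comp_lfunE, add_lfunE, opp_lfunE, scale_lfunE, id_lfunE).
by rewrite linearB /= [e (s *: _)]linearZ /= e0 scaler0 subr0 subrK.
Qed.

End SquareZero.

Lemma unipotent_automorphism (e : 'End(vT)) s : e \in L -> (e \o e = 0)%VF ->
  lie_automorphism (\1%VF + s *: to_sub (lie_bracket e) - s ^+ 2 *: to_sub (sandwich
    e)).
Proof.
move=> Le ee; rewrite -unipotent_conjE //.
have sN : - s *: e = - (s *: e) by rewrite scaleNr.
apply: lie_conj_automorphism.
- exact: unipotent_inv.
- by have := unipotent_inv ee (- s); rewrite sN opprK.
- by move=> D; apply: unipotent_conj_mem.
by move=> D /(unipotent_conj_mem Le ee (- s)); rewrite sN opprK.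
Qed.

(** * Contraction by a torus and the criterion for constancy *)

Definition pairing (chi : dual L) (x : V) : k := (chi : 'Hom(V, k^o)) x.

Lemma pairingD chi psi x : pairing (chi + psi) x = pairing chi x + pairing psi x.
Proof. by rewrite /pairing add_lfunE. Qed.

Lemma pairing_sum (I : Type) (r : seq I) (P : pred I) (F : I -> dual L) x :
  pairing (\sum_(i <- r | P i) F i) x = \sum_(i <- r | P i) pairing (F i) x.
Proof. by rewrite /pairing sum_lfunE. Qed.

Variable lam : k -> 'End(V).
Hypothesis lam_automorphism : forall s, s != 0 -> lie_automorphism (lam s).

(** The factor s lets the curve of translates, defined by automorphisms only for s != 0, extend
    polynomially to s = 0 with the value 0. *)
Definition contracted (zeta : dual L) : Prop :=
  exists2 R : k -> dual L, polycurve R &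
    forall s, s != 0 -> (zeta \o lam s)%VF = s *: R s.

Lemma contracted0 : contracted 0.
Proof.
by exists (fun=> 0) => [|s _]; [exact: polycurve_cst | rewrite comp_lfun0l scaler0].
Qed.

Lemma contractedD zeta xi : contracted zeta -> contracted xi -> contracted (zeta + xi).
Proof.
move=> [R cR Rz] [S cS Sx]; exists (fun s => R s + S s) => [|s s0].
  exact: polycurveD.
by rewrite comp_lfunDl Rz // Sx // scalerDr.
Qed.

Lemma contractedZ c zeta : contracted zeta -> contracted (c *: zeta).
Proof.
move=> [R cR Rz]; exists (fun s => c *: R s) => [|s s0].
  exact: polycurveZ.
by rewrite -comp_lfunZl Rz // !scalerA mulrC.
Qed.

Section Invariant.

Variable f : dual L -> k.
Hypotheses (polyf : polynomial_function f) (invf : coadjoint_invariant f).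

Lemma invariant_contracted zeta : contracted zeta -> f zeta = f 0.
Proof.
move=> [R cR Rz]; have [q fs] := polynomial_function_curve polyf (polycurveX cR).
(* [q] takes the value [f zeta] at every s != 0, hence is constant, and its value at 0 is [f 0]. *)
have /eqP : q - (f zeta)%:P = 0.
  apply: poly_eq0_off0 => s s0; rewrite hornerD hornerN hornerC -fs -Rz //.
  by rewrite coadjoint_invariantE ?subrr //; apply: lam_automorphism.
by rewrite subr_eq0 => /eqP q0; have := fs 0; rewrite scale0r q0 hornerC.
Qed.

Variable chi0 : dual L.
Hypothesis contr0 : contracted chi0.

Definition coadjoint_moves (es : seq (k * 'End(vT))) : dual L :=
  \sum_(e <- es) e.1 *: (chi0 \o to_sub (lie_bracket e.2))%VF.

Definition square_zero_in (e : 'End(vT)) := e \in L /\ (e \o e = 0)%VF.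

(** Induction on the list. For the empty list chi0 + s zeta is itself contracted for every s. A
    further pair (c, e) transforms the previous curve by the automorphism coming from 1 + s c e,
    which adds c times chi0 o ad e to the tangent vector at chi0 and changes nothing else below
    order s^2. *)
Lemma invariant_moves zeta es : contracted zeta ->
    (forall e, e \in es -> square_zero_in e.2) ->
  exists2 r, polycurve r & forall s,
    f (chi0 + s *: (zeta + coadjoint_moves es) + s ^+ 2 *: r s) = f 0.
Proof.
move=> cz; elim: es => [_ | [c e] es IHes sq].
  exists (fun=> 0) => [|s]; first exact: polycurve_cst.
  rewrite scaler0 addr0 /coadjoint_moves big_nil addr0.
  by apply/invariant_contracted/contractedD/contractedZ.
have [|r cr fr] := IHes; first by move=> e' es_e'; apply: sq; rewrite inE es_e' orbT.
have [/= Le ee] := sq _ (mem_head _ _).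
set eta := zeta + _ in fr; pose d := to_sub (lie_bracket e).
pose d2 := to_sub (sandwich e); pose g s := chi0 + s *: eta + s ^+ 2 *: r s.
(* The remainder of the transformed curve, as collected in [tangent_identity]. *)
pose r' s := r s + c *: precomp d eta + s *: (c *: precomp d (r s)) - c ^+ 2 *:
  precomp d2 (g s).
exists r' => [|s].
  apply: polycurveB; last first.
    apply/polycurveZ/polycurve_precomp/polycurveD; last exact: polycurveX2.
    by apply: polycurveD; [exact: polycurve_cst | apply/polycurveX/polycurve_cst].
  apply: polycurveD; last exact/polycurveX/polycurveZ/polycurve_precomp.
  by apply: polycurveD => //; exact: polycurve_cst.
have pE a chi : (chi \o (\1 + a *: d - a ^+ 2 *: d2) = chi + a *: precomp d chi - a
  ^+ 2 *: precomp d2 chi)%VF.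
  by rewrite /precomp comp_lfunDr comp_lfunNr comp_lfunDr comp_lfun1r -!comp_lfunZr.
transitivity (f (g s)); last exact: fr.
rewrite -(coadjoint_invariantE (g s) invf (unipotent_automorphism (s * c) Le ee)).
congr f; rewrite -/d -/d2 pE /coadjoint_moves big_cons -/(coadjoint_moves es).
rewrite addrCA -/eta -[(chi0 \o _)%VF]/(precomp d chi0) /r'.
have -> : precomp d (g s) = precomp d chi0 + s *: precomp d eta + s ^+ 2 *: precomp d
  (r s).
  by rewrite /g precompD [precomp d (chi0 + _)]precompD !precompZ.
rewrite {1}/g.
exact: tangent_identity.
Qed.

Theorem invariant_constant :
    (forall x : V, (forall zeta, contracted zeta -> pairing zeta x = 0) ->
       (forall e, square_zero_in e -> pairing chi0 (to_sub (lie_bracket e) x) = 0) ->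
         x = 0) ->
  forall chi, f chi = f 0.
Proof.
move=> sep; apply: (polynomial_function_tangent (v0 := chi0) polyf) => eta.
pose X (chi : 'Hom(V, k^o)) := contracted chi \/
  exists2 e, square_zero_in e & chi = precomp (to_sub (lie_bracket e)) chi0.
have [x X0|t Xt ->] := @separating_span _ _ X _ eta.
  apply: sep => [zeta cz | e sqe]; first by apply: X0; left.
  have := X0 (precomp (to_sub (lie_bracket e)) chi0); rewrite comp_lfunE; apply.
  by right; exists e.
have [zeta [cz [es [sq ->]]]] : exists zeta, contracted zeta /\ exists es,
    (forall e, e \in es -> square_zero_in e.2) /\
    \sum_(c <- t) c.1 *: c.2 = zeta + coadjoint_moves es.
  elim: t Xt => [|[c chi] t IHt] Xt.
    exists 0; split; first exact: contracted0.
    by exists [::]; split=> //; rewrite /coadjoint_moves !big_nil addr0.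
  have [|zeta [cz [es [sq Dt]]]] := IHt; first by move=> p tp; apply: Xt; rewrite inE
    tp orbT.
  rewrite big_cons Dt /=; case: (Xt _ (mem_head _ _)) => [/= cchi | [e sqe /= ->]].
    exists (c *: chi + zeta); split; first by apply: contractedD (contractedZ _ _) _.
    by exists es; split=> //; rewrite addrA.
  exists zeta; split=> //; exists ((c, e) :: es); split.
    by move=> e'; rewrite inE => /predU1P[->|/sq].
  by rewrite /coadjoint_moves big_cons addrCA.
exact: invariant_moves.
Qed.

End Invariant.

End InvariantCriterion.

(** * The truncated polynomial algebra *)

Section TruncatedCoefficients.

Variables (k : fieldType) (p : nat) (chp : p \in [pchar k]) (n : nat).

Local Notation A := (trunc chp n).
Local Notation x := (@tvar k p chp n).
Local Notation "''d_' i" := (@pderiv k p chp n i) (at level 8, i at level 2).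

Implicit Types (m : 'X_{1..n}) (a b : A) (i j l q : 'I_n) (D : 'End(A)).

(* The coefficient of x^m, with the value 0 when x^m = 0 in A. *)
Definition tcoef m a : k :=
  if [forall i, m i < p]%N then (repr a)@_m else 0.

Lemma tcoefE m f : (forall i, m i < p)%N -> tcoef m (tclass chp f) = f@_m.
Proof.
move=> ltm; rewrite /tcoef (introT forallP ltm); apply/eqP.
rewrite -subr_eq0 -mcoeffB; apply/eqP; move: m ltm; apply/(@trunc_ideal_coeff _ _ chp).
by rewrite -tclass_eq /tclass reprK.
Qed.

Lemma tcoef_eq0 m a i : (p <= m i)%N -> tcoef m a = 0.
Proof.
by move=> le_p; rewrite /tcoef; case: forallP => // /(_ i); rewrite ltnNge le_p.
Qed.

Lemma small_or m : (forall i, m i < p)%N \/ exists i, (p <= m i)%N.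
Proof.
have [/forallP ltm|] := boolP [forall i, m i < p]%N; first by left.
by rewrite negb_forall => /existsP[i]; rewrite -leqNgt; right; exists i.
Qed.

Fact tcoef_is_linear m : linear (tcoef m : A -> k^o).
Proof.
move=> c a b; have [ltm|[i lei]] := small_or m; last by rewrite !(tcoef_eq0 _ lei)
  scaler0 addr0.
have [[f ->] [g ->]] := (tclass_surj a, tclass_surj b).
by rewrite -linearP !tcoefE // mcoeffD mcoeffZ.
Qed.
HB.instance Definition _ m := GRing.isLinear.Build k A k^o _ (tcoef m : A -> k^o)
  (tcoef_is_linear m).

Lemma tcoefD m a b : tcoef m (a + b) = tcoef m a + tcoef m b.
Proof. exact: (linearD (tcoef m)). Qed.
Lemma tcoef0 m : tcoef m 0 = 0.
Proof. exact: (linear0 (tcoef m)). Qed.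
Lemma tcoefZ m c a : tcoef m (c *: a) = c * tcoef m a.
Proof. exact: (linearZ_LR (tcoef m)). Qed.

Lemma tcoef_inj a b : (forall m, tcoef m a = tcoef m b) -> a = b.
Proof.
have [[f ->] [g ->]] := (tclass_surj a, tclass_surj b) => fg.
apply/eqP; rewrite tclass_eq; apply/trunc_ideal_coeff => m ltm.
by rewrite mcoeffB -!tcoefE // fg subrr.
Qed.

Lemma tcoef1 m : tcoef m 1 = (m == 0%MM)%:R.
Proof.
have p0 : (0 < p)%N by rewrite prime_gt0 ?(pcharf_prime chp).
have [ltm|[i lei]] := small_or m; first by rewrite -(rmorph1 (@tclass k p chp n))
  tcoefE ?mcoeff1.
rewrite (tcoef_eq0 _ lei); case: eqP => // m0.
by move: lei; rewrite m0 mnm0E leqNgt p0.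
Qed.

Lemma tcoef_lt m i c a : (m i < c)%N -> tcoef m (x i ^+ c * a) = 0.
Proof.
move=> ltc; have [ltm|[q leq]] := small_or m; last exact: tcoef_eq0 leq.
have [f ->] := tclass_surj a; rewrite /tvar -rmorphXn -rmorphM tcoefE //.
rewrite mpolyXn mcoeffM big1 // => -[m1 m2] /= /eqP Dm.
rewrite mcoeffX; case: eqP => [Dm1|]; last by rewrite mul0r.
have /mnmP/(_ i) := Dm; rewrite mnmDE -Dm1 mulmnE mnm1E eqxx mul1n => Dmi.
by move: ltc; rewrite Dmi ltnNge leq_addr.
Qed.

Lemma tcoefXM m i c a : (forall q, (U_(i) *+ c + m)%MM q < p)%N ->
  tcoef (U_(i) *+ c + m)%MM (x i ^+ c * a) = tcoef m a.
Proof.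
move=> ltm; have [f ->] := tclass_surj a; rewrite /tvar -rmorphXn -rmorphM !tcoefE //.
  by rewrite mpolyXn [_ * f]mulrC mcoeffMX.
by move=> q; apply: leq_ltn_trans (ltm q); rewrite mnmDE leq_addl.
Qed.

Lemma tcoef_deriv m q a : tcoef m ('d_q a) = (m q).+1%:R * tcoef (m + U_(q))%MM a.
Proof.
have [ltm|[i lei]] := small_or m; last first.
  by rewrite !(@tcoef_eq0 _ _ i) ?mulr0 // mnmDE (leq_trans lei) ?leq_addr.
have [f ->] := tclass_surj a; rewrite pderivE tcoefE // mcoeff_deriv.
have [ltmq|[i lei]] := small_or (m + U_(q))%MM; first by rewrite tcoefE // mulr_natl.
(* The exponent m is reduced and m + U_(q) is not, so the exponent at q is p - 1 and the factor
   vanishes in k. *)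
have Dm : (m q).+1 = p.
  move: lei (ltm i); rewrite mnmDE mnm1E; have [<-|_] := eqVneq q i; rewrite ?addn1
    ?addn0.
    by move=> le1 lt1; apply/eqP; rewrite eqn_leq le1 lt1.
  by move=> le1; rewrite ltnNge le1.
by rewrite Dm (pcharf0 chp) mul0r -mulr_natl (pcharf0 chp) mul0r.
Qed.

Lemma tvar_exp i : x i ^+ p = 0.
Proof.
apply: tcoef_inj => m; rewrite tcoef0.
have [ltm|[q leq]] := small_or m; last exact: tcoef_eq0 leq.
by rewrite -[x i ^+ p]mulr1 tcoef_lt.
Qed.

Lemma tvar_exp_ge i c : (p <= c)%N -> x i ^+ c = 0.
Proof. by move=> le_c; rewrite -(subnK le_c) exprD tvar_exp mulr0. Qed.

Definition vector_field_fun (c : 'I_n -> A) a : A := \sum_q c q * 'd_q a.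

Fact vector_field_is_linear c : linear (vector_field_fun c).
Proof.
move=> d a b; rewrite /vector_field_fun scaler_sumr -big_split.
by apply: eq_bigr => q _; rewrite linearP mulrDr scalerAr.
Qed.
HB.instance Definition _ c := GRing.isLinear.Build k A A _ (vector_field_fun c)
  (vector_field_is_linear c).

Definition vector_field c : 'End(A) := linfun (vector_field_fun c).

Lemma vector_field_deriv c : is_deriv (vector_field c).
Proof.
move=> a b; rewrite !lfunE /= /vector_field_fun mulr_suml mulr_sumr -big_split.
by apply: eq_bigr => q _ /=; rewrite pderivM; ring.
Qed.

Lemma vector_field_var c i : vector_field c (x i) = c i.
Proof.
rewrite lfunE /= /vector_field_fun (bigD1 i) //= pderiv_var eqxx mulr1 big1 ?addr0 //.
by move=> q /negPf qi; rewrite pderiv_var qi mulr0.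
Qed.

Lemma deriv_ext D E : is_deriv D -> is_deriv E -> (forall i, D (x i) = E (x i)) -> D
  = E.
Proof.
move=> DM EM DE; apply/lfunP => a; rewrite !deriv_expand //.
by apply: eq_bigr => i _; rewrite DE.
Qed.

Lemma is_deriv_exp D a c : is_deriv D -> D (a ^+ c.+1) = c.+1%:R * (a ^+ c * D a).
Proof.
move=> DM; elim: c => [|c IHc]; first by rewrite expr1 expr0 !mul1r.
rewrite exprS DM IHc !exprS (mulrS 1 c.+1); move: (c.+1%:R) => d; ring.
Qed.

Lemma deriv_divisible D j c : is_deriv D ->
    (forall i, exists b, D (x i) = x j ^+ c * b) ->
  forall a, exists b, D a = x j ^+ c * b.
Proof.
move=> DM Dx a; have /fin_all_exists[b Db] := Dx.
exists (\sum_i b i * 'd_i a); rewrite (deriv_expand _ DM) mulr_sumr.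
by apply: eq_bigr => i _; rewrite Db mulrA.
Qed.

(** In D (D a) the factor x_j^(p-2) is either kept, which leaves x_j^(2p-4), or differentiated,
    which leaves x_j^(2p-5). A prime above 3 is at least 5, and then 2p - 5 >= p. *)
Lemma deriv_square_zero D j : (3 < p)%N -> is_deriv D ->
    (forall i, exists b, D (x i) = x j ^+ (p - 2) * b) ->
  (D \o D = 0)%VF.
Proof.
move=> p3 DM Dx; have p5 : (p <= p - 3 + (p - 2))%N.
  have /eqP p4 : p != 4 by apply/eqP => p4; have := pcharf_prime chp; rewrite p4.
  by lia.
apply/lfunP => a; rewrite comp_lfunE lfunE /=.
have [b ->] := deriv_divisible DM Dx a; have [c Dc] := deriv_divisible DM Dx b.
have x0 c1 c2 d : (p <= c1 + c2)%N -> x j ^+ c1 * (x j ^+ c2 * d) = 0.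
  by move=> le_p; rewrite mulrA -exprD tvar_exp_ge ?mul0r.
have Dxj : D (x j ^+ (p - 2)) = 0.
  have -> : (p - 2 = (p - 3).+1)%N by lia.
  by have [d Dd] := Dx j; rewrite is_deriv_exp // Dd x0 ?mulr0.
by rewrite DM Dxj Dc mul0r add0r x0 //; lia.
Qed.

End TruncatedCoefficients.

(** * Dilations *)

Section Dilations.

Variables (k : fieldType) (p : nat) (chp : p \in [pchar k]) (n : nat).
Variable w : 'I_n -> nat.

Local Notation A := (trunc chp n).
Local Notation x := (@tvar k p chp n).
Local Notation "''d_' i" := (@pderiv k p chp n i) (at level 8, i at level 2).

Implicit Types (m : 'X_{1..n}) (a b : A) (i j l q : 'I_n) (D E : 'End(A)) (s : k).

Definition wdeg m : nat := \sum_i w i * m i.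

Lemma wdegD m m' : wdeg (m + m')%MM = (wdeg m + wdeg m')%N.
Proof. by rewrite -big_split; apply: eq_bigr => i _; rewrite mnmDE mulnDr. Qed.

Lemma wdegU i c : wdeg (U_(i) *+ c)%MM = (w i * c)%N.
Proof.
rewrite /wdeg (bigD1 i) //= mulmnE mnm1E eqxx mul1n big1 ?addn0 // => j.
by rewrite eq_sym mulmnE mnm1E => /negPf->; rewrite mul0n muln0.
Qed.

Lemma wdegU1 i : wdeg U_(i)%MM = w i.
Proof. by rewrite -[U_(i)%MM]mulm1n wdegU muln1. Qed.

Definition dilation_poly s : {mpoly k[n]} -> A :=
  mmap (in_alg A) (fun i => s ^+ w i *: x i).

Definition dilation_fun s a : A := dilation_poly s (repr a).

Lemma dilation_tclass s f : dilation_fun s (tclass chp f) = dilation_poly s f.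
Proof.
apply/eqP; rewrite -subr_eq0 -[_ - _](rmorphB (mmap (in_alg A) _)).
have: repr (tclass chp f) - f \in trunc_ideal chp by rewrite -tclass_eq /tclass reprK.
case/trunc_idealP=> g ->; apply/eqP; rewrite rmorph_sum big1 // => i _ /=.
by rewrite rmorphM rmorphXn /= mmapX mmap1U exprZn tvar_exp scaler0 mulr0.
Qed.

Fact dilation_is_linear s : linear (dilation_fun s).
Proof.
move=> c a b; have [[f ->] [g ->]] := (tclass_surj a, tclass_surj b).
rewrite -linearP !dilation_tclass /dilation_poly mmapD mmapZ /=.
by rewrite -scalerAl mul1r.
Qed.
HB.instance Definition _ s := GRing.isLinear.Build k A A _ (dilation_fun s)
  (dilation_is_linear s).

Definition dilation s : 'End(A) := linfun (dilation_fun s).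

Lemma dilationE s f : dilation s (tclass chp f) = dilation_poly s f.
Proof. by rewrite lfunE /= dilation_tclass. Qed.

Lemma dilationM s a b : dilation s (a * b) = dilation s a * dilation s b.
Proof.
have [[f ->] [g ->]] := (tclass_surj a, tclass_surj b).
by rewrite -rmorphM !dilationE /dilation_poly rmorphM.
Qed.

Lemma dilationX s m :
  dilation s (tclass chp 'X_[m]) = s ^+ wdeg m *: tclass chp 'X_[m].
Proof.
rewrite dilationE /dilation_poly mmapX mpolyXE_id rmorph_prod /= /mmap1.
rewrite /wdeg (big_morph _ (fun c d => exprD s c d) (expr0 _)) -scaler_prod.
by apply: eq_bigr => i _; rewrite exprZn -exprM rmorphXn.
Qed.

Lemma dilation_var s i : dilation s (x i) = s ^+ w i *: x i.
Proof. by rewrite dilationX wdegU1. Qed.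

Lemma dilationC s (c : k) : dilation s c%:A = c%:A.
Proof. by rewrite -tclassC dilationE /dilation_poly mmapC /= tclassC. Qed.

Lemma tcoef_dilation s m a : tcoef m (dilation s a) = s ^+ wdeg m * tcoef m a.
Proof.
have [ltm|[i lei]] := small_or p m; last by rewrite !(tcoef_eq0 _ lei) mulr0.
have [f ->] := tclass_surj a; rewrite [f]mpolyE !linear_sum mulr_sumr.
apply: eq_bigr => m' _; rewrite !linearZ /= dilationX !tcoefZ mulrCA; congr (_ * _).
rewrite !tcoefE // mcoeffX; case: eqP => [->|_] //; by rewrite !mulr0.
Qed.

Lemma dilationK s a : s != 0 -> dilation s^-1 (dilation s a) = a.
Proof.
move=> s0; apply: tcoef_inj => m.
by rewrite !tcoef_dilation mulrA -exprMn mulVf // expr1n mul1r.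
Qed.

Lemma dilationVK s a : s != 0 -> dilation s (dilation s^-1 a) = a.
Proof. by move=> s0; rewrite -{1}[s]invrK dilationK // invr_eq0. Qed.

Lemma pderiv_dilation s i a : 'd_i (dilation s a) = s ^+ w i *: dilation s ('d_i a).
Proof.
apply: tcoef_inj => m; rewrite tcoefZ tcoef_dilation !tcoef_deriv tcoef_dilation.
by rewrite wdegD wdegU1 exprD; ring.
Qed.

Definition dilate s D : 'End(A) := (dilation s \o D \o dilation s^-1)%VF.

Lemma dilateE s D a : dilate s D a = dilation s (D (dilation s^-1 a)).
Proof. by rewrite /dilate !comp_lfunE. Qed.

Lemma dilate_deriv s D : s != 0 -> is_deriv D -> is_deriv (dilate s D).
Proof.
move=> s0 DM a b; rewrite !dilateE dilationM DM linearD /= !dilationM.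
by rewrite !dilationVK.
Qed.

Lemma dilate_dilation s D a : s != 0 -> dilate s D (dilation s a) = dilation s (D a).
Proof. by move=> s0; rewrite dilateE dilationK. Qed.

(** With [tcoef_dilation] this multiplies the coefficient of x^m d/dx_l by s to the power
    [wdeg m - w l], the degree of that field. *)
Lemma dilate_var s D l : dilate s D (x l) = s^-1 ^+ w l *: dilation s (D (x l)).
Proof. by rewrite dilateE dilation_var !linearZ. Qed.

Lemma dilate_bracket s D E : s != 0 ->
  dilate s (lie_bracket D E) = lie_bracket (dilate s D) (dilate s E).
Proof.
move=> s0; apply/lfunP => a; rewrite lie_bracketE !dilateE lie_bracketE linearB /=.
by rewrite !dilationK.
Qed.

Fact dilate_is_linear s : linear (dilate s).
Proof.
move=> c D E; rewrite /dilate comp_lfunDr comp_lfunDl.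
by rewrite -comp_lfunZr -comp_lfunZl.
Qed.
HB.instance Definition _ s := GRing.isLinear.Build k 'End(A) 'End(A) _
  (dilate s) (dilate_is_linear s).

Definition dilation_stable (L : {vspace 'End(A)}) : Prop :=
  forall s, s != 0 -> {in L, forall D, dilate s D \in L}.

Lemma derived_dilation_stable L : dilation_stable L -> dilation_stable (derived L).
Proof.
move=> stL s s0 D; suff sub: (derived L <= linfun (dilate s) @^-1: derived L)%VS.
  by move/(subvP sub); rewrite -memv_preim lfunE.
apply/derived_sub => {D} D E LD LE; rewrite -memv_preim lfunE /= dilate_bracket //.
by apply: mem_derived; apply: stL.
Qed.

Lemma witt_dilation_stable : dilation_stable (witt chp n).
Proof. by move=> s s0 D /mem_witt DM; apply/mem_witt/dilate_deriv. Qed.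

Section Forms.

Variables (s : k) (s0 : s != 0).
Local Notation forms := (forms chp n).
Implicit Types (u v : forms) (S : {set 'I_n}).

(** The action of the substitution on forms: dx_i is scaled in the same way as x_i. *)
Definition dilation_form u : forms :=
  [ffun S : {set 'I_n} => s ^+ (\sum_(i in S) w i) *: dilation s (u S)].

Fact dilation_form_is_linear : linear dilation_form.
Proof.
move=> c u v; apply/ffunP => S; rewrite !ffunE linearP scalerDr /=.
by rewrite !scalerA mulrC.
Qed.
HB.instance Definition _ := GRing.isLinear.Build k forms forms _ dilation_form
  dilation_form_is_linear.

Lemma dilation_formZ a u :
  dilation_form (fscale a u) = fscale (dilation s a) (dilation_form u).
Proof. by apply/ffunP => S; rewrite !ffunE dilationM scalerAr. Qed.

Lemma dilation_form1 : dilation_form (form1 chp n) = form1 chp n.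
Proof.
apply/ffunP => S; rewrite !ffunE; case: eqP => [->|_]; last by rewrite linear0 scaler0.
by rewrite big_set0 expr0 scale1r -[1]scale1r dilationC.
Qed.

Lemma dilation_dx_wedge i u :
  dilation_form (wedge (dx chp i) u) = s ^+ w i *: wedge (dx chp i) (dilation_form u).
Proof.
apply/ffunP => S; rewrite ffunE wedge_dxE [RHS]ffunE wedge_dxE.
case: ifP => iS; last by rewrite linear0 !scaler0.
rewrite ffunE (big_setD1 i) //= exprD -scalerA -signr_odd !mulr_sign.
by case: odd; rewrite ?linearN /= ?scalerN.
Qed.

Lemma dilation_dx i : dilation_form (dx chp i) = s ^+ w i *: dx chp i.
Proof. by rewrite -[dx chp i]wedge1r dilation_dx_wedge dilation_form1. Qed.

Lemma dilation_dform_wedge a u :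
  dilation_form (wedge (dform a) u) = wedge (dform (dilation s a)) (dilation_form u).
Proof.
rewrite /dform !wedge_suml linear_sum; apply: eq_bigr => i _ /=.
rewrite !wedge_fscalel dilation_formZ dilation_dx_wedge pderiv_dilation.
by apply/ffunP => S; rewrite !ffunE -scalerAl scalerAr.
Qed.

(** Naturality of the Lie derivative. It makes the annihilator and the line stabiliser of a
    homogeneous form stable under the torus. *)
Lemma dilation_lie_der D u : is_deriv D ->
  dilation_form (lie_der D u) = lie_der (dilate s D) (dilation_form u).
Proof.
move=> DM; have DM' := dilate_deriv s0 DM.
elim/forms_ind: u => [|u v IHu IHv|a u IHu|i u IHu].
- by rewrite dilation_form1 !lie_der_form1 // linear0.
- by rewrite !linearD /= IHu IHv.
- by rewrite lie_derZ // linearD /= !dilation_formZ lie_derZ // IHu dilate_dilation.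
rewrite lie_der_dxM // linearD /= dilation_dform_wedge !dilation_dx_wedge IHu.
rewrite linearZ /= lie_der_dxM // dilate_var scalerDr; congr (_ + _).
rewrite linearZ /= !scale_fscale wedge_fscalel fscaleA.
have -> : (s ^+ w i)%:A * (s^-1 ^+ w i)%:A = 1 :> A.
  by rewrite -scalerAl mul1r scalerA -exprMn divff // expr1n scale1r.
by rewrite fscale1.
Qed.

End Forms.

Lemma annihilator_dilation_stable (u : forms chp n) (d : nat) :
    (forall s, s != 0 -> dilation_form s u = s ^+ d *: u) ->
  dilation_stable (annihilator u).
Proof.
move=> su s s0 D /mem_annihilator[DM Du]; apply/mem_annihilator.
split; first exact: dilate_deriv.
have := dilation_lie_der s0 u DM; rewrite Du linear0 su // linearZ /= => /esym/eqP.
by rewrite scaler_eq0 expf_eq0 (negPf s0) andbF => /eqP.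
Qed.

Lemma line_stabiliser_dilation_stable (u : forms chp n) (d : nat) :
    (forall s, s != 0 -> dilation_form s u = s ^+ d *: u) ->
  dilation_stable (line_stabiliser u).
Proof.
move=> su s s0 D /mem_line_stabiliser[DM [a Du]]; apply/mem_line_stabiliser.
split; first exact: dilate_deriv.
exists (dilation s a); have := dilation_lie_der s0 u DM.
rewrite Du dilation_formZ su // !linearZ /= => /(congr1 ( *:%R (s ^+ d)^-1)).
by rewrite !scalerA mulVf ?expf_neq0 // !scale1r.
Qed.

End Dilations.

(** * Probing derivations of degree at most zero *)

Section Detection.

Variables (k : fieldType) (p : nat) (chp : p \in [pchar k]) (p_gt3 : (3 < p)%N).
Variables (n : nat) (w : 'I_n -> nat) (Q : rel 'I_n).
Hypotheses (w_gt0 : forall i, (0 < w i)%N).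

Local Notation A := (trunc chp n).
Local Notation x := (@tvar k p chp n).
Local Notation "''d_' i" := (@pderiv k p chp n i) (at level 8, i at level 2).
Local Notation J := (fun j => w j == 1%N).

Hypotheses (Qsym : forall j l, Q j l = Q l j) (Qirr : forall j, Q j j = false).
Hypothesis QJ : forall j l, Q j l -> J j && J l.

Implicit Types (m : 'X_{1..n}) (a b : A) (i j l q : 'I_n) (D e y : 'End(A)).

Lemma p_gt4 : (4 < p)%N.
Proof.
have /eqP p4 : p != 4 by apply/eqP => p4; have := pcharf_prime chp; rewrite p4.
by have := p_gt3; lia.
Qed.

Lemma natr_unit c : (0 < c < p)%N -> c%:R != 0 :> k.
Proof.
case/andP=> c0 ltc; rewrite -(dvdn_pcharf chp); apply/negP => /(dvdn_leq c0).
by rewrite leqNgt ltc.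
Qed.

Lemma natr_p1 : (p - 1)%:R = -1 :> k.
Proof.
have := pcharf0 chp; rewrite -{1}[p](@subnK 1) ?(ltnW (ltnW (ltnW p_gt3))) //.
by rewrite natrD => /eqP; rewrite addr_eq0 => /eqP.
Qed.

Lemma natr_p2 : (p - 2)%:R = - 2%:R :> k.
Proof.
have := pcharf0 chp; rewrite -{1}[p](@subnK 2) ?(ltnW (ltnW p_gt3)) //.
by rewrite natrD => /eqP; rewrite addr_eq0 => /eqP.
Qed.

Lemma mnmZ1E i c j : (U_(i) *+ c)%MM j = ((i == j) * c)%N.
Proof. by rewrite mulmnE mnm1E. Qed.

Definition mnm_valE := (@mnmDE n, mnmZ1E, @mnm1E n, @mnm0E n).

(** On multiples of x_j^(p-2) and x_j^(p-1) these coefficients become low coefficients of the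
    cofactor, by [probe_at_p2] and [probe_at_p1]. The relation [Q] selects the partners of j. *)
Definition probe_at j a : k :=
  tcoef (U_(j) *+ (p - 2))%MM a + tcoef (U_(j) *+ (p - 1))%MM a
  + \sum_(l | Q j l) tcoef (U_(j) *+ (p - 1) + U_(l))%MM a.

Lemma probe_atD j a b : probe_at j (a + b) = probe_at j a + probe_at j b.
Proof.
rewrite /probe_at !tcoefD (eq_bigr _ (fun l _ => tcoefD _ a b)) big_split /=; ring.
Qed.

Lemma probe_atZ j c a : probe_at j (c *: a) = c * probe_at j a.
Proof.
rewrite /probe_at !tcoefZ (eq_bigr _ (fun l _ => tcoefZ _ c a)) -mulr_sumr; ring.
Qed.

Lemma probe_atN j a : probe_at j (- a) = - probe_at j a.
Proof. by rewrite -scaleN1r probe_atZ mulN1r. Qed.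

Lemma probe_at_sum j (I : Type) (r : seq I) (P : pred I) (F : I -> A) :
  probe_at j (\sum_(i <- r | P i) F i) = \sum_(i <- r | P i) probe_at j (F i).
Proof.
apply: (big_morph (probe_at j)) => [a b|]; first exact: probe_atD.
by rewrite -(scale0r 0) probe_atZ mul0r.
Qed.

Lemma probe_at_p2 j a : probe_at j (x j ^+ (p - 2) * a) =
  tcoef 0%MM a + tcoef U_(j)%MM a + \sum_(l | Q j l) tcoef (U_(j) + U_(l))%MM a.
Proof.
have p5 := p_gt4; have pE : (U_(j) *+ (p - 1) = U_(j) *+ (p - 2) + U_(j))%MM.
  by apply/mnmP => i; rewrite !mnm_valE; lia.
rewrite /probe_at; congr (_ + _ + _).
- rewrite -{1}[(U_(j) *+ (p - 2))%MM]addm0 tcoefXM // => q; rewrite !mnm_valE; lia.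
- rewrite pE tcoefXM // => q; rewrite !mnm_valE; lia.
apply: eq_bigr => l Qjl; rewrite pE -addmA tcoefXM // => q; rewrite !mnm_valE.
by case: (l =P q) Qjl => [<-|_] Qjl; case: (j =P _) => [jl|_]; try lia; rewrite -jl
  Qirr in Qjl.
Qed.

Lemma probe_at_p1 j a : probe_at j (x j ^+ (p - 1) * a) =
  tcoef 0%MM a + \sum_(l | Q j l) tcoef U_(l)%MM a.
Proof.
have p5 := p_gt4; rewrite /probe_at tcoef_lt ?mnm_valE ?eqxx; last lia.
rewrite add0r -{1}[(U_(j) *+ (p - 1))%MM]addm0; congr (_ + _).
  by rewrite tcoefXM // => q; rewrite !mnm_valE; lia.
apply: eq_bigr => l Qjl; rewrite tcoefXM // => q; rewrite !mnm_valE.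
by case: (l =P q) Qjl => [<-|_] Qjl; case: (j =P _) => [jl|_]; try lia; rewrite -jl
  Qirr in Qjl.
Qed.

(** The monomials probed at i contain x_j at most once, and p - 3 >= 2. *)
Lemma probe_at_lt j i a : i != j -> probe_at i (x j ^+ (p - 3) * a) = 0.
Proof.
have p5 := p_gt4; move=> /negPf ij.
rewrite /probe_at !tcoef_lt ?mnm_valE ?ij; [|lia..].
by rewrite !add0r big1 // => l _; rewrite tcoef_lt // !mnm_valE ij; lia.
Qed.

Definition probe D : k := \sum_(j | J j) probe_at j (D (x j)).

Definition divisible_at j c e := forall q, exists b, e (x q) = x j ^+ c * b.

(** One power of x_j is lost because y may differentiate a factor of x_j^(p-2). *)
Lemma bracket_divisible j e y i : is_deriv e -> is_deriv y ->
  divisible_at j (p - 2) e -> exists b, lie_bracket e y (x i) = x j ^+ (p - 3) * b.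
Proof.
move=> eM yM ed; rewrite lie_bracketE.
have pE : (p - 2 = (p - 3).+1)%N by have := p_gt4; lia.
have [b ->] := deriv_divisible eM ed (y (x i)); have [c ->] := ed i.
rewrite yM pE is_deriv_exp // exprSr -mulrA -mulrA.
exists (x j * b - ((p - 3).+1%:R * y (x j) * c + x j * y c)); ring.
Qed.

(** By [bracket_divisible] and [probe_at_lt] only the summand at j survives. *)
Lemma probe_bracket j e y : J j -> is_deriv e -> is_deriv y ->
    divisible_at j (p - 2) e ->
  probe (lie_bracket e y) = probe_at j (e (y (x j))) - probe_at j (y (e (x j))).
Proof.
move=> Jj eM yM ed; rewrite /probe (bigD1 j) //= big1 => [|i /andP[_ ij]].
  by rewrite addr0 lie_bracketE probe_atD probe_atN.
by have [b ->] := bracket_divisible i eM yM ed; rewrite probe_at_lt.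
Qed.

Section LowDegree.

Variables (y : 'End(A)) (yM : is_deriv y).
Hypothesis ylow : forall m l, (w l < wdeg w m)%N -> tcoef m (y (x l)) = 0.

Local Notation Y q j := (tcoef U_(q)%MM (y (x j))).
Local Notation Y0 j := (tcoef 0%MM (y (x j))).

Lemma wdeg_eq0 m : wdeg w m = 0%N -> m = 0%MM.
Proof.
move/eqP; rewrite sum_nat_eq0 => /forallP m0; apply/mnmP => i.
by have := m0 i; rewrite /= muln_eq0 mnm0E => /orP[/eqP wi|/eqP //]; have := w_gt0 i;
  rewrite wi.
Qed.

(** For j of weight 1, y (x j) has weighted degree at most 1: it is a constant plus a linear form in
    the variables of weight 1. *)
Lemma low_pderiv q j : J j -> 'd_q (y (x j)) = (if J q then Y q j else 0)%:A.
Proof.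
move=> /eqP Jj; apply: tcoef_inj => m; rewrite tcoefZ tcoef_deriv tcoef1.
case: (m =P 0%MM) => [->|nm]; last first.
  rewrite ylow ?mulr0 // wdegD wdegU1 Jj.
  have := w_gt0 q; have : wdeg w m <> 0%N by move/wdeg_eq0. lia.
rewrite mnm0E mul1r mulr1 add0m; case: eqP => // wq.
by rewrite ylow // wdegU1 Jj; have := w_gt0 q; lia.
Qed.

Lemma low_expand e j : J j -> is_deriv e ->
  e (y (x j)) = \sum_(q | J q) Y q j *: e (x q).
Proof.
move=> Jj eM; rewrite (deriv_expand _ eM) [RHS]big_mkcond /=; apply: eq_bigr => q _.
rewrite low_pderiv //; case: ifP => _; last by rewrite scale0r mulr0.
by rewrite -scalerAr mulr1.
Qed.

Lemma low_eq0 j : J j -> Y0 j = 0 -> (forall q, J q -> Y q j = 0) -> y (x j) = 0.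
Proof.
move=> /eqP Jj Y00 Yq; apply: tcoef_inj => m; rewrite tcoef0.
have [->//|nm] := eqVneq m 0%MM.
have [lt1|le1] := ltnP 1 (wdeg w m); first by rewrite ylow ?Jj.
have [q mq] : exists q, (0 < m q)%N.
  apply/existsP; apply: contraNT nm; rewrite negb_exists => /forallP m0.
  by apply/eqP/mnmP => q; have := m0 q; rewrite -eqn0Ngt mnm0E => /eqP.
have Dm : m = (m - U_(q) + U_(q))%MM.
  by rewrite submK //; apply/mnm_lepP => i; rewrite mnm1E; case: eqP => [<-|].
have := le1; rewrite Dm wdegD wdegU1 => le1'.
have m0 : (m - U_(q))%MM = 0%MM by apply: wdeg_eq0; have := w_gt0 q; lia.
by rewrite m0 add0m Yq // ; move: le1'; rewrite m0; have := w_gt0 q; lia.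
Qed.

Lemma tcoef_var0 m l a : m l = 0%N -> tcoef m (x l * a) = 0.
Proof. by move=> ml; rewrite -[x l]expr1 tcoef_lt ?ml. Qed.

Lemma tcoef_varD m l a : (forall q, (U_(l) + m)%MM q < p)%N ->
  tcoef (U_(l) + m)%MM (x l * a) = tcoef m a.
Proof.
by move=> ltm; rewrite -[U_(l)%MM]mulm1n -[x l]expr1 tcoefXM // => q; rewrite mulm1n.
Qed.

Lemma U_neq0 i m : (U_(i) + m == 0)%MM = false.
Proof. by apply/eqP => /mnmP/(_ i); rewrite !mnm_valE eqxx. Qed.

Lemma probe_at_p2_one j : probe_at j (x j ^+ (p - 2)) = 1.
Proof.
rewrite -[x j ^+ _]mulr1 probe_at_p2 !tcoef1 eqxx big1 => [|l _].
  by rewrite -[U_(j)%MM]addm0 U_neq0 !addr0.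
by rewrite tcoef1 U_neq0.
Qed.

Lemma probe_at_p1_one j : probe_at j (x j ^+ (p - 1)) = 1.
Proof.
rewrite -[x j ^+ _]mulr1 probe_at_p1 !tcoef1 eqxx big1 ?addr0 // => l _.
by rewrite tcoef1 -[U_(l)%MM]addm0 U_neq0.
Qed.

Lemma probe_at_p2_var j l : l != j -> probe_at j (x j ^+ (p - 2) * x l) = 0.
Proof.
rewrite eq_sym => /negPf lj; rewrite -[x l]mulr1 probe_at_p2 !tcoef_var0 ?mnm_valE
  ?lj //.
rewrite !add0r big1 // => q Qjq; have [<-|/negPf ql] := eqVneq q l.
  rewrite addmC tcoef_varD ?tcoef1; last first.
    by move=> i; rewrite !mnm_valE; have := p_gt4; case: eqP; case: eqP; lia.
  by rewrite -[U_(j)%MM]addm0 U_neq0.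
by rewrite tcoef_var0 // !mnm_valE lj ql.
Qed.

Lemma probe_at_p2_sqr j l : l != j -> probe_at j (x j ^+ (p - 2) * x l ^+ 2) = 0.
Proof.
rewrite eq_sym => /negPf lj; rewrite -[x l ^+ 2]mulr1 probe_at_p2 !tcoef_lt ?mnm_valE
  ?lj //.
rewrite !add0r big1 // => q _; rewrite tcoef_lt // !mnm_valE lj.
by case: eqP.
Qed.

Lemma probe_at_p1_var j l : Q j l -> probe_at j (x j ^+ (p - 1) * x l) = 1.
Proof.
move=> Qjl; rewrite -[x l]mulr1 probe_at_p1 tcoef_var0 ?mnm_valE // add0r (bigD1 l) //=.
rewrite -{1}[U_(l)%MM]addm0 tcoef_varD ?tcoef1 ?eqxx; last first.
  by move=> i; rewrite !mnm_valE; have := p_gt4; case: eqP; lia.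
rewrite big1 ?addr0 // => q /andP[_ /negPf ql].
by rewrite tcoef_var0 // mnm_valE ql.
Qed.

Lemma probe_at_p2_low j i : J j -> J i -> probe_at j (x j ^+ (p - 2) * y (x i)) = Y0
  i + Y j i.
Proof.
move=> /eqP Jj /eqP Ji; rewrite probe_at_p2 big1 ?addr0 // => l _.
by rewrite ylow // wdegD !wdegU1 Jj Ji; have := w_gt0 l; lia.
Qed.

Lemma probe_at_p2_var_low j l i : J j -> J i -> Q j l ->
  probe_at j (x j ^+ (p - 2) * (x l * y (x i))) = Y j i.
Proof.
move=> /eqP Jj /eqP Ji Qjl; have lj : (j == l) = false.
  by apply/eqP => jl; rewrite jl Qirr in Qjl.
rewrite probe_at_p2 !tcoef_var0 ?mnm_valE ?lj // !add0r (bigD1 l) //=.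
rewrite addmC tcoef_varD; last first.
  by move=> q; rewrite !mnm_valE; have := p_gt4; case: eqP; case: eqP; lia.
rewrite big1 ?addr0 // => q /andP[_ /negPf ql].
by rewrite tcoef_var0 // !mnm_valE lj ql.
Qed.

Lemma probe_at_p1_low j i : probe_at j (x j ^+ (p - 1) * y (x i)) = Y0 i + \sum_(q |
  Q j q) Y q i.
Proof. exact: probe_at_p1. Qed.

Section Probes.

Variables (e : 'End(A)) (j : 'I_n).
Hypotheses (Jj : J j) (eM : is_deriv e) (ed : divisible_at j (p - 2) e).
Hypothesis probe0 : probe (lie_bracket e y) = 0.

(** The equation from which the next lemmas extract coefficients of y. Since y (x j) is affine, e (y
    (x j)) is a combination of the components e (x q) with coefficients [Y q j]. *)
Let probe_sum : \sum_(q | J q) Y q j * probe_at j (e (x q)) = probe_at j (y (e (x j))).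
Proof.
move/eqP: probe0; rewrite (probe_bracket Jj eM yM ed) (low_expand Jj eM) probe_at_sum
  subr_eq0 => /eqP <-.
by apply: eq_bigr => q _; rewrite probe_atZ.
Qed.

(** The right side of [probe_sum] is zero because e kills x_j; on the left the components other than
    the one at l are invisible to the probe, by [probe_at_p2_var]. *)
Lemma probe_off_diagonal l :
    J l -> l != j -> probe_at j (e (x l)) = 1 -> e (x j) = 0 ->
    (forall q, J q -> q != l -> q != j ->
       exists c l', l' != j /\ e (x q) = c *: (x j ^+ (p - 2) * x l')) ->
  Y l j = 0.
Proof.
move=> Jl lj el ej0 eq; have := probe_sum.
have ev0 : probe_at j 0 = 0 by rewrite -(scale0r 0) probe_atZ mul0r.
rewrite (bigD1 l) //= el mulr1 ej0 linear0 ev0 big1 ?addr0 // => q /andP[Jq ql].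
have [->|qj] := eqVneq q j; first by rewrite ej0 ev0 mulr0.
by have [c [l' [l'j ->]]] := eq q Jq ql qj; rewrite probe_atZ probe_at_p2_var // !mulr0.
Qed.

Let y_p1 : y (x j ^+ (p - 1)) = - (x j ^+ (p - 2) * y (x j)).
Proof.
have pE : (p - 1 = (p - 2).+1)%N by have := p_gt4; lia.
by rewrite {1}pE is_deriv_exp // -pE -scaler_nat natr_p1 scaleN1r mulN1r.
Qed.

(** As p - 1 = -1 in k, [probe_sum] reads [Y j j] = -([Y0 j] + [Y j j]). *)
Lemma probe_translation :
    e (x j) = x j ^+ (p - 1) ->
    (forall q, J q -> q != j -> exists c, e (x q) = c *: (x j ^+ (p - 2) * x q)) ->
  Y0 j + 2%:R * Y j j = 0.
Proof.
move=> ej e0; have := probe_sum.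
rewrite (bigD1 j) //= ej probe_at_p1_one mulr1 big1 => [|q /andP[Jq qj]]; last first.
  by have [c ->] := e0 q Jq qj; rewrite probe_atZ probe_at_p2_var // !mulr0.
rewrite addr0 y_p1 probe_atN probe_at_p2_low // => Yj.
by rewrite mulr_natl mulr2n {1}Yj; ring.
Qed.

(** Here [probe_sum] reads 2 [Y j j] = 2 ([Y0 l] + [Y l l] - [Y j j]), to be divided by 2. The
    coefficient at x_j^(p-1) x_l makes e (x j) visible on the left, and brings in [Y j j] and
    [Y l l] on the right. *)
Lemma probe_diagonal_pair l :
    Q j l -> (forall q, J q -> q != l -> Y q l = 0) ->
    e (x j) = 2%:R *: (x j ^+ (p - 1) * x l) ->
    e (x l) = x j ^+ (p - 2) * x l ^+ 2 ->
    (forall q, J q -> q != j -> q != l -> e (x q) = 0) ->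
  2%:R * Y j j = Y l l + Y0 l.
Proof.
move=> Qjl Y0l ej el e0; have /andP[_ Jl] := QJ Qjl.
have lj : l != j by apply/eqP => lj; rewrite lj Qirr in Qjl.
have := probe_sum; rewrite (bigD1 j) //= ej probe_atZ probe_at_p1_var // mulr1.
rewrite big1 => [|q /andP[Jq qj]]; last first.
  have [->|ql] := eqVneq q l; first by rewrite el probe_at_p2_sqr // mulr0.
  by rewrite e0 // -(scale0r 0) probe_atZ mul0r mulr0.
rewrite linearZ /= yM y_p1 probe_atZ probe_atD mulNr probe_atN -mulrA [y _ * x l]mulrC.
rewrite probe_at_p2_var_low // probe_at_p1_low (bigD1 l) //= big1 => [|q
  /andP[/QJ/andP[_ Jq] ql]]; last exact: Y0l.
rewrite !addr0 => E; have n2 : 2%:R != 0 :> k by apply: natr_unit; have := p_gt3; lia.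
apply: (mulfI n2); have -> : 2%:R * (2%:R * Y j j) = 2%:R * Y j j + Y j j * 2%:R by
  ring.
by rewrite E; ring.
Qed.

(** As p - 2 = -2 in k, [probe_sum] reads [Y j j] = -2 [Y j j], and 3 is invertible. *)
Lemma probe_diagonal :
    e (x j) = x j ^+ (p - 2) -> (forall q, J q -> q != j -> e (x q) = 0) ->
  Y j j = 0.
Proof.
move=> ej e0; have := probe_sum; have p5 := p_gt4.
rewrite (bigD1 j) //= ej probe_at_p2_one mulr1 big1 => [|q /andP[Jq qj]]; last first.
  by rewrite e0 // -(scale0r 0) probe_atZ mul0r mulr0.
have pE : (p - 2 = (p - 3).+1)%N by lia.
rewrite addr0 {1}pE is_deriv_exp // -pE -scaler_nat natr_p2 -scalerAl mul1r probe_atZ.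
have -> : probe_at j (x j ^+ (p - 3) * y (x j)) = Y j j.
  have /eqP wj := Jj.
  (* The added coefficients belong to weighted degrees above 1 and vanish; they give the right side
     the shape of [probe_at] shifted by x_j^(p-3). *)
  have -> : Y j j = Y j j + tcoef (U_(j) *+ 2)%MM (y (x j)) +
      \sum_(l | Q j l) tcoef (U_(j) *+ 2 + U_(l))%MM (y (x j)).
    have -> : tcoef (U_(j) *+ 2)%MM (y (x j)) = 0 by rewrite ylow // wdegU wj.
    by rewrite big1 ?addr0 // => l _; rewrite ylow // wdegD wdegU wj.
  have E1 : (U_(j) *+ (p - 2) = U_(j) *+ (p - 3) + U_(j))%MM.
    by apply/mnmP => q; rewrite !mnm_valE; lia.
  have E2 : (U_(j) *+ (p - 1) = U_(j) *+ (p - 3) + U_(j) *+ 2)%MM.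
    by apply/mnmP => q; rewrite !mnm_valE; lia.
  rewrite /probe_at E1 E2; congr (_ + _ + _).
  - by rewrite tcoefXM // => q; rewrite !mnm_valE; lia.
  - by rewrite tcoefXM // => q; rewrite !mnm_valE; lia.
  apply: eq_bigr => l Qjl; rewrite -addmA tcoefXM // => q; rewrite !mnm_valE.
  by case: (l =P q) Qjl => [<-|_] Qjl; case: (j =P _) => [jl|_]; try lia; rewrite -jl
    Qirr in Qjl.
move/eqP; rewrite -subr_eq0 mulNr opprK => /eqP Y3.
have n3 : 3%:R != 0 :> k by apply: natr_unit.
by apply: (mulfI n3); rewrite mulr0 -Y3; ring.
Qed.

End Probes.

End LowDegree.

End Detection.

Section ProbeConditions.

Variables (k : fieldType) (p : nat) (chp : p \in [pchar k]) (n : nat) (w : 'I_n -> nat).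
Local Notation A := (trunc chp n).

Definition low_degree (y : 'End(A)) : Prop :=
  forall m l, (w l < wdeg w m)%N -> tcoef m (y (tvar chp l)) = 0.

Definition probed (Q : rel 'I_n) (L : {vspace 'End(A)}) (y : 'End(A)) : Prop :=
  forall j e, w j == 1%N -> e \in L -> is_deriv e -> divisible_at j (p - 2) e ->
    probe w Q (lie_bracket e y) = 0.

End ProbeConditions.

(** * Graded subalgebras of W(n) *)

Section GradedSubalgebra.

Variables (k : closedFieldType) (p : nat) (chp : p \in [pchar k]) (p_gt3 : (3 < p)%N).
Variables (n : nat) (w : 'I_n -> nat) (L : {vspace 'End(trunc chp n)}).
Hypotheses (LW : (L <= witt chp n)%VS) (cL : lie_closed L).
Hypothesis stL : dilation_stable w L.

Local Notation A := (trunc chp n).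
Local Notation x := (@tvar k p chp n).
Local Notation V := (subvs_of L).

Definition torus (s : k) : 'End(V) := lie_conj L (dilation chp w s) (dilation chp w
  s^-1).

Lemma torus_automorphism s : s != 0 -> lie_automorphism (torus s).
Proof.
move=> s0; apply: lie_conj_automorphism => //.
- by apply/lfunP => a; rewrite comp_lfunE dilationVK // id_lfunE.
- by apply/lfunP => a; rewrite comp_lfunE dilationK // id_lfunE.
- exact: stL.
by move=> D LD; have := stL (s := s^-1); rewrite invr_eq0 /dilate invrK; apply.
Qed.

Definition entry_fun m l (u : V) : k^o := tcoef m (vsval u (x l)).

Fact entry_is_linear m l : linear (entry_fun m l).
Proof.
by move=> c u v; rewrite /entry_fun linearP add_lfunE scale_lfunE tcoefD tcoefZ.
Qed.
HB.instance Definition _ m l := GRing.isLinear.Build k V k^o _ (entry_fun m l)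
  (entry_is_linear m l).

Definition entry m l : dual L := linfun (entry_fun m l).

Lemma entryE m l (u : V) : pairing (entry m l) u = tcoef m (vsval u (x l)).
Proof. by rewrite /pairing lfunE. Qed.

Lemma entry_contracted m l : (w l < wdeg w m)%N -> contracted torus (entry m l).
Proof.
(* One factor of s to the power [wdeg m - w l] is the s demanded by [contracted]; hence the
   predecessor in the exponent. *)
move=> ltw; exists (fun s => ('X^((wdeg w m - w l).-1) : {poly k}).[s] *: entry m l).
  exact/polycurve_horner/polycurve_cst.
move=> s s0; rewrite scalerA hornerXn -exprS prednK ?subn_gt0 //.
apply/lfunP => u; rewrite comp_lfunE scale_lfunE -!/(pairing _ _) !entryE lie_conjK;
  last first.
  exact: stL (subvsP u).
rewrite -/(dilate w s _) dilate_var tcoefZ tcoef_dilation mulrA; congr (_ * _).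
by rewrite exprVn mulrC -expfB // ltnW.
Qed.

Lemma contracted_sum (I : Type) (r : seq I) (P : pred I) (F : I -> dual L) :
  (forall i, P i -> contracted torus (F i)) -> contracted torus (\sum_(i <- r | P i)
    F i).
Proof.
by move=> cF; apply: (big_ind (contracted torus)) => //; [exact: contracted0 | exact:
  contractedD].
Qed.

(** The coefficient functionals of positive degree are contracted, so an element orthogonal to all
    contracted functionals has degree at most 0, and the separation condition only concerns such
    elements. *)
Theorem graded_criterion (chi0 : dual L) (f : dual L -> k) :
    contracted torus chi0 ->
    (forall y, y \in L -> is_deriv y ->
       (forall m l, (w l < wdeg w m)%N -> tcoef m (y (x l)) = 0) ->
       (forall e, e \in L -> is_deriv e -> (e \o e = 0)%VF ->
          forall u : V, vsval u = lie_bracket e y -> pairing chi0 u = 0) ->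
       y = 0) ->
    polynomial_function f -> coadjoint_invariant f ->
  forall chi, f chi = f 0.
Proof.
move=> c0 det polyf invf.
apply: (invariant_constant cL _ torus_automorphism polyf invf c0) => [|u u0 e0].
  by apply: (natr_unit chp); have := p_gt3; lia.
apply/(can_inj vsvalK); rewrite linear0; apply: det => [||m l ltw|e Le eM ee v vE].
- exact: subvsP.
- exact/mem_witt/(subvP LW)/subvsP.
- by have := u0 _ (entry_contracted ltw); rewrite entryE.
rewrite -(e0 e (conj Le ee)); congr (pairing chi0 _); apply: (can_inj vsvalK).
by rewrite to_subE /= vsprojK ?vE // cL ?subvsP.
Qed.

Section Probe.

Variable Q : rel 'I_n.

Local Notation J := (fun j => w j == 1%N).

Definition probe_dual : dual L := \sum_(j | J j)
  (entry (U_(j) *+ (p - 2))%MM j + entry (U_(j) *+ (p - 1))%MM j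
   + \sum_(l | Q j l) entry (U_(j) *+ (p - 1) + U_(l))%MM j).

Lemma probe_dualE (u : V) : pairing probe_dual u = probe w Q (vsval u).
Proof.
rewrite pairing_sum; apply: eq_bigr => j _; rewrite 2!pairingD pairing_sum 2!entryE.
by congr (_ + _); apply: eq_bigr => l _; rewrite entryE.
Qed.

Lemma probe_contracted : (forall j, 0 < w j)%N -> contracted torus probe_dual.
Proof.
move=> w0; have p5 := p_gt4 chp p_gt3; apply: contracted_sum => j /eqP wj.
apply: contractedD; first by apply: contractedD; apply: entry_contracted; rewrite
  wdegU wj; lia.
by apply: contracted_sum => l _; apply: entry_contracted; rewrite wdegD wdegU wj; lia.
Qed.

End Probe.

End GradedSubalgebra.

(** * Witt algebras *)

Section Witt.

Variables (k : closedFieldType) (p : nat) (chp : p \in [pchar k]) (p_gt3 : (3 < p)%N)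
  (n : nat).
Local Notation A := (trunc chp n).
Local Notation x := (@tvar k p chp n).
Local Notation one := (fun _ : 'I_n => 1%N).

Definition distinct : rel 'I_n := fun i j => i != j.

Lemma distinct_sym i j : distinct i j = distinct j i. Proof. by rewrite /distinct
  eq_sym. Qed.
Lemma distinct_irr i : distinct i i = false. Proof. by rewrite /distinct eqxx. Qed.

Theorem probe_criterion (w : 'I_n -> nat) (Q : rel 'I_n) (L : {vspace 'End(A)}) (f :
  dual L -> k) :
    (forall i, 0 < w i)%N -> (L <= witt chp n)%VS -> lie_closed L -> dilation_stable
      w L ->
    (forall y, y \in L -> is_deriv y -> low_degree w y -> probed w Q L y -> y = 0) ->
    polynomial_function f -> coadjoint_invariant f ->
  forall chi, f chi = f 0.
Proof.
move=> w0 LW cL stL det polyf invf.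
have := graded_criterion p_gt3 LW cL stL (probe_contracted p_gt3 LW stL Q w0) _ polyf
  invf.
apply.
move=> y Ly yM ylow yp; apply: det => // j e _ Le eM ed.
have Lb := cL _ _ Le Ly; rewrite -(vsprojK Lb) -probe_dualE.
by apply: yp Le eM (deriv_square_zero p_gt3 eM ed) _ _; rewrite vsprojK.
Qed.

Lemma low_derivation_eq0 w (y : 'End(A)) : (forall i, 0 < w i)%N -> is_deriv y ->
  low_degree w y ->
    (forall j, w j = 1%N) ->
    (forall j, tcoef 0%MM (y (x j)) = 0) -> (forall q j, tcoef U_(q)%MM (y (x j)) =
      0) ->
  y = 0.
Proof.
move=> w0 yM ylow w1 y0 Yq; apply: deriv_ext => // [a b|j]; first by rewrite !lfunE
  /= mul0r mulr0 addr0.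
by rewrite lfunE /=; apply: low_eq0 => //; rewrite w1.
Qed.

Lemma witt_invariant (f : dual (witt chp n) -> k) :
  polynomial_function f -> coadjoint_invariant f -> forall chi, f chi = f 0.
Proof.
apply: (@probe_criterion one distinct) => //.
- exact: witt_closed.
- exact: witt_dilation_stable.
move=> y _ yM ylow yp.
have w0 (i : 'I_n) : (0 < one i)%N by [].
have QJ j l : distinct j l -> (one j == 1%N) && (one l == 1%N) by [].
(* W(n) contains every field x_j^c d/dx_l. With c = p - 2 these give the diagonal coefficients (l =
   j) and the others (l != j); c = p - 1 and l = j then gives the constant terms. *)
have probeW j l c : (p - 2 <= c)%N ->
    let e := vector_field (fun q => if q == l then x j ^+ c else 0) in
    is_deriv e /\ divisible_at j (p - 2) e /\ probe one distinct (lie_bracket e y) = 0.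
  move=> le_c e; have eM : is_deriv e by exact: vector_field_deriv.
  have ed : divisible_at j (p - 2) e.
    move=> q; rewrite vector_field_var; case: eqP => _; last by exists 0; rewrite mulr0.
    by exists (x j ^+ (c - (p - 2))); rewrite -exprD subnKC.
  by split=> //; split=> //; apply: (yp j) => //; apply/mem_witt.
have Yd j : tcoef U_(j)%MM (y (x j)) = 0.
  have [eM [ed e0]] := probeW j j _ (leqnn _).
  apply: (probe_diagonal p_gt3 w0 distinct_irr yM ylow _ eM ed e0) => //.
    by rewrite vector_field_var eqxx.
  by move=> q _ /negPf qj; rewrite vector_field_var qj.
have Yo q j : tcoef U_(q)%MM (y (x j)) = 0.
  have [->|qj] := eqVneq q j; first exact: Yd.
  have [eM [ed e0]] := probeW j q _ (leqnn _).
  apply: (probe_off_diagonal p_gt3 w0 distinct_irr yM ylow _ eM ed e0) => //.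
  - by rewrite vector_field_var eqxx (probe_at_p2_one chp p_gt3 distinct_irr).
  - by rewrite vector_field_var eq_sym (negPf qj).
  move=> i _ /negPf iq _; exists 0, q; split=> //.
  by rewrite vector_field_var iq scale0r.
apply: (low_derivation_eq0 w0) => // j.
have [eM [ed e0]] := probeW j j (p - 1)%N (leq_sub2l p (isT : 1 <= 2)%N).
have := probe_translation p_gt3 w0 distinct_irr yM ylow _ eM ed e0.
rewrite Yd mulr0 addr0; apply=> //; first by rewrite vector_field_var eqxx.
by move=> q _ /negPf qj; exists 0; rewrite vector_field_var qj scale0r.
Qed.

End Witt.

(** * Special algebras *)

Section Pairs.

Variables (k : fieldType) (p : nat) (chp : p \in [pchar k]) (p_gt3 : (3 < p)%N).
Variables (n : nat) (w : 'I_n -> nat) (Q : rel 'I_n) (L : {vspace 'End(trunc chp n)}).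
Local Notation A := (trunc chp n).
Local Notation x := (@tvar k p chp n).
Local Notation J := (fun j => w j == 1%N).

Hypotheses (w_gt0 : forall i, (0 < w i)%N).
Hypotheses (Qsym : forall j l, Q j l = Q l j) (Qirr : forall j, Q j j = false).
Hypothesis QJ : forall j l, Q j l -> J j && J l.

Definition field_at j (e : 'End(A)) := [/\ e \in L, is_deriv e & divisible_at j (p -
  2) e].

Hypothesis off_field : forall j l, J j -> J l -> l != j ->
  exists e, [/\ field_at j e, probe_at Q j (e (x l)) = 1, e (x j) = 0 &
    forall q, J q -> q != l -> q != j ->
      exists c l', l' != j /\ e (x q) = c *: (x j ^+ (p - 2) * x l')].

Hypothesis linear_field : forall j l, Q j l ->
  exists e, [/\ field_at j e, e (x j) = x j ^+ (p - 1), e (x l) = x j ^+ (p - 2) * x l &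
    forall q, J q -> q != j -> q != l -> e (x q) = 0].

Hypothesis quadratic_field : forall j l, Q j l ->
  exists e, [/\ field_at j e, e (x j) = 2%:R *: (x j ^+ (p - 1) * x l),
    e (x l) = x j ^+ (p - 2) * x l ^+ 2 &
    forall q, J q -> q != j -> q != l -> e (x q) = 0].

Hypothesis paired : forall j, J j -> exists l, Q j l.

(** Write Y_j for the coefficient of x_j in y (x j). The linear fields give the constant terms as -2
    Y_j. For partners j and l the quadratic field then gives 2 Y_j = Y_l - 2 Y_l = - Y_l. Exchanging
    j and l yields 4 Y_j = Y_j, so 3 Y_j = 0. *)
Lemma pair_criterion y : is_deriv y -> low_degree w y -> probed w Q L y ->
  forall j, J j -> y (x j) = 0.
Proof.
move=> yM ylow yp.
have Yo j l : J j -> J l -> l != j -> tcoef U_(l)%MM (y (x j)) = 0.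
  move=> Jj Jl lj; have [e [[Le eM ed] el ej eq]] := off_field Jj Jl lj.
  exact: (probe_off_diagonal p_gt3 w_gt0 Qirr yM ylow Jj eM ed (yp _ _ Jj Le eM ed)).
have Y0 j : J j -> tcoef 0%MM (y (x j)) = - 2%:R * tcoef U_(j)%MM (y (x j)).
  move=> Jj; have [l Qjl] := paired Jj; have [e [[Le eM ed] ej el eq]] :=
    linear_field Qjl.
  have := probe_translation p_gt3 w_gt0 Qirr yM ylow Jj eM ed (yp _ _ Jj Le eM ed) ej.
  move/(_ _)/eqP; rewrite addr_eq0 mulNr => /(_ _)/eqP; apply => q Jq qj.
  have [->|ql] := eqVneq q l; first by exists 1; rewrite scale1r.
  by exists 0; rewrite scale0r eq.
have Y2 j l : Q j l -> 2%:R * tcoef U_(j)%MM (y (x j)) = - tcoef U_(l)%MM (y (x l)).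
  move=> Qjl; have /andP[Jj Jl] := QJ Qjl; have [e [[Le eM ed] ej el eq]] :=
    quadratic_field Qjl.
  have Yl q : J q -> q != l -> tcoef U_(q)%MM (y (x l)) = 0 by move=> Jq; apply: Yo.
  rewrite (probe_diagonal_pair p_gt3 w_gt0 Qirr QJ yM ylow Jj eM ed (yp _ _ Jj Le eM
    ed) Qjl Yl ej el eq).
  by rewrite Y0 //; ring.
have Yd j : J j -> tcoef U_(j)%MM (y (x j)) = 0.
  move=> Jj; have [l Qjl] := paired Jj; have Y2j := Y2 j l Qjl.
  have Y2l : 2%:R * tcoef U_(l)%MM (y (x l)) = - tcoef U_(j)%MM (y (x j)) by apply:
    Y2; rewrite Qsym.
  have n3 : 3%:R != 0 :> k by apply: (natr_unit chp).
  apply: (mulfI n3); rewrite mulr0.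
  have -> : 3%:R * tcoef U_(j)%MM (y (x j)) =
    2%:R * (2%:R * tcoef U_(j)%MM (y (x j))) - tcoef U_(j)%MM (y (x j)) by ring.
  by rewrite Y2j mulrN Y2l opprK subrr.
move=> j Jj; apply: (low_eq0 p_gt3 w_gt0 ylow Jj) => [|q Jq]; first by rewrite Y0 //
  Yd // mulr0.
by have [->|qj] := eqVneq q j; [exact: Yd | exact: Yo].
Qed.

End Pairs.

(** * Eigenvectors and derived algebras *)

Section Eigenvectors.

Variables (k : fieldType) (p : nat) (chp : p \in [pchar k]) (p_gt3 : (3 < p)%N) (n :
  nat).
Local Notation A := (trunc chp n).
Local Notation x := (@tvar k p chp n).
Implicit Types (D E h e : 'End(A)) (M : {vspace 'End(A)}).

(** The tool for placing explicit fields inside S, H and K, which are given only as derived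
    algebras. *)
Lemma mem_derived_eigen M h e (c : k) :
  h \in M -> e \in M -> c != 0 -> lie_bracket h e = c *: e -> e \in derived M.
Proof.
move=> Mh Me c0 he; have -> : e = c^-1 *: lie_bracket h e by rewrite he scalerA mulVf
  ?scale1r.
by rewrite memvZ // mem_derived.
Qed.

Lemma deriv_eigenX h a (c : k) r : is_deriv h -> h a = c *: a -> h (a ^+ r) = (c *+
  r) *: a ^+ r.
Proof.
move=> hM ha; elim: r => [|r IHr]; first by rewrite expr0 deriv1 // scale0r.
by rewrite exprS hM ha IHr -scalerAl -scalerAr -scalerDl mulrS.
Qed.

Lemma deriv_eigenM h a b (c d : k) : is_deriv h -> h a = c *: a -> h b = d *: b ->
  h (a * b) = (c + d) *: (a * b).
Proof. by move=> hM ha hb; rewrite hM ha hb -scalerAl -scalerAr -scalerDl. Qed.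

Lemma bracket_eigen h e (c : k) : is_deriv h -> is_deriv e ->
    (forall q, exists2 d : k, h (x q) = d *: x q & h (e (x q)) = (c + d) *: e (x q)) ->
  lie_bracket h e = c *: e.
Proof.
move=> hM eM he; apply: deriv_ext => [||q].
- exact: is_deriv_bracket.
- by move=> a b; rewrite !scale_lfunE eM scalerDr scalerAl scalerAr.
have [d hq heq] := he q; rewrite lie_bracketE heq hq linearZ /= scalerDl.
by rewrite addrK scale_lfunE.
Qed.

End Eigenvectors.

Section Special.

Variables (k : fieldType) (p : nat) (chp : p \in [pchar k]) (p_gt3 : (3 < p)%N) (n :
  nat).
Local Notation A := (trunc chp n).
Local Notation x := (@tvar k p chp n).
Local Notation "''d_' i" := (@pderiv k p chp n i) (at level 8, i at level 2).
Local Notation hat := (special_hat chp n).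

Lemma annihilator_witt (u : forms chp n) : (annihilator u <= witt chp n)%VS.
Proof. exact: capvSl. Qed.

Lemma derived_subv (M : {vspace 'End(A)}) : lie_closed M -> (derived M <= M)%VS.
Proof. by move=> cM; apply/derived_sub. Qed.

Lemma special_hat_closed : lie_closed hat.
Proof. exact: annihilator_closed. Qed.

Lemma volumeE : volume chp n = [ffun S => (S == setT)%:R].
Proof. by rewrite -dmon_enum /volume; congr dmon; apply: eq_enum => i; rewrite !inE.
  Qed.

Lemma special_hat_dilation_stable w : dilation_stable w hat.
Proof.
apply: (@annihilator_dilation_stable _ _ _ _ _ _ (\sum_i w i)) => s s0.
apply/ffunP => S; rewrite volumeE !ffunE; case: eqP => [->|_]; last by rewrite
  linear0 !scaler0.
have -> : dilation chp w s 1 = 1 by rewrite -[1]scale1r dilationC.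
by congr (_ ^+ _ *: _); apply: eq_bigl => i; rewrite inE.
Qed.

Lemma special_witt : (special chp n <= witt chp n)%VS.
Proof.
have sub := derived_subv special_hat_closed; apply: subv_trans (annihilator_witt
  (volume chp n)).
rewrite /special; case: ifP => // _; apply: subv_trans sub.
exact/derived_subv/derived_closed/special_hat_closed.
Qed.

Lemma special_dilation_stable w : dilation_stable w (special chp n).
Proof.
by rewrite /special; case: ifP => _; do ?apply: derived_dilation_stable; exact:
  special_hat_dilation_stable.
Qed.

Lemma mem_special_hat D : is_deriv D -> \sum_i 'd_i (D (x i)) = 0 -> D \in hat.
Proof.
by move=> DM D0; apply/mem_annihilator; split=> //; rewrite lie_der_volume // D0
  fscale0l.
Qed.

Variables (j l : 'I_n) (jl : l != j).

Definition plane_field (a b : A) : 'End(A) :=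
  vector_field (fun q => if q == j then a else if q == l then b else 0).

Lemma plane_field_deriv a b : is_deriv (plane_field a b).
Proof. exact: vector_field_deriv. Qed.

Lemma plane_fieldj a b : plane_field a b (x j) = a.
Proof. by rewrite vector_field_var eqxx. Qed.

Lemma plane_fieldl a b : plane_field a b (x l) = b.
Proof. by rewrite vector_field_var (negPf jl) eqxx. Qed.

Lemma plane_field0 a b q : q != j -> q != l -> plane_field a b (x q) = 0.
Proof. by move=> /negPf qj /negPf ql; rewrite vector_field_var qj ql. Qed.

Lemma plane_field_hat a b : 'd_j a + 'd_l b = 0 -> plane_field a b \in hat.
Proof.
move=> ab; apply: mem_special_hat (plane_field_deriv a b) _.
rewrite (bigD1 j) //= plane_fieldj (bigD1 l) //= plane_fieldl addrA ab add0r big1 //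
  => q.
by case/andP=> qj ql; rewrite plane_field0 ?linear0.
Qed.

Let h := plane_field (x j) (- x l).

Let hM : is_deriv h := plane_field_deriv _ _.

Let h_hat : h \in hat.
Proof. by apply: plane_field_hat; rewrite linearN /= !pderiv_var !eqxx subrr. Qed.

(** The relation of sl_2 between x_j d/dx_l and x_l d/dx_j. For S(2), a second derived algebra, the
    eigenvector argument is applied twice, and the second time h itself must lie in the first
    derived algebra. *)
Let h_derived : h \in derived hat.
Proof.
have -> : h = lie_bracket (plane_field 0 (x j)) (plane_field (x l) 0).
  apply: deriv_ext => [||q]; first exact: plane_field_deriv.
    by apply: is_deriv_bracket; apply: plane_field_deriv.
  rewrite lie_bracketE /h; have [->|qj] := eqVneq q j.
    by rewrite !plane_fieldj plane_fieldl !(linear0, oppr0, addr0).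
  have [->|ql] := eqVneq q l; first by rewrite !plane_fieldl plane_fieldj !(linear0,
    sub0r).
  by rewrite !plane_field0 // !(linear0, oppr0, addr0).
by apply: mem_derived; apply: plane_field_hat; rewrite linear0 ?addr0 ?add0r
  pderiv_var ?(negPf jl) // eq_sym (negPf jl).
Qed.

Lemma plane_field_special (a b : A) (c : k) : c != 0 -> 'd_j a + 'd_l b = 0 ->
  h a = (c + 1) *: a -> h b = (c - 1) *: b -> plane_field a b \in special chp n.
Proof.
move=> c0 ab ha hb; have he : lie_bracket h (plane_field a b) = c *: plane_field a b.
  apply: bracket_eigen => // [|q]; first exact: plane_field_deriv.
  have [->|qj] := eqVneq q j; first by exists 1; rewrite /h !plane_fieldj ?scale1r.
  have [->|ql] := eqVneq q l; first by exists (-1); rewrite /h !plane_fieldl ?scaleN1r.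
  by exists 0; rewrite /h ?plane_field0 // ?linear0 ?scaler0 // scale0r.
have e1 := mem_derived_eigen h_hat (plane_field_hat ab) c0 he.
by rewrite /special; case: ifP => _ //; apply: mem_derived_eigen h_derived e1 c0 he.
Qed.

Let hj : h (x j) = 1 *: x j. Proof. by rewrite plane_fieldj scale1r. Qed.
Let hl : h (x l) = - 1 *: x l. Proof. by rewrite plane_fieldl scaleN1r. Qed.

Let djj : 'd_j (x j) = 1. Proof. by rewrite pderiv_var eqxx. Qed.
Let djl : 'd_j (x l) = 0. Proof. by rewrite pderiv_var eq_sym (negPf jl). Qed.
Let dlj : 'd_l (x j) = 0. Proof. by rewrite pderiv_var (negPf jl). Qed.
Let dll : 'd_l (x l) = 1. Proof. by rewrite pderiv_var eqxx. Qed.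

Let p12 : (p - 1 = (p - 2).+1)%N. Proof. by have := p_gt3; lia. Qed.

Let dj_p1 : 'd_j (x j ^+ (p - 1)) = - x j ^+ (p - 2).
Proof.
rewrite p12 (is_deriv_exp _ _ (pderivM j)) djj mulr1 -p12 -scaler_nat.
by rewrite (natr_p1 chp) // scaleN1r mulN1r.
Qed.

Let dlX c : 'd_l (x j ^+ c) = 0.
Proof. by case: c => [|c]; rewrite ?(is_deriv_exp _ _ (pderivM l)) ?dlj ?mulr0 //
  expr0 (deriv1 (pderivM l)). Qed.

Lemma special_off_field : plane_field 0 (x j ^+ (p - 2)) \in special chp n.
Proof.
(* Under h, x_j^(p-2) has eigenvalue p - 2 = -2 and d/dx_l has eigenvalue 1, in total -1. Each
   further factor x_l lowers this by 1, whence -2 and -3 for the linear and quadratic fields. *)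
apply: (@plane_field_special _ _ (-1)); rewrite ?oppr_eq0 ?oner_eq0 ?linear0 ?scaler0
  ?dlX ?addr0 //.
rewrite (deriv_eigenX _ hM hj) (natr_p2 chp) //; congr (_ *: _); ring.
Qed.

Lemma special_linear_field :
  plane_field (x j ^+ (p - 1)) (x j ^+ (p - 2) * x l) \in special chp n.
Proof.
apply: (@plane_field_special _ _ (- 2%:R)).
- by rewrite oppr_eq0 (natr_unit chp) //; have := p_gt3; lia.
- by rewrite dj_p1 pderivM dlX dll mul0r add0r mulr1 addNr.
- rewrite (deriv_eigenX _ hM hj) (natr_p1 chp) //; congr (_ *: _); ring.
rewrite (deriv_eigenM hM (deriv_eigenX _ hM hj) hl) (natr_p2 chp) //.
Qed.

Lemma special_quadratic_field :
  plane_field (2%:R *: (x j ^+ (p - 1) * x l)) (x j ^+ (p - 2) * x l ^+ 2) \in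
    special chp n.
Proof.
apply: (@plane_field_special _ _ (- 3%:R)).
- by rewrite oppr_eq0 (natr_unit chp).
- rewrite linearZ /= !pderivM dj_p1 dlX dll djl !mulr0 mul0r addr0 add0r.
  rewrite !mulr1 mul1r -mulr2n scaler_nat mulNr mulrnAr addrC.
  by rewrite mulNrn subrr.
- rewrite linearZ /= (deriv_eigenM hM (deriv_eigenX _ hM hj) hl) (natr_p1 chp) //
  !scalerA.
  congr (_ *: _); ring.
rewrite (deriv_eigenM hM (deriv_eigenX _ hM hj) (deriv_eigenX _ hM hl)) (natr_p2 chp)
  //.
congr (_ *: _); ring.
Qed.

End Special.

Section SpecialInvariants.

Variables (k : closedFieldType) (p : nat) (chp : p \in [pchar k]) (p_gt3 : (3 < p)%N)
  (n : nat).
Local Notation x := (@tvar k p chp n).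

Lemma special_invariant (f : dual (special chp n) -> k) : (2 <= n)%N ->
  polynomial_function f -> coadjoint_invariant f -> forall chi, f chi = f 0.
Proof.
move=> n2; apply: (@probe_criterion _ _ chp p_gt3 _ (fun=> 1%N) (@distinct n)) => //.
- exact: special_witt.
- by apply: cartan_type_closed; constructor.
- exact: special_dilation_stable.
move=> y _ yM ylow yp; apply: deriv_ext => // [a b|j]; first by rewrite !lfunE /=
  mul0r mulr0 addr0.
have w0 (i : 'I_n) : (0 < 1)%N by [].
have div_plane j' l a b c d : l != j' -> a = x j' ^+ (p - 2) * c -> b = x j' ^+ (p -
  2) * d ->
    divisible_at j' (p - 2) (plane_field j' l a b).
  move=> lj -> -> q; have [->|qj] := eqVneq q j'; first by exists c; rewrite
    plane_fieldj.
  have [->|ql] := eqVneq q l; first by exists d; rewrite plane_fieldl.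
  by exists 0; rewrite mulr0 plane_field0.
have xp1 j' : x j' ^+ (p - 1) = x j' ^+ (p - 2) * x j' by rewrite -exprSr; congr (_
  ^+ _); lia.
rewrite lfunE /=; apply: (@pair_criterion _ _ chp p_gt3 _ (fun=> 1%N) (@distinct n)
  (special chp n)) => //.
- exact: distinct_sym.
- exact: distinct_irr.
- move=> j' l _ _ lj; exists (plane_field j' l 0 (x j' ^+ (p - 2))).
  rewrite plane_fieldj plane_fieldl // (probe_at_p2_one chp p_gt3 (@distinct_irr n));
    split=> //.
    split; [exact: special_off_field | exact: plane_field_deriv |].
    by apply: (div_plane _ _ _ _ 0 1); rewrite ?mulr0 ?mulr1.
  by move=> q _ ql qj; exists 0, q; rewrite plane_field0 // scale0r.
- move=> j' l; rewrite distinct_sym => lj.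
  exists (plane_field j' l (x j' ^+ (p - 1)) (x j' ^+ (p - 2) * x l)).
  rewrite plane_fieldj plane_fieldl //; split=> //; last by move=> q _; apply:
    plane_field0.
  split; [exact: special_linear_field | exact: plane_field_deriv |].
  exact: (div_plane _ _ _ _ (x j') (x l)).
- move=> j' l; rewrite distinct_sym => lj.
  exists (plane_field j' l (2%:R *: (x j' ^+ (p - 1) * x l)) (x j' ^+ (p - 2) * x l
    ^+ 2)).
  rewrite plane_fieldj plane_fieldl //; split=> //; last by move=> q _; apply:
    plane_field0.
  split; [exact: special_quadratic_field | exact: plane_field_deriv |].
  apply: (div_plane _ _ _ _ (2%:R *: (x j' * x l)) (x l ^+ 2)) => //.
  by rewrite xp1 -mulrA scalerAr.
move=> j' _; have [j0|nj0] := eqVneq (j' : nat) 0%N.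
  by exists (Ordinal n2); rewrite /distinct -val_eqE /= j0.
have n0 : (0 < n)%N by apply: leq_trans n2.
by exists (Ordinal n0); rewrite /distinct -val_eqE /=.
Qed.

End SpecialInvariants.

(** * Hamiltonian algebras *)

Section Symplectic.

Variables (k : fieldType) (p : nat) (chp : p \in [pchar k]) (p_gt3 : (3 < p)%N).
Variables (n : nat) (w : 'I_n -> nat) (L : {vspace 'End(trunc chp n)}).
Variables (iota : 'I_n -> 'I_n) (sigma : 'I_n -> k).
Local Notation A := (trunc chp n).
Local Notation x := (@tvar k p chp n).
Local Notation "''d_' i" := (@pderiv k p chp n i) (at level 8, i at level 2).
Local Notation J := (fun j => w j == 1%N).

Hypotheses (w_gt0 : forall i, (0 < w i)%N) (iotaK : involutive iota).
Hypotheses (Jiota : forall j, J j -> J (iota j)) (iota_neq : forall j, J j -> iota j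
  != j).
Hypotheses (sigma_sqr : forall j, J j -> sigma j * sigma j = 1).
Hypotheses (sigma_iota : forall j, J j -> sigma (iota j) = - sigma j).

Definition partner : rel 'I_n := fun j l => J j && (l == iota j).

(** Only the components at variables of weight 1 are prescribed, so that contact fields qualify in
    spite of their different last component. *)
Hypothesis hamiltonian_field : forall j l b, J j -> J l -> l != j -> (b <= 2)%N ->
  exists2 e, field_at L j e &
    forall i, J i -> e (x i) = sigma i *: 'd_(iota i) (x j ^+ (p - 1) * x l ^+ b).

Lemma partner_sym j l : partner j l = partner l j.
Proof.
apply/andP/andP => [] [Jj /eqP ->]; rewrite iotaK eqxx (Jiota Jj) //.
Qed.

Lemma partner_irr j : partner j j = false.
Proof. by apply/negP => /andP[Jj]; rewrite eq_sym (negPf (iota_neq Jj)). Qed.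

Lemma partnerJ j l : partner j l -> J j && J l.
Proof. by case/andP=> Jj /eqP->; rewrite Jj Jiota. Qed.

Let p12 : (p - 1 = (p - 2).+1)%N. Proof. by have := p_gt3; lia. Qed.

Lemma pderiv_power q j c : 'd_q (x j ^+ c) = (c%:R * (q == j)%:R : k) *: x j ^+ c.-1.
Proof.
case: c => [|c]; first by rewrite expr0 (deriv1 (pderivM q)) mul0r scale0r.
rewrite (is_deriv_exp _ _ (pderivM q)) pderiv_var -pred_Sn.
by case: eqP => _; rewrite ?mulr0 ?scale0r // !mulr1 mulr_natl scaler_nat.
Qed.

Lemma pderiv_monomial q j l b : l != j ->
  'd_q (x j ^+ (p - 1) * x l ^+ b) =
    - (q == j)%:R *: (x j ^+ (p - 2) * x l ^+ b)
    + (b%:R * (q == l)%:R : k) *: (x j ^+ (p - 1) * x l ^+ b.-1).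
Proof.
move=> lj; rewrite pderivM !pderiv_power natr_p1 // mulN1r p12 -pred_Sn.
by rewrite -scalerAl -scalerAr.
Qed.

Lemma field_atZ c j e : field_at L j e -> field_at L j (c *: e).
Proof.
case=> Le eM ed; split; first exact: memvZ.
  by move=> a b; rewrite !scale_lfunE eM scalerDr scalerAl scalerAr.
by move=> q; have [b eb] := ed q; exists (c *: b); rewrite scale_lfunE eb scalerAr.
Qed.

Lemma iota_eq i j : (iota i == j) = (i == iota j).
Proof. by rewrite -(inj_eq (can_inj iotaK)) iotaK. Qed.

Lemma symplectic_criterion y : is_deriv y -> low_degree w y -> probed w partner L y ->
  forall j, J j -> y (x j) = 0.
Proof.
apply: (pair_criterion p_gt3 w_gt0 partner_sym partner_irr partnerJ).
(* The factors [sigma] below only normalise signs. If l is the partner of j, the Hamiltonian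
   x_j^(p-1) moves x_l alone among the variables of weight 1. *)
- move=> j l Jj Jl lj; have [lij|lij] := eqVneq l (iota j).
    have [e eL ei] := hamiltonian_field Jj Jl lj (leq0n 2).
    exists (sigma j *: e); split; first exact: field_atZ.
    + rewrite scale_lfunE ei // pderiv_monomial // lij iotaK eqxx sigma_iota // mul0r
      scale0r addr0.
      by rewrite expr0 mulr1 !scalerA !(mulrN, mulNr) !opprK ?mulr1 ?mul1r sigma_sqr
        // scale1r (probe_at_p2_one chp p_gt3 partner_irr).
    + rewrite scale_lfunE ei // pderiv_monomial // (negPf (iota_neq Jj)) mul0r.
      by rewrite oppr0 !scale0r addr0 !scaler0.
    move=> q Jq ql qj; exists 0, l; split=> //; rewrite scale_lfunE ei //
      pderiv_monomial //.
    by rewrite iota_eq -lij (negPf ql) mul0r oppr0 !scale0r addr0 !scaler0.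
  (* Otherwise the Hamiltonian is x_j^(p-1) times the partner of x_l. Up to sign it sends x_l to
     x_j^(p-1), and the partner of x_j to a multiple of x_j^(p-2) that the probe does not see. *)
  have lij' : iota l != j by rewrite iota_eq.
  have [e eL ei] := hamiltonian_field Jj (Jiota Jl) lij' (isT : 1 <= 2)%N.
  exists (sigma l *: e); split; first exact: field_atZ.
  + rewrite scale_lfunE ei // pderiv_monomial // (negPf lij') eqxx oppr0 scale0r add0r.
    by rewrite expr0 mulr1 !scalerA mul1r mulr1 sigma_sqr // scale1r (probe_at_p1_one
      chp p_gt3 partner_irr).
  + rewrite scale_lfunE ei // pderiv_monomial // (negPf (iota_neq Jj)).
    by rewrite (inj_eq (can_inj iotaK)) eq_sym (negPf lj) mulr0 oppr0 !scale0r addr0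
      !scaler0.
  move=> q Jq ql qj; exists (sigma l * (sigma q * - (iota q == j)%:R)), (iota l);
    split=> //.
  rewrite scale_lfunE ei // pderiv_monomial // (inj_eq (can_inj iotaK)) (negPf ql)
    mulr0 scale0r addr0.
  by rewrite !scalerA expr1 mulrA.
- move=> j l /andP[Jj /eqP lij]; have lj : l != j by rewrite lij iota_neq.
  have Jl : J l by rewrite lij Jiota.
  have [e eL ei] := hamiltonian_field Jj Jl lj (isT : 1 <= 2)%N.
  have si : sigma l = - sigma j by rewrite lij sigma_iota.
  exists (sigma j *: e); split; first exact: field_atZ.
  + rewrite scale_lfunE ei // pderiv_monomial // -lij eqxx (negPf lj) oppr0 scale0r
    add0r.
    by rewrite expr0 mulr1 scalerA mulr1 scalerA mulr1 sigma_sqr // scale1r.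
  + rewrite scale_lfunE ei // pderiv_monomial // lij iotaK eqxx eq_sym (negPf
    (iota_neq Jj)).
    by rewrite mulr0 scale0r addr0 -lij si !scalerA !(mulrN, mulNr) !opprK ?mulr1
      ?mul1r sigma_sqr // scale1r expr1.
  move=> q Jq qj ql; rewrite scale_lfunE ei // pderiv_monomial // iota_eq -lij (negPf
    ql).
  by rewrite lij (inj_eq (can_inj iotaK)) (negPf qj) mulr0 oppr0 !scale0r addr0
    !scaler0.
- move=> j l /andP[Jj /eqP lij]; have lj : l != j by rewrite lij iota_neq.
  have Jl : J l by rewrite lij Jiota.
  have [e eL ei] := hamiltonian_field Jj Jl lj (leqnn 2).
  have si : sigma l = - sigma j by rewrite lij sigma_iota.
  exists (sigma j *: e); split; first exact: field_atZ.
  + rewrite scale_lfunE ei // pderiv_monomial // -lij eqxx (negPf lj) oppr0 scale0r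
    add0r.
    by rewrite expr1 mulr1 !scalerA sigma_sqr // mul1r.
  + rewrite scale_lfunE ei // pderiv_monomial // lij iotaK eqxx eq_sym (negPf
    (iota_neq Jj)).
    by rewrite mulr0 scale0r addr0 -lij si !scalerA !(mulrN, mulNr) !opprK ?mulr1
      ?mul1r sigma_sqr // scale1r.
  move=> q Jq qj ql; rewrite scale_lfunE ei // pderiv_monomial // iota_eq -lij (negPf
    ql).
  by rewrite lij (inj_eq (can_inj iotaK)) (negPf qj) mulr0 oppr0 !scale0r addr0
    !scaler0.
by move=> j Jj; exists (iota j); rewrite /partner Jj eqxx.
Qed.

End Symplectic.

(** * Diagonal fields and the symmetry of second derivatives *)

Section DiagonalFields.

Variables (k : fieldType) (p : nat) (chp : p \in [pchar k]) (p_gt3 : (3 < p)%N) (n :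
  nat).
Local Notation A := (trunc chp n).
Local Notation x := (@tvar k p chp n).
Local Notation "''d_' i" := (@pderiv k p chp n i) (at level 8, i at level 2).

Lemma diagonal_pderiv (h : 'End(A)) (d : 'I_n -> k) q f : is_deriv h ->
  (forall i, h (x i) = d i *: x i) -> h ('d_q f) = 'd_q (h f) - d q *: 'd_q f.
Proof.
move=> hM hd; rewrite !(deriv_expand _ hM) linear_sum /=.
have E i : 'd_q (h (x i) * 'd_i f) = (q == i)%:R * (d i *: 'd_i f) + h (x i) * 'd_i
  ('d_q f).
  rewrite pderivM pderivC hd linearZ /= pderiv_var; congr (_ + _).
  by rewrite -scalerAl scalerAr.
rewrite [X in _ = X - _](eq_bigr _ (fun i _ => E i)) big_split /=.
have -> : \sum_i (q == i)%:R * (d i *: 'd_i f) = d q *: 'd_q f.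
  rewrite (bigD1 q) //= eqxx mul1r big1 ?addr0 // => i iq.
  by rewrite eq_sym (negPf iq) mul0r.
by rewrite [X in _ = X - _]addrC addrK.
Qed.

Lemma dformM (a b : A) : dform (a * b) = fscale a (dform b) + fscale b (dform a).
Proof.
rewrite /dform !linear_sum -big_split; apply: eq_bigr => i _ /=.
by rewrite !fscaleA -fscaleDl pderivM; congr (fscale _ _); ring.
Qed.

Lemma oppr_eq_self0 (V : lmodType k) (u : V) : u = - u -> u = 0.
Proof.
move=> uN; have n2 : 2%:R != 0 :> k by apply: (natr_unit chp); have := p_gt3; lia.
by apply: (scalerI n2); rewrite scaler0 scaler_nat mulr2n {2}uN subrr.
Qed.

(** This is d (df) = 0 in coordinates: second derivatives are symmetric, dx_j /\ dx_i is
    antisymmetric, and 2 is invertible. *)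
Lemma hessian_wedge (f : A) : \sum_i wedge (dform ('d_i f)) (dx chp i) = 0.
Proof.
apply: oppr_eq_self0.
have E : \sum_i wedge (dform ('d_i f)) (dx chp i) =
    \sum_i \sum_j fscale ('d_j ('d_i f)) (wedge (dx chp j) (dx chp i)).
  apply: eq_bigr => i _; rewrite /dform wedge_suml; apply: eq_bigr => j _.
  by rewrite wedge_fscalel.
rewrite {1}E exchange_big E -sumrN; apply: eq_bigr => i _; rewrite -sumrN; apply:
  eq_bigr => j _.
by rewrite pderivC dx_anticomm fscaleN.
Qed.

End DiagonalFields.

Section Reversal.

Variable m : nat.
Implicit Types i j : 'I_(2 * m).

Lemma rev_ord_ltn i : (rev_ord i < m)%N = ~~ (i < m)%N.
Proof. by rewrite /=; have := ltn_ord i; lia. Qed.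

Lemma rev_ord_neq i : rev_ord i != i.
Proof. by rewrite -val_eqE /=; have := ltn_ord i; lia. Qed.

Lemma rev_ord_eq i j : (rev_ord i == j) = (i == rev_ord j).
Proof. by rewrite -(inj_eq rev_ord_inj) rev_ordK. Qed.

End Reversal.

Section MonomialDivisibility.

Variables (k : fieldType) (p : nat) (chp : p \in [pchar k]) (p_gt3 : (3 < p)%N) (n :
  nat).
Local Notation x := (@tvar k p chp n).

Lemma pderiv_divisible q j l b : l != j ->
  exists c, pderiv chp q (x j ^+ (p - 1) * x l ^+ b) = x j ^+ (p - 2) * c.
Proof.
move=> lj; rewrite pderiv_monomial //.
have -> : (p - 1 = (p - 2).+1)%N by have := p_gt3; lia.
exists (- (q == j)%:R *: x l ^+ b + (b%:R * (q == l)%:R : k) *: (x j * x l ^+ b.-1)).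
by rewrite mulrDr -!scalerAr mulrA exprSr.
Qed.

End MonomialDivisibility.

Section Hamiltonian.

Variables (k : fieldType) (p : nat) (chp : p \in [pchar k]) (p_gt3 : (3 < p)%N) (m :
  nat).
Local Notation n := (2 * m)%N.
Local Notation A := (trunc chp n).
Local Notation x := (@tvar k p chp n).
Local Notation "''d_' i" := (@pderiv k p chp n i) (at level 8, i at level 2).
Local Notation hat := (hamiltonian_hat chp m).
Implicit Types (i j l : 'I_n) (f : A).

Definition hsign i : k := if (i < m)%N then 1 else -1.

Lemma hsign_rev i : hsign (rev_ord i) = - hsign i.
Proof. by rewrite /hsign rev_ord_ltn; case: (i < m)%N; rewrite ?opprK. Qed.

Lemma hsign_sqr i : hsign i * hsign i = 1.
Proof. by rewrite /hsign; case: ifP; rewrite ?mulrNN mulr1. Qed.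

Definition ham f : 'End(A) := vector_field (fun i => hsign i *: 'd_(rev_ord i) f).

Lemma ham_deriv f : is_deriv (ham f). Proof. exact: vector_field_deriv. Qed.

Lemma ham_var f i : ham f (x i) = hsign i *: 'd_(rev_ord i) f.
Proof. exact: vector_field_var. Qed.

Lemma ham_hat f : ham f \in hat.
Proof.
apply/mem_annihilator; split; first exact: ham_deriv.
(* The Lie derivative of dx_i /\ dx_(rev i) consists of the two terms of [hessian_wedge] with
   indices i and rev i. *)
rewrite /omegaH linear_sum /= -[RHS](hessian_wedge p_gt3 f) [RHS](bigID (fun i : 'I_n
  => (i < m)%N)) /=.
rewrite [X in _ = _ + X](reindex_inj rev_ord_inj) /=.
rewrite [X in _ = _ + X](eq_bigl (fun i : 'I_n => (i < m)%N)); last first.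
  by move=> i; rewrite rev_ord_ltn negbK.
rewrite -big_split; apply: eq_bigr => i ltim /=.
rewrite lie_der_wedge ?lie_der_dx; [|exact: ham_deriv..].
rewrite !ham_var hsign_rev rev_ordK /hsign ltim scale1r scaleN1r addrC; congr (_ + _).
have := dform_dx_anticomm ('d_i f) i (form1 chp n); rewrite !wedge1r => ->.
by rewrite linearN /= wedgeNr.
Qed.

Lemma hamiltonian_hat_closed : lie_closed hat.
Proof. exact: annihilator_closed. Qed.

Lemma hamiltonian_witt : (hamiltonian chp m <= witt chp n)%VS.
Proof.
exact: subv_trans (derived_subv hamiltonian_hat_closed) (annihilator_witt _).
Qed.

Lemma hamiltonian_dilation_stable : dilation_stable (fun=> 1%N) (hamiltonian chp m).
Proof.
apply/derived_dilation_stable/(@annihilator_dilation_stable _ _ _ _ _ _ 2) => s s0.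
rewrite /omegaH linear_sum scaler_sumr; apply: eq_bigr => i _ /=.
by rewrite dilation_dx_wedge dilation_dx !scale_fscale wedge_fscaler fscaleA
  -scalerAl mul1r scalerA -exprD.
Qed.

(** The field of x_j x_(rev j) is diagonal with opposite eigenvalues on partners. It therefore
    preserves the symplectic form, and the field of f inherits the eigenvalue of f. *)
Lemma ham_mem f j (c : k) : c != 0 ->
    ham (x j * x (rev_ord j)) f = (hsign (rev_ord j) * c) *: f ->
  ham f \in hamiltonian chp m.
Proof.
move=> c0 hf; set h := ham _ in hf; have hM : is_deriv h := ham_deriv _.
pose d i : k := hsign (rev_ord j) * ((rev_ord j == i)%:R - (j == i)%:R).
have hd i : h (x i) = d i *: x i.
  rewrite ham_var pderivM !pderiv_var /d rev_ord_eq (inj_eq rev_ord_inj) [rev_ord j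
    == i]eq_sym [j == i]eq_sym.
  have [->|ij] := eqVneq i j.
    by rewrite eq_sym (negPf (rev_ord_neq j)) mul0r add0r mulr1 sub0r mulrN1
      hsign_rev opprK.
  have [->|ij'] := eqVneq i (rev_ord j); last by rewrite mul0r mulr0 addr0 subrr
    mulr0 scale0r scaler0.
  by rewrite mul1r mulr0 addr0 subr0 mulr1.
have d_rev i : d (rev_ord i) = - d i.
  by rewrite /d (inj_eq rev_ord_inj) [j == rev_ord i]eq_sym rev_ord_eq [i ==
    _]eq_sym; ring.
apply: (mem_derived_eigen (ham_hat _) (ham_hat f) (c := hsign (rev_ord j) * c)).
  rewrite mulf_neq0 //; apply/eqP => s0; have := hsign_sqr (rev_ord j).
  by rewrite s0 mul0r => /esym/eqP; rewrite oner_eq0.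
apply: bracket_eigen => [||i]; [exact: hM | exact: ham_deriv |].
exists (d i); first exact: hd.
rewrite ham_var linearZ /= (diagonal_pderiv _ _ hM hd) hf linearZ /= d_rev scaleNr
  opprK.
by rewrite -scalerDl !scalerA mulrC.
Qed.

Lemma ham_monomial_mem j l b : l != j -> (b <= 2)%N ->
  ham (x j ^+ (p - 1) * x l ^+ b) \in hamiltonian chp m.
Proof.
move=> lj le_b; pose h := ham (x j * x (rev_ord j)).
have hM : is_deriv h := ham_deriv _.
have hj : h (x j) = - hsign (rev_ord j) *: x j.
  rewrite ham_var pderivM !pderiv_var (negPf (rev_ord_neq j)) eqxx mul0r add0r mulr1.
  by rewrite hsign_rev opprK.
have hj' : h (x (rev_ord j)) = hsign (rev_ord j) *: x (rev_ord j).
  rewrite ham_var rev_ordK pderivM !pderiv_var eqxx eq_sym (negPf (rev_ord_neq j)).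
  by rewrite mul1r mulr0 addr0.
have [lj'|lj'] := eqVneq l (rev_ord j).
  (* Up to the common sign, x_j^(p-1) contributes -(p - 1) = 1 and the power of the partner
     contributes b; b + 1 <= 3 is invertible. *)
  apply: (@ham_mem _ j (b.+1)%:R).
    by apply: (natr_unit chp); have := p_gt3; lia.
  rewrite lj' (deriv_eigenM hM (deriv_eigenX _ hM hj) (deriv_eigenX _ hM hj')).
  by congr (_ *: _); rewrite -[X in X + _]mulr_natr -[X in _ + X]mulr_natr natr_p1 //
    mulrN1 opprK -[b.+1]add1n natrD; ring.
have hl : h (x l) = 0 *: x l.
  rewrite ham_var pderivM !pderiv_var rev_ord_eq (negPf lj') (inj_eq rev_ord_inj)
    (negPf lj).
  by rewrite mul0r mulr0 addr0 scaler0 scale0r.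
apply: (@ham_mem _ j 1); first exact: oner_neq0.
rewrite (deriv_eigenM hM (deriv_eigenX _ hM hj) (deriv_eigenX _ hM hl)).
by congr (_ *: _); rewrite -[X in X + _]mulr_natr natr_p1 // mulrN1 opprK mul0rn
  addr0 mulr1.
Qed.

End Hamiltonian.

Section HamiltonianInvariants.

Variables (k : closedFieldType) (p : nat) (chp : p \in [pchar k]) (p_gt3 : (3 < p)%N)
  (m : nat).
Local Notation x := (@tvar k p chp (2 * m)).

Lemma hamiltonian_invariant (f : dual (hamiltonian chp m) -> k) :
  polynomial_function f -> coadjoint_invariant f -> forall chi, f chi = f 0.
Proof.
pose Q := partner (fun _ : 'I_(2 * m) => 1%N) (@rev_ord (2 * m)).
apply: (@probe_criterion _ _ chp p_gt3 _ (fun=> 1%N) Q) => //.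
- exact: hamiltonian_witt.
- exact/derived_closed/hamiltonian_hat_closed.
- exact: hamiltonian_dilation_stable.
move=> y _ yM ylow yp; apply: deriv_ext => // [a b|j]; first by rewrite !lfunE /=
  mul0r mulr0 addr0.
rewrite lfunE /=; apply: (symplectic_criterion p_gt3 (iota := @rev_ord (2 * m))
  (sigma := @hsign k m)) yM ylow yp _ _ => //.
- exact: rev_ordK.
- by move=> i _; apply: rev_ord_neq.
- by move=> i _; apply: hsign_sqr.
- by move=> i _; apply: hsign_rev.
move=> {}j l b _ _ lj le_b; exists (ham (x j ^+ (p - 1) * x l ^+ b)); last by move=>
  i _; apply: ham_var.
split; [exact: ham_monomial_mem | exact: ham_deriv |].
by move=> q; rewrite ham_var; have [c ->] := pderiv_divisible chp p_gt3 (rev_ord q) b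
  lj; exists (hsign k q *: c); rewrite scalerAr.
Qed.

End HamiltonianInvariants.

(** * Contact algebras *)

Section ContactIndices.

Variable m : nat.
Local Notation n := (2 * m).+1.

Definition lower (i : 'I_(2 * m)) : 'I_n := widen_ord (leqnSn (2 * m)) i.

Variant index_spec (q : 'I_n) : option 'I_(2 * m) -> Prop :=
  | LowerIndex i of q = lower i : index_spec q (Some i)
  | TopIndex of q = ord_max : index_spec q None.

Lemma indexP (q : 'I_n) : index_spec q (insub (q : nat)).
Proof.
case: insubP => [i _ qi|ge_q]; constructor; apply: val_inj => //=.
by have := ltn_ord q; lia.
Qed.

Lemma insub_lower i : insub (lower i : nat) = Some i.
Proof. exact: valK. Qed.

Lemma insub_max : insub (@ord_max (2 * m) : nat) = None :> option 'I_(2 * m).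
Proof. by case: insubP => //= i; rewrite ltnn. Qed.

Lemma lower_inj : injective lower.
Proof. by move=> i j /(congr1 val) /= /val_inj. Qed.

Lemma lower_neq_max i : (lower i == ord_max) = false.
Proof. by rewrite -val_eqE /= ltn_eqF. Qed.

(** With these weights the contact form is homogeneous of degree 2. *)
Definition contact_weight (q : 'I_n) : nat := if q == ord_max then 2 else 1.

Lemma contact_weight_lower i : contact_weight (lower i) = 1%N.
Proof. by rewrite /contact_weight lower_neq_max. Qed.

Lemma contact_weight1 q : contact_weight q == 1%N -> exists i, q = lower i.
Proof. by case: (indexP q) => [i ->|->]; [exists i | rewrite /contact_weight eqxx]. Qed.

(** Fixing the last index makes this an involution of all indices; only indices of weight 1 are
    paired by [partner]. *)
Definition contact_partner (q : 'I_n) : 'I_n :=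
  if insub (q : nat) is Some i then lower (rev_ord i) else q.

Lemma contact_partner_lower i : contact_partner (lower i) = lower (rev_ord i).
Proof. by rewrite /contact_partner insub_lower. Qed.

Lemma contact_partnerK : involutive contact_partner.
Proof.
move=> q; case: (indexP q) => [i ->|->]; first by rewrite !contact_partner_lower
  rev_ordK.
by rewrite /contact_partner !insub_max.
Qed.

End ContactIndices.

Section Contact.

Variables (k : fieldType) (p : nat) (chp : p \in [pchar k]) (p_gt3 : (3 < p)%N) (m :
  nat).
Local Notation n := (2 * m).+1.
Local Notation A := (trunc chp n).
Local Notation x := (@tvar k p chp n).
Local Notation "''d_' i" := (@pderiv k p chp n i) (at level 8, i at level 2).
Local Notation hat := (contact_hat chp m).
Local Notation z := (@ord_max (2 * m)).
Local Notation xl i := (x (lower i)).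
Local Notation dl i f := ('d_(lower i) f).
Local Notation sg := (@hsign k m).
Implicit Types (i j l : 'I_(2 * m)) (q : 'I_n) (f g a b : A).

Definition euler f : A := \sum_i xl i * dl i f.

(* Twice the contact field with Hamiltonian f, which avoids denominators. *)
Definition contact_field f : 'End(A) := vector_field (fun q =>
  if insub (q : nat) is Some i then - sg i *: dl (rev_ord i) f + xl i * 'd_z f
  else f *+ 2 - euler f).

Lemma contact_field_deriv f : is_deriv (contact_field f).
Proof. exact: vector_field_deriv. Qed.

Lemma contact_field_lower f i :
  contact_field f (xl i) = - sg i *: dl (rev_ord i) f + xl i * 'd_z f.
Proof. by rewrite vector_field_var insub_lower. Qed.

Lemma contact_field_top f : contact_field f (x z) = f *+ 2 - euler f.
Proof. by rewrite vector_field_var insub_max. Qed.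

Lemma omegaKE : omegaK chp m =
  \sum_i fscale (sg i *: xl i) (dx chp (lower (rev_ord i))) + dx chp z.
Proof.
rewrite /omegaK; congr (_ + _); rewrite big_split /= [RHS](bigID (fun i => (i <
  m)%N)) /=.
congr (_ + _); first by apply: eq_bigr => i lti; rewrite /hsign lti scale1r.
rewrite [RHS](reindex_inj rev_ord_inj) /= [RHS](eq_bigl (fun i : 'I_(2 * m) => (i <
  m)%N)); last first.
  by move=> i; rewrite -[in LHS]/(nat_of_ord (rev_ord i)) rev_ord_ltn negbK.
apply: eq_bigr => i lti; rewrite hsign_rev /hsign lti rev_ordK scaleN1r.
by apply/ffunP => S; rewrite !ffunE mulNr.
Qed.

Lemma dformE a : dform a = \sum_i fscale (dl i a) (dx chp (lower i)) + fscale ('d_z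
  a) (dx chp z).
Proof. by rewrite /dform big_ord_recr. Qed.

Lemma fscaleNl a (u : forms chp n) : fscale (- a) u = - fscale a u.
Proof. by apply/ffunP => S; rewrite !ffunE mulNr. Qed.

Lemma signed_pairs : \sum_i sg i *: (xl i * xl (rev_ord i)) = 0 :> A.
Proof.
apply: (oppr_eq_self0 chp p_gt3); rewrite -sumrN [LHS](reindex_inj rev_ord_inj).
by apply: eq_bigr => i _; rewrite hsign_rev rev_ordK mulrC scaleNr.
Qed.

(** Split the form as th + dz. The derivative of th is 2 S1 + d(euler f) and that of dz is 2 df -
    d(euler f), so the Euler terms cancel. Since S1 = (d_z f) th - et and df = et + (d_z f) dz, what
    remains is 2 (d_z f) (th + dz). *)
Lemma lie_der_contact_field f :
  lie_der (contact_field f) (omegaK chp m) = fscale ('d_z f *+ 2) (omegaK chp m).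
Proof.
set E := contact_field f; have EM : is_deriv E := contact_field_deriv f.
pose th : forms chp n := \sum_i fscale (sg i *: xl i) (dx chp (lower (rev_ord i))).
pose et : forms chp n := \sum_i fscale (dl i f) (dx chp (lower i)).
pose S1 : forms chp n := \sum_i fscale (sg i *: E (xl i)) (dx chp (lower (rev_ord i))).
have S1E : S1 = fscale ('d_z f) th - et.
  rewrite /et (reindex_inj rev_ord_inj) /= /S1 /th linear_sum -sumrB; apply: eq_bigr
    => i _ /=.
  rewrite fscaleA -fscaleNl -fscaleDl; congr (fscale _ _).
  rewrite contact_field_lower scalerDr scalerA mulrN hsign_sqr scaleN1r addrC.
  by congr (_ - _); rewrite -scalerAr mulrC.
(* Integration by parts. The total differential is that of [euler f], because the d_z f terms form
   the sum [signed_pairs], whose terms cancel under reversal. *)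
have S2E : \sum_i fscale (sg i *: xl i) (dform (E (xl (rev_ord i)))) = dform (euler
  f) + S1.
  have E1 i : fscale (sg i *: xl i) (dform (E (xl (rev_ord i)))) =
      dform ((sg i *: xl i) * E (xl (rev_ord i)))
      + fscale (sg (rev_ord i) *: E (xl (rev_ord i))) (dx chp (lower (rev_ord
        (rev_ord i)))).
    rewrite dformM -addrA rev_ordK hsign_rev; apply/esym.
    have -> : dform (sg i *: xl i) = sg i *: dx chp (lower i).
      rewrite linearZ /=; congr (_ *: _); rewrite /dform (bigD1 (lower i)) //=
        pderiv_var eqxx fscale1.
      by rewrite big1 ?addr0 // => q /negPf qi; rewrite pderiv_var qi fscale0l.
    rewrite scale_fscale fscaleA -fscaleDl.
    by rewrite -scalerAr mulr1 scaleNr subrr fscale0l addr0.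
  rewrite (eq_bigr _ (fun i _ => E1 i)) big_split /= -linear_sum /=; congr (dform _ +
    _); last first.
    by rewrite /S1 [RHS](reindex_inj rev_ord_inj).
  transitivity (euler f + 'd_z f * \sum_i sg i *: (xl i * xl (rev_ord i))).
    rewrite mulr_sumr /euler -big_split; apply: eq_bigr => i _ /=.
    rewrite contact_field_lower rev_ordK hsign_rev opprK mulrDr -scalerAl -!scalerAr
      scalerA.
    rewrite hsign_sqr scale1r -scalerAl; congr (_ + _ *: _).
    by rewrite mulrA mulrC.
  by rewrite signed_pairs mulr0 addr0.
rewrite omegaKE linearD linear_sum /= lie_der_dx // contact_field_top.
have -> : \sum_i lie_der E (fscale (sg i *: xl i) (dx chp (lower (rev_ord i)))) =
    S1 + (dform (euler f) + S1).
  rewrite -S2E -big_split; apply: eq_bigr => i _ /=.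
  by rewrite lie_derZ // lie_der_dx // linearZ.
rewrite linearB /= raddfMn /= -/E (dformE f) -/et -/th fscaleDr S1E.
have -> : fscale ('d_z f *+ 2) th = fscale ('d_z f) th *+ 2.
  by rewrite !mulr2n fscaleDl.
have -> : fscale ('d_z f *+ 2) (dx chp z) = fscale ('d_z f) (dx chp z) *+ 2.
  by rewrite !mulr2n fscaleDl.
rewrite !mulr2n.
move: (fscale _ th) (fscale _ (dx _ _)) (dform (euler f)) (et) => T Z U V.
by apply/ffunP => S; rewrite !ffunE; ring.
Qed.

Lemma contact_field_hat f : contact_field f \in hat.
Proof.
apply/mem_line_stabiliser; split; first exact: contact_field_deriv.
by exists ('d_z f *+ 2); apply: lie_der_contact_field.
Qed.

(** The condition on partners says that the diagonal field scales the contact form by d z. This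
    shifts the eigenvalue of the field of f from c to c - d z. *)
Lemma contact_field_mem g f (d : 'I_n -> k) (c : k) :
    (forall q, contact_field g (x q) = d q *: x q) ->
    (forall i, d (lower i) + d (lower (rev_ord i)) = d z) ->
    contact_field g f = c *: f -> c != d z ->
  contact_field f \in contact chp m.
Proof.
set h := contact_field g => hd dd hf cd; have hM : is_deriv h := contact_field_deriv g.
have hp q : h ('d_q f) = (c - d q) *: 'd_q f.
  by rewrite (diagonal_pderiv _ _ hM hd) hf linearZ /= scalerBl.
apply: (mem_derived_eigen (contact_field_hat g) (contact_field_hat f) (c := c - d z)).
  by rewrite subr_eq0.
apply: bracket_eigen => [||q]; [exact: hM | exact: contact_field_deriv |].
exists (d q); first exact: hd.
case: (indexP q) => [i ->|->].
  rewrite contact_field_lower linearD linearZ /= (deriv_eigenM hM (hd _) (hp _)) hp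
    scalerDr.
  rewrite !scalerA; congr (_ *: _ + _ *: _); rewrite -(dd i); ring.
rewrite contact_field_top subrK linearB /= raddfMn /= hf scalerBr scalerMnr; congr (_
  - _).
rewrite /euler linear_sum scaler_sumr; apply: eq_bigr => i _ /=.
by rewrite (deriv_eigenM hM (hd _) (hp _)); congr (_ *: _); ring.
Qed.

Lemma euler_lower_pair j : euler (xl j * xl (rev_ord j)) = (xl j * xl (rev_ord j)) *+ 2.
Proof.
rewrite /euler (bigD1 j) //= (bigD1 (rev_ord j)) ?rev_ord_neq //= big1 ?addr0 => [|i
  /andP[ij ij']].
  rewrite !pderivM !pderiv_var !(inj_eq (@lower_inj m)) !eqxx (negPf (rev_ord_neq j))
    eq_sym (negPf (rev_ord_neq j)).
  by rewrite !(mulr0, mul0r, mul1r, mulr1, addr0, add0r) mulr2n [xl (rev_ord j) *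
    _]mulrC.
by rewrite pderivM !pderiv_var !(inj_eq (@lower_inj m)) (negPf ij) (negPf ij') mul0r
  mulr0 addr0 mulr0.
Qed.

Lemma contact_monomial_mem j l (b : nat) : l != j -> (b <= 2)%N ->
  contact_field (xl j ^+ (p - 1) * xl l ^+ b) \in contact chp m.
Proof.
move=> lj le_b; pose g := xl j * xl (rev_ord j).
pose c i : k := sg j * ((rev_ord j == i)%:R - (j == i)%:R).
pose d (q : 'I_n) : k := if insub (q : nat) is Some i then c i else 0.
have d_low i : d (lower i) = c i by rewrite /d insub_lower.
have d_top : d z = 0 by rewrite /d insub_max.
have c_rev i : c (rev_ord i) = - c i.
  by rewrite /c (inj_eq rev_ord_inj) [j == rev_ord i]eq_sym rev_ord_eq [i ==
    _]eq_sym; ring.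
have gtop : 'd_z g = 0.
  by rewrite pderivM !pderiv_var ![z == _]eq_sym !lower_neq_max mul0r mulr0 addr0.
have hd q : contact_field g (x q) = d q *: x q.
  case: (indexP q) => [i ->|->]; last first.
    by rewrite contact_field_top euler_lower_pair subrr d_top scale0r.
  rewrite contact_field_lower gtop mulr0 addr0 pderivM !pderiv_var !(inj_eq
    (@lower_inj m)) d_low /c.
  rewrite rev_ord_eq (inj_eq rev_ord_inj) [rev_ord j == i]eq_sym [j == i]eq_sym.
  have [->|ij] := eqVneq i j.
    by rewrite eq_sym (negPf (rev_ord_neq j)) mul0r add0r mulr1 sub0r mulrN1.
  have [->|ij'] := eqVneq i (rev_ord j); last by rewrite mul0r mulr0 addr0 subrr
    mulr0 scale0r scaler0.
  by rewrite mul1r mulr0 addr0 subr0 mulr1 hsign_rev opprK.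
have hM := contact_field_deriv g.
have hf : contact_field g (xl j ^+ (p - 1) * xl l ^+ b) =
    (c j *+ (p - 1) + c l *+ b) *: (xl j ^+ (p - 1) * xl l ^+ b).
  apply: deriv_eigenM => //; apply: deriv_eigenX => //; by rewrite hd d_low.
apply: (contact_field_mem hd _ hf) => [i|]; first by rewrite !d_low c_rev subrr.
have cj : c j = - sg j by rewrite /c eqxx (negPf (rev_ord_neq j)) sub0r mulrN1.
have sg0 : sg j != 0.
  by apply/eqP => s0; have := hsign_sqr k j; rewrite s0 mul0r => /esym/eqP; rewrite
    oner_eq0.
(* Since g does not involve the last variable, d z = 0. The eigenvalue is a sign times b + 1 or
   times 1, according to whether l is the partner of j. *)
rewrite d_top -[X in X + _]mulr_natr natr_p1 // mulrN1 cj opprK.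
have [lj'|lj'] := eqVneq l (rev_ord j).
  rewrite lj' c_rev cj opprK -[X in _ + X]mulr_natr.
  have -> : sg j + sg j * b%:R = sg j * b.+1%:R by rewrite -[b.+1]add1n natrD; ring.
  rewrite mulf_neq0 //; apply: (natr_unit chp); have := p_gt3; lia.
by rewrite /c [j == l]eq_sym (negPf lj) [rev_ord j == l]eq_sym (negPf lj') subrr
  mulr0 mul0rn addr0.
Qed.

Lemma contact_top_mem : contact_field (x z ^+ (p - 1)) \in contact chp m.
Proof.
pose d (q : 'I_n) : k := if (insub (q : nat) : option 'I_(2 * m)) is Some i then 1
  else 2%:R.
have dz0 i : dl i (x z) = 0 by rewrite pderiv_var lower_neq_max.
have dzz : 'd_z (x z) = 1 by rewrite pderiv_var eqxx.
have hd q : contact_field (x z) (x q) = d q *: x q.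
  rewrite /d; case: (indexP q) => [i ->|->].
    by rewrite contact_field_lower dz0 scaler0 add0r dzz mulr1 scale1r.
  rewrite contact_field_top /euler big1 => [|i _]; last by rewrite dz0 mulr0.
  by rewrite subr0 scaler_nat.
have hM := contact_field_deriv (x z).
apply: (contact_field_mem hd) (deriv_eigenX _ hM (hd z)) _ => [i|].
  by rewrite /d !insub_lower insub_max.
(* The field of x_z is the grading, for which x_z^(p-1) has eigenvalue 2 (p - 1) = -2. This differs
   from d z = 2 because 4 is invertible. *)
rewrite /d insub_max -[X in X != _]mulr_natr natr_p1 // mulrN1 -subr_eq0 -opprD
  oppr_eq0 -natrD.
by apply: (natr_unit chp); have := p_gt4 chp p_gt3; lia.
Qed.

Lemma contact_hat_closed : lie_closed hat.
Proof. exact: line_stabiliser_closed. Qed.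

Lemma contact_sub_hat : (contact chp m <= hat)%VS.
Proof. exact/derived_subv/contact_hat_closed. Qed.

Lemma contact_witt : (contact chp m <= witt chp n)%VS.
Proof. exact: subv_trans contact_sub_hat (capvSl _ _). Qed.

Lemma contact_dilation_stable : dilation_stable (@contact_weight m) (contact chp m).
Proof.
apply/derived_dilation_stable/(@line_stabiliser_dilation_stable _ _ _ _ _ _ 2) => s s0.
rewrite omegaKE linearD linear_sum scalerDr scaler_sumr /=; congr (_ + _).
  apply: eq_bigr => i _; rewrite dilation_formZ dilation_dx [dilation _ _ _ _]linearZ
    /= dilation_var.
  rewrite !contact_weight_lower !scale_fscale !fscaleA; congr (fscale _ _).
  by rewrite -!scalerAl !mul1r -scalerAr mulr1 !scalerA expr1 expr2; congr (_ *: _);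
    ring.
by rewrite dilation_dx /contact_weight eqxx.
Qed.

Lemma dform_coef a q : dform a [set q] = 'd_q a.
Proof.
rewrite /dform sum_ffunE (bigD1 q) //= !ffunE eqxx mulr1 big1 ?addr0 // => i iq.
by rewrite !ffunE (inj_eq set1_inj) eq_sym (negPf iq) mulr0.
Qed.

Lemma pderiv_eq0_const a : (forall q, 'd_q a = 0) -> a = (tcoef 0%MM a)%:A.
Proof.
move=> da; apply: tcoef_inj => u; rewrite tcoefZ tcoef1; case: eqP => [->|nu]; first
  by rewrite mulr1.
rewrite mulr0; have [ltu|[q leq]] := small_or p u; last exact: tcoef_eq0 leq.
have [q uq] : exists q, (0 < u q)%N.
  apply/existsP; apply: contra_notT nu; rewrite negb_exists => /forallP u0.
  by apply/mnmP => q; have := u0 q; rewrite -eqn0Ngt mnm0E => /eqP.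
have := tcoef_deriv (u - U_(q))%MM q a; rewrite da tcoef0 submK; last first.
  by apply/mnm_lepP => i; rewrite mnm1E; case: eqP => [<-|].
rewrite mnmBE mnm1E eqxx subn1 prednK // => /esym/eqP; rewrite mulf_eq0.
by rewrite (negPf (natr_unit chp _)) ?uq ?ltu // => /eqP.
Qed.

(* Comparing the mixed second derivatives of y (x z) shows that the multiplier
   by which y acts on the contact form vanishes. *)
Lemma contact_vertical (y : 'End(A)) (i : 'I_(2 * m)) : y \in hat -> (forall i, y (xl
  i) = 0) ->
  y (x z) = (tcoef 0%MM (y (x z)))%:A.
Proof.
move=> /mem_line_stabiliser[yM [a ya]] y0; apply: pderiv_eq0_const.
have {ya} dz_a : dform (y (x z)) = fscale a (omegaK chp m).
  rewrite -ya omegaKE linearD linear_sum /= lie_der_dx // big1 ?add0r // => j _.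
  by rewrite lie_derZ // lie_der_dx // y0 [y (_ *: _)]linearZ /= y0 scaler0 fscale0l
    !linear0 addr0.
have coefE q : 'd_q (y (x z)) = a * omegaK chp m [set q].
  by rewrite -dform_coef dz_a ffunE.
have om_top : omegaK chp m [set z] = 1.
  rewrite omegaKE ffunE sum_ffunE big1 ?add0r => [|j _]; first by rewrite ffunE eqxx.
  by rewrite !ffunE (inj_eq set1_inj) eq_sym lower_neq_max mulr0.
have om_low j : omegaK chp m [set lower j] = - sg j *: xl (rev_ord j).
  rewrite omegaKE ffunE sum_ffunE (bigD1 (rev_ord j)) //= !ffunE rev_ordK eqxx mulr1
    hsign_rev.
  rewrite (inj_eq set1_inj) lower_neq_max  addr0 big1 ?addr0 // => l lj.
  rewrite !ffunE (inj_eq set1_inj) (inj_eq (@lower_inj m)) eq_sym rev_ord_eq (negPf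
    lj) mulr0 //.
have top : 'd_z (y (x z)) = a by rewrite coefE om_top mulr1.
have low j : dl j (y (x z)) = - sg j *: (a * xl (rev_ord j)) by rewrite coefE om_low
  scalerAr.
have da j : dl j a = - sg j *: ('d_z a * xl (rev_ord j)).
  by rewrite -{1}top pderivC low linearZ /= pderivM pderiv_var eq_sym lower_neq_max
    mulr0 addr0.
suff a0 : a = 0 by move=> q; rewrite coefE a0 mul0r.
have E1 : dl (rev_ord i) (dl i (y (x z))) = - sg i *: a - 'd_z a * xl i * xl (rev_ord
  i).
  rewrite low linearZ /= pderivM pderiv_var eqxx mulr1 da hsign_rev rev_ordK opprK.
  by rewrite scalerDr -scalerAl scalerA mulNr hsign_sqr scaleN1r addrC.
have E2 : dl i (dl (rev_ord i) (y (x z))) = sg i *: a - 'd_z a * xl i * xl (rev_ord i).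
  rewrite low linearZ /= rev_ordK pderivM pderiv_var eqxx mulr1 da hsign_rev opprK.
  by rewrite scalerDr -scalerAl scalerA mulrN hsign_sqr scaleN1r addrC mulrAC.
have := E1; rewrite pderivC E2 => /addIr sa.
have sa0 : sg i *: a = 0 by apply: (oppr_eq_self0 chp p_gt3); rewrite -scaleNr.
by rewrite -[a]scale1r -(hsign_sqr k i) -scalerA sa0 scaler0.
Qed.

End Contact.

Section ContactInvariants.

Variables (k : closedFieldType) (p : nat) (chp : p \in [pchar k]) (p_gt3 : (3 < p)%N)
  (m : nat).
Local Notation n := (2 * m).+1.
Local Notation x := (@tvar k p chp n).
Local Notation z := (@ord_max (2 * m)).
Local Notation w := (@contact_weight m).

Lemma contact_weight_gt0 q : (0 < w q)%N.
Proof. by rewrite /contact_weight; case: ifP. Qed.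

Lemma contact_invariant (f : dual (contact chp m) -> k) : (1 <= m)%N ->
  polynomial_function f -> coadjoint_invariant f -> forall chi, f chi = f 0.
Proof.
move=> m1; have m2 : (0 < 2 * m)%N by rewrite muln_gt0.
pose i0 : 'I_(2 * m) := Ordinal m2.
pose Q := partner w (@contact_partner m).
have cL : lie_closed (contact chp m) by apply: cartan_type_closed; constructor.
have p5 := p_gt4 chp p_gt3.
(* For the field e with Hamiltonian x_z^(p-1), this is the monomial that appears in [e, d/dz]
   (x_(i0)). *)
pose u : 'X_{1..n} := (U_(z) *+ (p - 3) + U_(lower i0))%MM.
have u_small j c : (1 < c)%N -> j != z -> (u j < c)%N.
  by move=> c1 /negPf jz; rewrite mnmDE mulmnE !mnm1E eq_sym jz mul0n add0n; case:
    eqP => _ //; apply: ltnW.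
(* The last entry is not summed over the lower indices, because their number
   2m may vanish in k. *)
pose chi0 : dual (contact chp m) := probe_dual w (contact chp m) Q + entry (contact
  chp m) u (lower i0).
have stL := @contact_dilation_stable _ _ chp m.
apply: (graded_criterion p_gt3 (contact_witt chp m) cL stL (chi0 := chi0)).
  apply: contractedD; first exact: (probe_contracted p_gt3 (contact_witt chp m) stL Q
    contact_weight_gt0).
  apply: entry_contracted => //.
  rewrite wdegD wdegU wdegU1 contact_weight_lower {1}/contact_weight eqxx; lia.
move=> y Ly yM ylow y_chi.
have y_chiE e : e \in contact chp m -> is_deriv e -> (e \o e = 0)%VF ->
    probe w Q (lie_bracket e y) + tcoef u (lie_bracket e y (x (lower i0))) = 0.
  move=> Le eM ee; have Lb := cL _ _ Le Ly.
  have := y_chi e Le eM ee (vsproj _ (lie_bracket e y)) (vsprojK Lb).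
  by rewrite pairingD probe_dualE entryE vsprojK.
have neq_max q : w q == 1%N -> q != z by case/contact_weight1 => i ->; rewrite
  lower_neq_max.
have y_low j : y (x (lower j)) = 0.
  (* The additional coefficient does not disturb the other tests: x_q occurs at most once in u for q
     != z, while the bracket is divisible by x_q^(p-3). *)
  have yp : probed w Q (contact chp m) y.
    move=> q e /neq_max qz Le eM ed; have := y_chiE e Le eM (deriv_square_zero p_gt3
      eM ed).
    have [b ->] := bracket_divisible p_gt3 (lower i0) eM yM ed.
    by rewrite tcoef_lt ?addr0 // u_small //; lia.
  (* The sign is opposite to [hsign] as in [contact_field]; the value 0 at the last index is a
     default. *)
  pose sigma (q : 'I_n) : k := if (insub (q : nat) : option 'I_(2 * m)) is Some i
    then - hsign k i else 0.
  have sigma_lower i : sigma (lower i) = - hsign k i by rewrite /sigma insub_lower.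
  apply: (symplectic_criterion p_gt3 (sigma := sigma) contact_weight_gt0
    (@contact_partnerK m)) yM ylow yp _ _.
  - by move=> _ /contact_weight1[i ->]; rewrite contact_partner_lower
    contact_weight_lower.
  - move=> _ /contact_weight1[i ->]; rewrite contact_partner_lower (inj_eq
    (@lower_inj m)).
    exact: rev_ord_neq.
  - by move=> _ /contact_weight1[i ->]; rewrite sigma_lower mulrNN hsign_sqr.
  - by move=> _ /contact_weight1[i ->]; rewrite contact_partner_lower !sigma_lower
    hsign_rev.
  - move=> _ _ b /contact_weight1[i ->] /contact_weight1[l ->].
    rewrite (inj_eq (@lower_inj m)) => li le_b.
    set g := x (lower i) ^+ (p - 1) * x (lower l) ^+ b.
    have gz : pderiv chp z g = 0.
      rewrite pderivM !pderiv_power ![z == _]eq_sym !lower_neq_max !mulr0 !scale0r.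
      by rewrite mul0r mulr0 addr0.
    exists (contact_field g); last first.
      move=> _ /contact_weight1[q ->].
      by rewrite contact_field_lower gz mulr0 addr0 contact_partner_lower sigma_lower.
    have ll : lower l != lower i by rewrite (inj_eq (@lower_inj m)).
    split; [exact: contact_monomial_mem | exact: contact_field_deriv |].
    move=> q; case: (indexP q) => [{}q ->|->].
      rewrite contact_field_lower gz mulr0 addr0.
      have [c ->] := pderiv_divisible chp p_gt3 (lower (rev_ord q)) b ll.
      by exists (- hsign k q *: c); rewrite scalerAr.
    have /fin_all_exists[c gc] : forall q, exists c, pderiv chp (lower q) g = x
      (lower i) ^+ (p - 2) * c.
      by move=> q'; apply: pderiv_divisible.
    exists (x (lower i) * x (lower l) ^+ b *+ 2 - \sum_q x (lower q) * c q).
    rewrite contact_field_top mulrBr mulr_sumr mulrnAr mulrA -exprSr; congr (_ *+ 2 -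
      _).
      by rewrite /g; congr (_ ^+ _ * _); lia.
    by apply: eq_bigr => q' _; rewrite gc mulrCA.
  by rewrite contact_weight_lower.
apply: deriv_ext => // [a b|q]; first by rewrite !lfunE /= mul0r mulr0 addr0.
rewrite lfunE /=; case: (indexP q) => [i ->|->] //.
have yz := contact_vertical p_gt3 i0 (subvP (contact_sub_hat chp m) _ Ly) y_low.
set c := tcoef _ _ in yz; rewrite yz.
(* At this point y is c d/dz, and it remains to show c = 0. *)
pose e := contact_field (x z ^+ (p - 1)); have eM : is_deriv e := contact_field_deriv _.
have dz : pderiv chp z (x z ^+ (p - 1)) = - x z ^+ (p - 2).
  rewrite pderiv_power eqxx mulr1 natr_p1 // scaleN1r; congr (- (_ ^+ _)); lia.
have e_low i : e (x (lower i)) = - (x (lower i) * x z ^+ (p - 2)).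
  by rewrite contact_field_lower dz pderiv_power lower_neq_max mulr0 scale0r scaler0
    add0r mulrN.
have ed : divisible_at z (p - 2) e.
  move=> q'; case: (indexP q') => [i ->|->].
    by exists (- x (lower i)); rewrite e_low mulrN mulrC.
  exists (x z *+ 2); rewrite contact_field_top /euler big1 ?subr0 => [|i _].
    by rewrite mulrnAr -exprSr; congr (_ ^+ _ *+ 2); lia.
  by rewrite pderiv_power lower_neq_max mulr0 scale0r mulr0.
have := y_chiE e (contact_top_mem chp p_gt3 m) eM (deriv_square_zero p_gt3 eM ed).
(* The bracket is divisible by x_z^(p-3), which the probes at variables of weight 1 do not see; only
   the additional coefficient remains, with value -2 c. *)
rewrite [X in X + _]/probe big1 ?add0r => [|q' /neq_max qz]; last first.
  by have [b ->] := bracket_divisible p_gt3 q' eM yM ed; rewrite probe_at_lt.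
have -> : lie_bracket e y (x (lower i0)) = (- 2%:R * c) *: (x z ^+ (p - 3) * x (lower
  i0)).
  have pE : (p - 2 = (p - 3).+1)%N by lia.
  rewrite lie_bracketE y_low e_low linear0 sub0r [y (- _)]linearN /= opprK yM y_low
    mul0r add0r.
  rewrite {1}pE is_deriv_exp // -pE yz -scaler_nat natr_p2 // -scalerAl mul1r.
  by rewrite -!scalerAr mulr1 scalerA mulrC [x _ * _]mulrC.
rewrite tcoefZ tcoefXM; last first.
  move=> q'; have [->|qz] := eqVneq q' z; last by apply: u_small => //; lia.
  by rewrite mnmDE mulmnE !mnm1E eqxx lower_neq_max; lia.
have -> : tcoef U_(lower i0)%MM (x (lower i0)) = 1.
  rewrite -[x (lower i0)]mulr1 -[U_(lower i0)%MM]addm0 tcoef_varD ?tcoef1 ?eqxx // =>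
    q'.
  by rewrite mnmDE mnm0E mnm1E; case: eqP; lia.
rewrite mulr1 => /eqP; rewrite mulf_eq0 oppr_eq0 (negPf (natr_unit chp _)) /=; last lia.
by move/eqP->; rewrite scale0r.
Qed.

End ContactInvariants.

Theorem theorem6 (k : closedFieldType) (p : nat) (chp : p \in [pchar k])
    (p_gt3 : (3 < p)%N) (n : nat) (L : {vspace 'End(trunc chp n)})
    (HL : cartan_type L) (f : dual L -> k) :
  polynomial_function f /\ coadjoint_invariant f <->
  exists c : k, forall chi : dual L, f chi = c.
Proof.
split=> [[polyf invf] | [c fc]]; last first.
  split=> [|g _ chi]; last by rewrite !fc.
  by exists c%:MP => chi; rewrite fc mevalC.
exists (f 0); case: HL f polyf invf => {n L} [n _|n n2|m _|m m1] f.
- exact: witt_invariant.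
- exact: special_invariant.
- exact: hamiltonian_invariant.
exact: contact_invariant.
Qed.
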